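(* There exist a positive real number $\varepsilon$ and a positive integer $\kappa_3$ such that the following holds. If $(G,\sigma)$ is a connected signed graph with smallest eigenvalue $\lambda_{\min}(G,\sigma)>-3-\varepsilon$ and minimum valency at least $\kappa_3$, then $\lambda_{\min}(G,\sigma)\geq -3$, and the lattice $\Lambda(G,\sigma)$ associated with $(G,\sigma)$ is (isomorphic to) a sublattice of a direct sum of a standard lattice $\mathbb{Z}^n$ and copies of the root lattice $E_8$, i.e. of $\mathbb{Z}^n\oplus E_8^{\oplus k}$ for some non-negative integers $n,k$.
   Context: All graphs are finite, undirected, simple and non-empty. A signed graph $(G,\sigma)$ is a graph $G=(V(G),E(G))$ together with a function $\sigma:E(G)\to\{+,-\}$. It is connected if $G$ is connected, and the valency of a vertex $x$ is its number of neighbours in $G$ (regardless of signs). The adjacency matrix $A(G,\sigma)$ is the symmetric matrix indexed by $V(G)$ whose $(x,y)$-entry is $1$ if $\{x,y\}\in E(G)$ with $\sigma(\{x,y\})=+$, is $-1$ if $\{x,y\}\in E(G)$ with $\sigma(\{x,y\})=-$, and is $0$ otherwise. The eigenvalues of $(G,\sigma)$ are those of $A(G,\sigma)$, and $\lambda_{\min}(G,\sigma)$ is the smallest one. Associated lattice: let $\lambda=\lambda_{\min}(G,\sigma)$. The matrix $A(G,\sigma)-\lfloor\lambda\rfloor\mathbf{I}$ is positive semidefinite, so it equals $N^TN$ for some real matrix $N$. The integral lattice generated (over $\mathbb{Z}$) by the columns of $N$ is denoted $\Lambda(G,\sigma)$; up to isomorphism (isometry) it does not depend on the choice of $N$. ''Direct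 sum'' means orthogonal direct sum. The root lattice $E_8$ is $D_8\cup(\mathbf{c}+D_8)\subset\mathbb{R}^8$, where $D_8=\{\mathbf{x}\in\mathbb{Z}^8\mid \sum_{i=1}^8 x_i \text{ is even}\}$ and $\mathbf{c}=\frac12(1,1,1,1,1,1,1,1)^T$. *)

(* Defs.v *)
From mathcomp Require Import all_boot all_order all_algebra.
From mathcomp Require Import classical_sets functions reals.

Set Implicit Arguments.
Unset Strict Implicit.
Unset Printing Implicit Defensive.

Import Order.TTheory GRing.Theory Num.Theory.
Local Open Scope classical_set_scope.
Local Open Scope ring_scope.

Record sgraph := SGraph {
  vertex :> finType;
  adj : rel vertex;
  adj_sym : symmetric adj;
  adj_irr : irreflexive adj;
  vertex_gt0 : (0 < #|vertex|)%N }.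

(* The sign of the edge {x, y} is + iff [positive [set x; y]]; the value of
   [positive] on sets that are not edges is never used. *)
Record signed_graph := SignedGraph {
  underlying :> sgraph;
  positive : {set underlying} -> bool }.

Definition connected (G : sgraph) : Prop :=
  forall x y : G, connect (@adj G) x y.

Definition valency (G : sgraph) (x : G) : nat := #|[pred y : G | adj x y]|.

Section Spectrum.
Variable R : realType.

Definition signed_entry (G : signed_graph) (x y : G) : R :=
  if adj x y then (if positive [set x; y]%SET then 1 else -1) else 0.

Definition adjmx (G : signed_graph) : 'M[R]_#|G| :=
  \matrix_(i, j) signed_entry (enum_val i) (enum_val j).

(* A real symmetric matrix of positive order has a finite nonempty set of
   eigenvalues, so this infimum is the smallest one. *)
Definition lambda_min (G : signed_graph) : R :=
  inf [set a | eigenvalue (adjmx G) a].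

(* A(G, sigma) - floor(lambda_min) I *)
Definition shifted_adjmx (G : signed_graph) : 'M[R]_#|G| :=
  adjmx G - (Num.floor (lambda_min G))%:~R%:M.

End Spectrum.

Section Lattices.
Variable R : realType.

Definition dot m (x y : 'cV[R]_m) : R := \sum_(i < m) x i 0 * y i 0.

(* The Z-span of the columns of N. When N^T N = A(G, sigma) -
   floor(lambda_min) I, this is a copy of the lattice Lambda(G, sigma). *)
Definition column_lattice m n (N : 'M[R]_(m, n)) : set 'cV[R]_m :=
  range (fun z : {ffun 'I_n -> int} => \sum_(j < n) col j N *~ z j).

Definition sublattice m (L M : set 'cV[R]_m) : Prop :=
  [/\ L `<=` M, L 0 & forall x y, L x -> L y -> L (x - y)].

Definition lattice_isometry m p (L : set 'cV[R]_m) (M : set 'cV[R]_p)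
    (f : 'cV[R]_m -> 'cV[R]_p) : Prop :=
  [/\ set_bij L M f,
      forall x y, L x -> L y -> f (x + y) = f x + f y &
      forall x y, L x -> L y -> dot (f x) (f y) = dot x y].

Definition isomorphic_lattices m p (L : set 'cV[R]_m) (M : set 'cV[R]_p) :
  Prop := exists f, lattice_isometry L M f.

Definition iso_to_sublattice m p (L : set 'cV[R]_m) (M : set 'cV[R]_p) :
  Prop := exists2 M', sublattice M' M & isomorphic_lattices L M'.

Definition Zlattice n : set 'cV[R]_n :=
  range (fun z : 'cV[int]_n => map_mx intr z).

Definition D8 : set 'cV[R]_8 :=
  [set map_mx intr z | z in [set z : 'cV[int]_8 | (2 %| \sum_i z i 0)%Z]].

Definition E8 : set 'cV[R]_8 := D8 `|` [set const_mx 2^-1 + x | x in D8].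

(* Orthogonal direct sum, inside R^m (+) R^p = R^(m + p). *)
Definition lattice_sum m p (L : set 'cV[R]_m) (M : set 'cV[R]_p) :
    set 'cV[R]_(m + p) :=
  [set v | L (usubmx v) /\ M (dsubmx v)].

(* The base case is the zero lattice R^0; [(k.+1 * m)%N] is convertible to
   [(m + k * m)%N]. *)
Fixpoint lattice_pow m (L : set 'cV[R]_m) (k : nat) : set 'cV[R]_(k * m) :=
  match k return set 'cV[R]_(k * m) with
  | 0 => setT
  | k'.+1 => lattice_sum L (@lattice_pow m L k')
  end.

End Lattices.

Arguments adjmx R G : clear implicits.
Arguments lambda_min R G : clear implicits.
Arguments shifted_adjmx R G : clear implicits.
Arguments Zlattice R n : clear implicits.
Arguments E8 R : clear implicits.
Arguments lattice_pow {R m} L k.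

(* Main.v *)
Require Import Defs.
From mathcomp Require Import boolp classical_sets functions reals.
From mathcomp Require Import all_boot all_order all_algebra.
From mathcomp Require Import ring lra zify.

Set Implicit Arguments.
Unset Strict Implicit.
Unset Printing Implicit Defensive.

Import Order.TTheory GRing.Theory Num.Theory.
Local Open Scope ring_scope.

(** Let [A] be the adjacency matrix of the signed graph, with smallest eigenvalue above
    [-3 - eps] and all valencies large. Then [A + 3 + eps] is the Gram matrix of real vectors
    [v x], of norm [3 + eps], with inner products -1, 0, 1 between different vertices. (Here and
    below, the norm of a vector is its inner product with itself.)

    By Ramsey's theorem each vertex lies in a large clique whose edges are positive after
    switching: many neighbours with pairwise nonpositive inner products would be too long
    together ([vertex_in_clique]). The centroid of a large clique is almost a unit vector, and
    Bessel's inequality shows that the inner products of a centroid with the vertices and with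
    other centroids are almost integers ([near_centroid]). So up to sign there is a family of
    almost orthonormal centroids, and each vertex has inner product close to [+-1] with at least
    one and at most three of them, and close to 0 with the others. Subtracting these directions
    gives an integral form [remainder_form], with diagonal entries 0, 1, 2, such that
    [A + 3 = remainder_form + T T^t] with [T] integral. It suffices to embed [remainder_form] in
    [Z^n + E_8^k]: then [A + 3] embeds too, so it is positive semidefinite.

    On sets of bounded size, [remainder_form] is as close as desired to a Gram matrix, and an
    integral form from a finite list which is close to a positive semidefinite one is itself
    positive semidefinite ([psd_stable]). So the theorem follows from a local-global principle
    ([embeds_of_local_psd]): for some absolute constant [K], an integral form with diagonal
    entries at most 2 which is positive semidefinite on all sets of at most [K] elements embeds
    in some [Z^n + E_8^k].

    For forms that are positive semidefinite and connected, this is a piece of the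
    classification of root lattices ([psd_Zrep_or_E8rep]). One looks at a maximal frame in the
    lattice: of unit vectors, of type [D_n] with [n >= 4], or failing these of type [A_n]. Either
    the frame captures everything and the lattice is in [Z^n], or some root has half-integral
    coordinates over [D_5], and the part orthogonal to [D_5] is governed by a regular tetrahedron,
    as it is in [E_8]. In general, one adds the elements one at a time, keeping the set connected.
    A large set without repetitions does not fit in [E_8], so it is in some [Z^n]. The inner
    products of the next element with a large connected piece of bounded size determine an
    integral coordinate vector: a real solution of norm at most 2 has a coordinate near 0, and
    the lattice of the piece then forces all its coordinates near integers ([rich_functional]).
    These local solutions glue ([glue_functionals]).

    When the smallest eigenvalue is at least -2, the matrix to embed is [A + 2] or [A + 1]; it is
    positive semidefinite, and the local-global principle applies to it directly. *)

(** * The standard inner product *)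

Section InnerProduct.
Variable R : realType.
Implicit Types (p q : nat).

Lemma dotC p (u v : 'cV[R]_p) : dot u v = dot v u.
Proof. by apply: eq_bigr => i _; rewrite mulrC. Qed.

Lemma dotDl p (u v w : 'cV[R]_p) : dot (u + v) w = dot u w + dot v w.
Proof. by rewrite -big_split; apply: eq_bigr => i _; rewrite mxE mulrDl. Qed.

Lemma dotZl p (c : R) (u w : 'cV[R]_p) : dot (c *: u) w = c * dot u w.
Proof. by rewrite mulr_sumr; apply: eq_bigr => i _; rewrite mxE mulrA. Qed.

Lemma dotNl p (u w : 'cV[R]_p) : dot (- u) w = - dot u w.
Proof. by rewrite -scaleN1r dotZl mulN1r. Qed.

Lemma dotBl p (u v w : 'cV[R]_p) : dot (u - v) w = dot u w - dot v w.
Proof. by rewrite dotDl dotNl. Qed.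

Lemma dot0l p (w : 'cV[R]_p) : dot 0 w = 0.
Proof. by rewrite -(scale0r 0) dotZl mul0r. Qed.

Lemma dotDr p (u v w : 'cV[R]_p) : dot w (u + v) = dot w u + dot w v.
Proof. by rewrite !(dotC w) dotDl. Qed.

Lemma dotZr p (c : R) (u w : 'cV[R]_p) : dot w (c *: u) = c * dot w u.
Proof. by rewrite !(dotC w) dotZl. Qed.

Lemma dotNr p (u w : 'cV[R]_p) : dot w (- u) = - dot w u.
Proof. by rewrite !(dotC w) dotNl. Qed.

Lemma dotBr p (u v w : 'cV[R]_p) : dot w (u - v) = dot w u - dot w v.
Proof. by rewrite dotDr dotNr. Qed.

Lemma dot0r p (w : 'cV[R]_p) : dot w 0 = 0.
Proof. by rewrite dotC dot0l. Qed.

Definition dotE := (dotDl, dotDr, dotNl, dotNr, dotZl, dotZr, dot0l, dot0r).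

Lemma dot_suml p I (r : seq I) (P : pred I) (F : I -> 'cV[R]_p) w :
  dot (\sum_(i <- r | P i) F i) w = \sum_(i <- r | P i) dot (F i) w.
Proof.
apply: (big_morph (fun u => dot u w)) => [u v|]; first exact: dotDl.
exact: dot0l.
Qed.

Lemma dot_sumr p I (r : seq I) (P : pred I) (F : I -> 'cV[R]_p) w :
  dot w (\sum_(i <- r | P i) F i) = \sum_(i <- r | P i) dot w (F i).
Proof. by rewrite dotC dot_suml; apply: eq_bigr => i _; rewrite dotC. Qed.

Lemma dot_ge0 p (u : 'cV[R]_p) : 0 <= dot u u.
Proof. by apply: sumr_ge0 => i _; rewrite -expr2 sqr_ge0. Qed.

Lemma dot_eq0 p (u : 'cV[R]_p) : dot u u = 0 -> u = 0.
Proof.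
move=> u0; apply/matrixP => i j; rewrite ord1 mxE.
have /psumr_eq0P u00 : forall k : 'I_p, true -> 0 <= u k 0 * u k 0.
  by move=> k _; rewrite -expr2 sqr_ge0.
by have /eqP := u00 u0 i isT; rewrite mulf_eq0 orbb => /eqP.
Qed.

Lemma dot_col_mx p q (u v : 'cV[R]_p) (u' v' : 'cV[R]_q) :
  dot (col_mx u u') (col_mx v v') = dot u v + dot u' v'.
Proof.
rewrite /dot big_split_ord /=; congr (_ + _); apply: eq_bigr => i _.
  by rewrite !col_mxEu.
by rewrite !col_mxEd.
Qed.

Lemma cauchy_schwarz p (u v : 'cV[R]_p) : dot u v ^+ 2 <= dot u u * dot v v.
Proof.
have [v0|v0] := eqVneq (dot v v) 0.
  by rewrite (dot_eq0 v0) !dot0r expr0n /= mulr0.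
have vp : 0 < dot v v by rewrite lt_neqAle eq_sym v0 dot_ge0.
have := dot_ge0 (dot v v *: u - dot u v *: v).
rewrite !dotE (dotC v u).
set a := dot u u; set b := dot u v; set c := dot v v in vp *.
rewrite [X in 0 <= X](_ : _ = c * (a * c - b ^+ 2)); last by ring.
by rewrite (pmulr_rge0 _ vp) subr_ge0.
Qed.

Lemma dot_norm_le p (u v : 'cV[R]_p) (c : R) :
  0 <= c -> dot u u * dot v v <= c ^+ 2 -> `|dot u v| <= c.
Proof.
move=> c0 le_c; rewrite -ler_sqr ?nnegrE // real_normK ?num_real //.
exact: le_trans (cauchy_schwarz u v) le_c.
Qed.

End InnerProduct.

(** * Positive semidefinite forms and Gram vectors *)

Section PositiveForms.
Variables (R : realType) (X : finType).
Implicit Types (D T : {set X}) (S : X -> X -> R).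

Definition psd_on D S :=
  forall u : X -> R, 0 <= \sum_(x in D) \sum_(y in D) u x * u y * S x y.

Definition gram_on D S p (v : X -> 'cV[R]_p) :=
  {in D &, forall x y, dot (v x) (v y) = S x y}.

Lemma quad_gram D p (v : X -> 'cV[R]_p) (u : X -> R) :
  \sum_(x in D) \sum_(y in D) u x * u y * dot (v x) (v y) =
  dot (\sum_(x in D) u x *: v x) (\sum_(x in D) u x *: v x).
Proof.
rewrite dot_suml; apply: eq_bigr => x _; rewrite dot_sumr.
by apply: eq_bigr => y _; rewrite dotZl dotZr mulrA.
Qed.

Lemma gram_psd D S p (v : X -> 'cV[R]_p) : gram_on D S v -> psd_on D S.
Proof.
move=> vS u.
have -> : \sum_(x in D) \sum_(y in D) u x * u y * S x y =
          \sum_(x in D) \sum_(y in D) u x * u y * dot (v x) (v y).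
  by apply: eq_bigr => x xD; apply: eq_bigr => y yD; rewrite vS.
by rewrite quad_gram dot_ge0.
Qed.

Lemma psd_onS D T S : T \subset D -> psd_on D S -> psd_on T S.
Proof.
move=> sTD psdD u; have := psdD (fun x => if x \in T then u x else 0).
have sum_if (F : X -> R) :
    \sum_(x in D) (if x \in T then F x else 0) = \sum_(x in T) F x.
  rewrite -big_mkcondr; apply: eq_bigl => x.
  by apply: andb_idl => /(subsetP sTD).
rewrite -sum_if; congr (0 <= _); apply: eq_bigr => x _.
case: ifP => _; last by rewrite big1 // => y _; rewrite !mul0r.
by rewrite -sum_if; apply: eq_bigr => y _; case: ifP; rewrite ?mulr0 ?mul0r.
Qed.

(** Linear functionals on a span are inner products: a prescription [f] that kills every
    linear relation between the vectors [v y] lies in the row space of their Gram matrix. *)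
Lemma gram_solve D p (v : X -> 'cV[R]_p) (f : X -> R) :
  (forall u : X -> R, \sum_(x in D) u x *: v x = 0 ->
     \sum_(x in D) u x * f x = 0) ->
  exists c : X -> R,
    {in D, forall y, dot (\sum_(x in D) c x *: v x) (v y) = f y}.
Proof.
move=> fker.
pose V : 'M[R]_(p, #|X|) :=
  \matrix_(i, j) (if enum_val j \in D then v (enum_val j) i 0 else 0).
pose g : 'rV[R]_#|X| :=
  \row_j (if enum_val j \in D then f (enum_val j) else 0).
have sum_rank (F : 'I_#|X| -> R) : \sum_j F j = \sum_x F (enum_rank x).
  by rewrite (reindex enum_rank) //; apply: onW_bij; exact: enum_rank_bij.
have Vcol (k : 'cV[R]_#|X|) :
    V *m k = \sum_(x in D) k (enum_rank x) 0 *: v x.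
  apply/matrixP => i j; rewrite ord1 mxE summxE sum_rank [RHS]big_mkcond.
  apply: eq_bigr => x _.
  by rewrite !mxE enum_rankK; case: ifP => _; rewrite ?mxE ?mul0r // mulrC.
have gV : (g <= V^T *m V)%MS.
  rewrite submxE; apply/eqP/matrixP => i j; rewrite ord1 [RHS]mxE.
  set C := cokermx _; pose k := col j C.
  have Vk0 : V *m k = 0.
    apply: dot_eq0; have /matrixP/(_ 0 0) : k^T *m (V^T *m V *m k) = 0.
      by rewrite /k colE (mulmxA _ C) mulmx_coker mul0mx mulmx0.
    rewrite mulmxA mulmxA -trmx_mul -mulmxA [X in _ = X]mxE => <-.
    by rewrite [RHS]mxE; apply: eq_bigr => a _; rewrite [in RHS]mxE.
  have := fker (fun x => k (enum_rank x) 0); rewrite -Vcol => /(_ Vk0) <-.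
  rewrite mxE sum_rank [RHS]big_mkcond; apply: eq_bigr => x _.
  by rewrite !mxE enum_rankK; case: ifP => _; rewrite ?mul0r // mulrC.
case/submxP: gV => a ga; exists (fun x => a 0 (enum_rank x)) => y yD.
have -> : \sum_(x in D) a 0 (enum_rank x) *: v x = V *m a^T.
  by rewrite Vcol; apply: eq_bigr => x _; rewrite mxE.
have /matrixP/(_ 0 (enum_rank y)) := ga.
rewrite [LHS]mxE enum_rankK yD => ->; rewrite mulmxA -[a *m V^T]trmxK trmx_mul trmxK.
by rewrite [RHS]mxE; apply: eq_bigr => i _; rewrite [in RHS]mxE; congr (_ * _); rewrite mxE enum_rankK yD.
Qed.

Lemma quad_setU1 D S (u : X -> R) x : x \notin D -> (forall y z, S y z = S z y) ->
  \sum_(y in x |: D) \sum_(z in x |: D) u y * u z * S y z =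
  u x ^+ 2 * S x x + 2 * u x * (\sum_(y in D) u y * S x y)
  + \sum_(y in D) \sum_(z in D) u y * u z * S y z.
Proof.
move=> xD symS; rewrite big_setU1 //= big_setU1 //=.
under [X in _ + X = _]eq_bigr do rewrite big_setU1 //=.
rewrite big_split /= addrA; congr (_ + _).
have -> : \sum_(z in D) u x * u z * S x z = u x * \sum_(y in D) u y * S x y.
  by rewrite mulr_sumr; apply: eq_bigr => z _; rewrite mulrA.
have -> : \sum_(z in D) u z * u x * S z x = u x * \sum_(y in D) u y * S x y.
  by rewrite mulr_sumr; apply: eq_bigr => z _; rewrite symS; ring.
by ring.
Qed.

Lemma linear_ge0_eq0 (a b : R) : (forall s : R, 0 <= b + s * a) -> a = 0.
Proof.
move=> ge0; have [//|a0] := eqVneq a 0.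
have := ge0 (- (b + 1) / a); rewrite mulfVK //; lra.
Qed.

(** One step of a Cholesky factorization. A linear relation between the [v y] has zero norm,
    so by positivity it is orthogonal to [x]; hence the orthogonal projection [w] of [x] on
    their span is defined, and what positivity leaves is [|w|^2 <= S x x]. *)
Lemma psd_extend D S p (v : X -> 'cV[R]_p) x : x \notin D ->
  (forall y z, S y z = S z y) -> gram_on D S v -> psd_on (x |: D) S ->
  exists2 w : 'cV[R]_p,
    {in D, forall y, dot w (v y) = S x y} & dot w w <= S x x.
Proof.
move=> xD symS vS psdS.
have quad (u : X -> R) (s : R) :
    0 <= s ^+ 2 * S x x + 2 * s * (\sum_(y in D) u y * S x y)
       + dot (\sum_(y in D) u y *: v y) (\sum_(y in D) u y *: v y).
  have := psdS (fun y => if y == x then s else u y).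
  have u'u y : y \in D -> (if y == x then s else u y) = u y.
    by case: eqP xD => [->|//] /negbTE->.
  rewrite quad_setU1 // eqxx -quad_gram.
  rewrite (eq_bigr (fun y => u y * S x y)) => [|y yD]; last by rewrite u'u.
  congr (0 <= _ + _); apply: eq_bigr => y yD; apply: eq_bigr => z zD.
  by rewrite !u'u // vS.
have [u uv0|c cS] := gram_solve (D := D) (v := v) (f := S x).
  apply: (@linear_ge0_eq0 _ (S x x)) => s.
  have := quad (fun y => s / 2 * u y) 1; rewrite expr1n mul1r.
  under [X in dot X]eq_bigr do rewrite -scalerA.
  rewrite -scaler_sumr uv0 scaler0 dot0l addr0 mulr1.
  suff -> : s * (\sum_(y in D) u y * S x y) =
            2 * \sum_(y in D) s / 2 * u y * S x y by [].
  by rewrite !mulr_sumr; apply: eq_bigr => y _; field.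
exists (\sum_(y in D) c y *: v y) => //.
have := quad c (-1); rewrite sqrrN expr1n mul1r.
have <- : dot (\sum_(y in D) c y *: v y) (\sum_(y in D) c y *: v y) =
          \sum_(y in D) c y * S x y.
  by rewrite dot_sumr; apply: eq_bigr => y yD; rewrite dotZr cS.
lra.
Qed.

Lemma psd_gram D S : (forall y z, S y z = S z y) -> psd_on D S ->
  exists p (v : X -> 'cV[R]_p), gram_on D S v.
Proof.
move=> symS; move: {2}#|D| (erefl #|D|) => n; elim: n D => [|n IHn] D.
  by move/eqP; rewrite cards_eq0 => /eqP-> _; exists 0%N, (fun=> 0) => x y; rewrite inE.
move=> Dn psdS; have /card_gt0P[x xD] : (0 < #|D|)%N by rewrite Dn.
have psdS' : psd_on (D :\ x) S by apply: psd_onS psdS; rewrite subD1set.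
have [|p [v vS]] := IHn _ _ psdS'; first by move: Dn; rewrite (cardsD1 x) xD => -[].
have [||w wS wx] := psd_extend _ symS vS (x := x); rewrite ?setD1K ?inE ?eqxx //.
exists (p + 1)%N, (fun y => if y == x then col_mx w (Num.sqrt (S x x - dot w w))%:M
                           else col_mx (v y) 0) => y z yD zD.
have dot_scal (a b : R) : dot (a%:M : 'cV_1) b%:M = a * b.
  by rewrite /dot big_ord1 !mxE !eqxx !mulr1n.
have [-> {y yD}|yx] := eqVneq y x; have [->{z zD}|zx] := eqVneq z x; rewrite dot_col_mx.
- by rewrite dot_scal -expr2 sqr_sqrtr ?subr_ge0 // addrC subrK.
- by rewrite dot0r addr0 wS // !inE zx.
- by rewrite dot0l addr0 dotC wS // ?symS // !inE yx.
- by rewrite dot0l addr0 vS // !inE ?yx ?zx.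
Qed.

End PositiveForms.

(** * The smallest eigenvalue of a symmetric matrix *)

Section LambdaMin.
Variable R : realType.

Definition qform n (A : 'M[R]_n) (x : 'cV[R]_n) : R := dot x (A *m x).

Lemma dot_mulmx n m (A : 'M[R]_(m, n)) (x : 'cV[R]_m) (y : 'cV[R]_n) :
  dot x (A *m y) = dot (A^T *m x) y.
Proof.
have dotM k (a b : 'cV[R]_k) : dot a b = (a^T *m b) 0 0.
  by rewrite mxE; apply: eq_bigr => i _; rewrite !mxE.
by rewrite !dotM trmx_mul trmxK mulmxA.
Qed.

Lemma mulmx_bounded n (A : 'M[R]_n) :
  exists2 C, 0 < C & forall x, dot (A *m x) (A *m x) <= C ^+ 2 * dot x x.
Proof.
pose C2 := \sum_i dot (row i A)^T (row i A)^T.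
have C2_ge0 : 0 <= C2 by apply: sumr_ge0 => i _; apply: dot_ge0.
exists (C2 + 1) => [|x]; first by rewrite ltr_wpDl.
apply: (@le_trans _ _ (C2 * dot x x)); last first.
  by apply: ler_wpM2r; [exact: dot_ge0|nra].
rewrite [X in X <= _]/dot mulr_suml; apply: ler_sum => i _.
have -> : (A *m x) i 0 = dot (row i A)^T x.
  by rewrite mxE; apply: eq_bigr => j _; rewrite !mxE.
by rewrite -expr2 cauchy_schwarz.
Qed.

Lemma qform_bounded n (A : 'M[R]_n) :
  exists2 C, 0 < C & forall x, `|qform A x| <= C * dot x x.
Proof.
have [C C0 leC] := mulmx_bounded A; exists C => // x.
apply: dot_norm_le; first by apply: mulr_ge0; [exact: ltW|exact: dot_ge0].
rewrite exprMn mulrC [X in _ <= X](_ : _ = C ^+ 2 * dot x x * dot x x); last by ring.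
by apply: ler_wpM2r; [exact: dot_ge0|exact: leC].
Qed.

Lemma qformZ n (A : 'M[R]_n) c x : qform A (c *: x) = c ^+ 2 * qform A x.
Proof. by rewrite /qform -scalemxAr !dotE; ring. Qed.

Lemma qformB_scalar n (A : 'M[R]_n) c x :
  qform (A - c%:M) x = qform A x - c * dot x x.
Proof. by rewrite /qform mulmxBl mul_scalar_mx dotBr dotZr. Qed.

(** Expanding the nonnegative form at [x - c B^-1 x], with [c] the inverse of a bound for
    [B^-1], gives [c |x|^2 <= qform B x], without any compactness argument. *)
Lemma psd_unit_coercive n (B : 'M[R]_n) : B^T = B -> B \in unitmx ->
  (forall x, 0 <= qform B x) ->
  exists2 c, 0 < c & forall x, c * dot x x <= qform B x.
Proof.
move=> symB uB psdB; have [C C0 leC] := qform_bounded (invmx B).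
exists C^-1 => [|x]; first by rewrite invr_gt0.
have := psdB (x - C^-1 *: (invmx B *m x)).
rewrite /qform mulmxBr -scalemxAr mulKVmx //; set y := invmx B *m x.
have yBx : dot y (B *m x) = dot x x by rewrite dot_mulmx symB mulKVmx.
rewrite !(dotBl, dotBr, dotZl, dotZr) yBx.
have : C^-1 * dot y x <= dot x x.
  rewrite mulrC ler_pdivrMr // [X in _ <= X]mulrC dotC.
  by apply: le_trans (leC x); apply: ler_norm.
have C'0 : 0 < C^-1 by rewrite invr_gt0.
move: (C^-1) C'0 (dot x _) (dot y x) (dot x x) => c c0 q a b le_ab.
have := ler_wpM2l (ltW c0) le_ab; lra.
Qed.

(** Let [mu] be the infimum of the Rayleigh quotients. If [A - mu] were invertible, it would be
    coercive, and the infimum could be increased. *)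
Lemma symmetric_min_eigenvalue n (A : 'M[R]_n) : (0 < n)%N -> A^T = A ->
  exists2 mu, eigenvalue A mu & forall x, mu * dot x x <= qform A x.
Proof.
case: n A => // n A _ symA.
pose Q : set R := [set q | exists2 x, dot x x = 1 & q = qform A x]%classic.
have [C C0 leC] := qform_bounded A.
have Q0 : (Q !=set0)%classic.
  exists (qform A (delta_mx ord0 0)); exists (delta_mx ord0 0) => //.
  rewrite /dot (bigD1 ord0) //= !mxE eqxx mulr1 big1 ?addr0 // => i /negbTE i0.
  by rewrite !mxE i0 mul0r.
have lbQ : has_lbound Q.
  exists (- C) => _ [x x1 ->]; have := leC x; rewrite x1 mulr1.
  by rewrite ler_norml => /andP[].
pose mu := inf Q.
have mu_le x : mu * dot x x <= qform A x.
  have [x0|x0] := eqVneq (dot x x) 0.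
    by rewrite (dot_eq0 x0) /qform !dot0l mulr0.
  have xx : 0 < dot x x by rewrite lt_neqAle eq_sym x0 dot_ge0.
  have : mu <= qform A ((Num.sqrt (dot x x))^-1 *: x).
    apply: (ge_inf lbQ); exists ((Num.sqrt (dot x x))^-1 *: x) => //.
    by rewrite !dotE mulrA -expr2 exprVn sqr_sqrtr ?mulVf // ltW.
  rewrite qformZ exprVn sqr_sqrtr ?(ltW xx) // mulrC.
  by rewrite ler_pdivlMr.
exists mu => //; apply: contraT => Nmu.
have uB : A - mu%:M \in unitmx.
  by rewrite -row_free_unit -kermx_eq0; move: Nmu; rewrite negbK.
have [|x|c c0 cB] := psd_unit_coercive _ uB.
- by rewrite linearB /= symA tr_scalar_mx.
- by rewrite qformB_scalar subr_ge0.
have : mu + c <= mu.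
  apply: lb_le_inf => // _ [x x1 ->].
  by have := cB x; rewrite qformB_scalar x1; lra.
lra.
Qed.

Lemma lambda_minP (G : signed_graph) :
  eigenvalue (adjmx R G) (lambda_min R G) /\
  forall x, lambda_min R G * dot x x <= qform (adjmx R G) x.
Proof.
have symA : (adjmx R G)^T = adjmx R G.
  apply/matrixP => i j; rewrite !mxE /signed_entry adj_sym.
  by rewrite finset.setUC.
have [mu Amu mu_le] := symmetric_min_eigenvalue (vertex_gt0 G) symA.
suff -> : lambda_min R G = mu by [].
have lb_mu : lbound [set a | eigenvalue (adjmx R G) a]%classic mu.
  move=> a /eigenvalueP[w wA w0]; have := mu_le w^T.
  have Aw : adjmx R G *m w^T = a *: w^T.
    by rewrite -symA -trmx_mul wA linearZ.
  rewrite /qform Aw dotZr ler_pM2r // lt_neqAle dot_ge0 eq_sym andbT.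
  apply/negP => /eqP/dot_eq0/(congr1 trmx); rewrite trmxK trmx0 => w00.
  by rewrite w00 eqxx in w0.
apply: le_anti; apply/andP; split.
  by apply: ge_inf => //; exists mu.
by apply: lb_le_inf => //; exists mu.
Qed.

End LambdaMin.

(** * Integers and half-integers in a real field *)

Section Integers.
Variable R : realType.
Implicit Types x y z : R.

Lemma int_lt1_eq0 z : z \is a Num.int -> `|z| < 1 -> z = 0.
Proof.
move=> zZ z1; apply/eqP; apply: contraTT z1 => z0.
by rewrite -leNgt norm_intr_ge1.
Qed.

Lemma int_sqr_lt4 z : z \is a Num.int -> z ^+ 2 < 4 -> [\/ z = -1, z = 0 | z = 1].
Proof.
case/intrP=> m -> m4; have : (m ^+ 2 < 4)%R.
  by rewrite -(ltr_int R) rmorphXn.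
rewrite expr2 => {}m4.
have : m = -1 \/ m = 0 \/ m = 1 by nia.
by case=> [->|[->|->]]; [constructor 1|constructor 2|constructor 3].
Qed.

Lemma int_sqr_half z : z \is a Num.int -> (z ^+ 2 - z) / 2 \is a Num.int.
Proof.
case/intrP=> m ->; have [k mk] : exists k : int, m * m - m = 2 * k.
  have := divz_eq m 2; have : (0 <= (m %% 2)%Z < 2)%R by rewrite modz_ge0 // ltz_pmod.
  set q := (m %/ 2)%Z; set r := (m %% 2)%Z => r2 ->.
  have : r = 0 \/ r = 1 by lia.
  case=> ->; [exists (q * (q * 2 - 1))|exists (q * (q * 2 + 1))]; ring.
by rewrite expr2 -intrM -rmorphB /= mk intrM [2%:~R * _]mulrC mulfK ?intr_int ?pnatr_eq0.
Qed.

Lemma half_int_odd z : 2 * z \is a Num.int -> z \isn't a Num.int ->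
  z - 2^-1 \is a Num.int.
Proof.
case/intrP=> m zm; have -> : z = m%:~R / 2 by rewrite -zm; field.
have := divz_eq m 2; have : (0 <= (m %% 2)%Z < 2)%R by rewrite modz_ge0 // ltz_pmod.
set q := (m %/ 2)%Z; set r := (m %% 2)%Z => r2 ->.
have : r = 0 \/ r = 1 by lia.
case=> -> nint; rewrite intrD intrM.
  by case/negP: nint; rewrite addr0 intrM mulfK ?intr_int ?pnatr_eq0.
by rewrite (_ : _ - _ = q%:~R) ?intr_int //; field.
Qed.

End Integers.

(** * Subgroups and integral spans *)

Section Spans.

Definition subgroup (V : zmodType) (Q : V -> Prop) :=
  Q 0 /\ forall x y, Q x -> Q y -> Q (x - y).

(** Integer combinations, as an inductive predicate: only closure properties and induction are
    used, never the coefficients. *)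
Inductive zspan (V : zmodType) (P : V -> Prop) : V -> Prop :=
| zspan_gen x : P x -> zspan P x
| zspan0 : zspan P 0
| zspanB x y : zspan P x -> zspan P y -> zspan P (x - y).

Lemma zspan_subgroup (V : zmodType) (P : V -> Prop) : subgroup (zspan P).
Proof. by split; [exact: zspan0|exact: zspanB]. Qed.

Lemma zspan_min (V : zmodType) (P Q : V -> Prop) : subgroup Q ->
  (forall x, P x -> Q x) -> forall x, zspan P x -> Q x.
Proof. by move=> [Q0 QB] PQ x; elim=> [y /PQ||y z _ Qy _ Qz] //; exact: QB. Qed.

Section Subgroup.
Variables (V : zmodType) (Q : V -> Prop).
Hypothesis sgQ : subgroup Q.

Lemma subgroup0 : Q 0. Proof. by case: sgQ. Qed.
Lemma subgroupB x y : Q x -> Q y -> Q (x - y). Proof. by case: sgQ => _; apply. Qed.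
Lemma subgroupN x : Q x -> Q (- x).
Proof. by rewrite -sub0r; apply: subgroupB; apply: subgroup0. Qed.
Lemma subgroupD x y : Q x -> Q y -> Q (x + y).
Proof. by move=> Qx Qy; rewrite -[y]opprK; apply: subgroupB => //; apply: subgroupN. Qed.
Lemma subgroup_sum I (r : seq I) (P : pred I) (F : I -> V) :
  (forall i, P i -> Q (F i)) -> Q (\sum_(i <- r | P i) F i).
Proof. by move=> QF; apply: big_ind => //; [exact: subgroup0|exact: subgroupD]. Qed.
Lemma subgroupMn x n : Q x -> Q (x *+ n).
Proof.
move=> Qx; elim: n => [|n IHn]; first by rewrite mulr0n; apply: subgroup0.
by rewrite mulrS; apply: subgroupD.
Qed.
Lemma subgroupMz x (m : int) : Q x -> Q (x *~ m).
Proof.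
case: m => n Qx; first exact: subgroupMn.
by rewrite NegzE mulrNz; apply: subgroupN; apply: subgroupMn.
Qed.
End Subgroup.

Lemma subgroupZ (R : realType) (V : lmodType R) (Q : V -> Prop) (c : R) x :
  subgroup Q -> c \is a Num.int -> Q x -> Q (c *: x).
Proof. by move=> sgQ /intrP[m ->] Qx; rewrite scaler_int; apply: subgroupMz. Qed.

End Spans.

Section RealSpans.
Variable R : realType.

Lemma zspan_dot_int p (P : 'cV[R]_p -> Prop) (w : 'cV[R]_p) :
  (forall x, P x -> dot x w \is a Num.int) ->
  forall x, zspan P x -> dot x w \is a Num.int.
Proof.
move=> Pw; apply: zspan_min => //; split; first by rewrite dot0l.
by move=> x y xw yw; rewrite dotBl rpredB.
Qed.

Lemma zspan_dot0 p (P : 'cV[R]_p -> Prop) (w : 'cV[R]_p) :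
  (forall x, P x -> dot x w = 0) -> forall x, zspan P x -> dot x w = 0.
Proof.
move=> Pw; apply: zspan_min => //; split; first by rewrite dot0l.
by move=> x y xw yw; rewrite dotBl xw yw subrr.
Qed.

(** The span of a set of pairs is the graph of an isometry as soon as paired generators have
    equal inner products. Isometries of lattices are transported in this form, which needs no
    choice of coefficients and no basis. *)
Lemma zspan_pair_dot p q (P : 'cV[R]_p * 'cV[R]_q -> Prop) :
  (forall x y, P x -> P y -> dot x.1 y.1 = dot x.2 y.2) ->
  forall x y, zspan P x -> zspan P y -> dot x.1 y.1 = dot x.2 y.2.
Proof.
move=> PP x y Px Py; move: x Px; apply: zspan_min.
  split; first by rewrite !dot0l.
  by move=> x x' xy x'y; rewrite !dotBl xy x'y.
move=> x Px; move: y Py; apply: zspan_min; last by move=> y; exact: PP.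
split; first by rewrite !dot0r.
by move=> y y' xy x'y; rewrite !dotBr xy x'y.
Qed.

Lemma independent_le p n (e : nat -> 'cV[R]_p) :
  (forall c : 'I_n -> R, \sum_i c i *: e i = 0 -> forall i, c i = 0) -> (n <= p)%N.
Proof.
move=> free; pose E : 'M[R]_(n, p) := \matrix_(i, j) e i j 0.
suff fE : row_free E by rewrite -(eqP fE); apply: rank_leq_col.
rewrite -kermx_eq0; apply/eqP/row_matrixP => i; rewrite row0.
have : row i (kermx E) *m E = 0 by rewrite -row_mul mulmx_ker row0.
set k := row i _ => kE; apply/matrixP => a b; rewrite ord1 [RHS]mxE.
apply: (free (fun b => k 0 b)); apply/matrixP => j0 z; rewrite ord1 summxE.
have /matrixP/(_ 0 j0) := kE; rewrite !mxE => kE0; rewrite -[RHS]kE0.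
by apply: eq_bigr => l _; rewrite !mxE.
Qed.

(** Frames and cliques of maximal size are obtained from this, the bound being the dimension. *)
Lemma ex_maximal (P : nat -> Prop) n0 b : P n0 -> (forall n, P n -> (n <= b)%N) ->
  exists n, [/\ (n0 <= n)%N, P n & ~ P n.+1].
Proof.
move=> P0 leb; apply: contrapT => noP.
suff /leb : P (n0 + b.+1)%N by lia.
elim: b.+1 => [|m IHm]; first by rewrite addn0.
apply: contrapT => Pm; apply: noP; exists (n0 + m)%N; split=> //; first exact: leq_addr.
by rewrite -addnS.
Qed.

End RealSpans.

(** * Orthonormal frames *)

Section Frames.
Variables (R : realType) (p : nat).
Implicit Types (e : nat -> 'cV[R]_p) (x y : 'cV[R]_p).

Definition orthoframe n e :=
  forall i j, (i < n)%N -> (j < n)%N -> dot (e i) (e j) = (i == j)%:R.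

Definition residue n e x := x - \sum_(i < n) dot x (e i) *: e i.

Lemma dot_frame_sum n e (c : nat -> R) j : orthoframe n e -> (j < n)%N ->
  dot (\sum_(i < n) c i *: e i) (e j) = c j.
Proof.
move=> oe jn; rewrite dot_suml (bigD1 (Ordinal jn)) //= dotZl oe // eqxx mulr1.
rewrite big1 ?addr0 // => i /negP ij; rewrite dotZl oe //.
case: eqP => [e_ij|_]; last by rewrite mulr0.
by case: ij; apply/eqP/val_inj.
Qed.

Lemma residue_orth n e x i : orthoframe n e -> (i < n)%N ->
  dot (residue n e x) (e i) = 0.
Proof.
by move=> oe ltin; rewrite dotBl (dot_frame_sum (fun i => dot x (e i))) // subrr.
Qed.

Lemma dot_residue n e x y : orthoframe n e ->
  dot x y = \sum_(i < n) dot x (e i) * dot y (e i)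
            + dot (residue n e x) (residue n e y).
Proof.
move=> oe; rewrite {2}/residue dotBr dot_sumr [X in _ - X]big1 => [|i _]; last first.
  by rewrite dotZr residue_orth // mulr0.
rewrite subr0 /residue dotBl dot_suml addrC.
under [X in _ - X]eq_bigr do rewrite dotZl (dotC _ y).
by rewrite subrK.
Qed.

Lemma orthoframe_le n e : orthoframe n e -> (n <= p)%N.
Proof.
move=> oe; apply: (independent_le (e := e)) => c c0 i.
pose d k := if insub k is Some j then c j else 0.
have dE (j : 'I_n) : d j = c j by rewrite /d valK.
rewrite -dE -(dot_frame_sum d oe (ltn_ord i)).
by under eq_bigr do rewrite dE; rewrite c0 dot0l.
Qed.

Definition snoc n e x : nat -> 'cV[R]_p := fun i => if (i < n)%N then e i else x.

Lemma orthoframe_snoc n e x : orthoframe n e -> dot x x = 1 ->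
  (forall i, (i < n)%N -> dot x (e i) = 0) -> orthoframe n.+1 (snoc n e x).
Proof.
move=> oe x1 xe i j; rewrite /snoc !ltnS => lein lejn.
case: ltnP => ltin; case: ltnP => ltjn.
- exact: oe.
- by rewrite dotC xe // (_ : (i == j) = false) //; lia.
- by rewrite xe // (_ : (i == j) = false) //; lia.
- by rewrite x1 (_ : i == j) //; lia.
Qed.

(** The sums [e i + e j], including [i = j], generate the lattice [D_n]. *)
Lemma even_frame_sum n e (Q : 'cV[R]_p -> Prop) (c : nat -> R) : subgroup Q ->
  (forall i j, (i < n)%N -> (j < n)%N -> Q (e i + e j)) ->
  (forall i, (i < n)%N -> c i \is a Num.int) ->
  (\sum_(i < n) c i) / 2 \is a Num.int -> Q (\sum_(i < n) c i *: e i).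
Proof.
case: n => [|n] sgQ Qe cZ c2; first by rewrite big_ord0; apply: subgroup0.
have -> : \sum_(i < n.+1) c i *: e i =
    \sum_(i < n.+1) c i *: (e i + e 0%N) - ((\sum_(i < n.+1) c i) / 2) *: (e 0%N + e 0%N).
  under [in RHS]eq_bigr do rewrite scalerDr.
  rewrite big_split /= -scaler_suml -mulr2n -scaler_nat scalerA mulfVK ?pnatr_eq0 //.
  by rewrite addrK.
apply: subgroupB => //; last by apply: subgroupZ => //; exact: Qe.
by apply: subgroup_sum => // i _; apply: subgroupZ => //; [exact: cZ|exact: Qe].
Qed.

End Frames.

(** * Connected forms and their representations *)

Section Connectivity.
Variables (R : realType) (X : finType).
Implicit Types (D : {set X}) (S : X -> X -> R).

Definition linked D S : rel X := fun x y => [&& x \in D, y \in D & S x y != 0].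

Definition connected_on D S := {in D &, forall x y, connect (linked D S) x y}.

Lemma connected_on_ind D S (Q : X -> Prop) x0 : connected_on D S ->
  x0 \in D -> Q x0 ->
  (forall x y, x \in D -> y \in D -> S x y != 0 -> Q x -> Q y) ->
  {in D, forall x, Q x}.
Proof.
move=> cD x0D Qx0 step x xD; have /connectP[s] := cD _ _ x0D xD.
elim: s x0 x0D Qx0 => [|y s IHs] z zD Qz /=; first by move=> _ ->.
by case/andP=> /and3P[_ yD zy] ys; apply: IHs => //; exact: step Qz.
Qed.

Definition Zrep D S := exists n (a : X -> 'cV[R]_n),
  {in D, forall x i, a x i 0 \is a Num.int} /\ gram_on D S a.

Definition E8rep D S := exists b : X -> 'cV[R]_8,
  {in D, forall x, E8 R (b x)} /\ gram_on D S b.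

End Connectivity.

(** * Lattices with a unit vector *)

Section FrameSpans.
Variables (R : realType) (p : nat) (X : finType).
Variables (D : {set X}) (S : X -> X -> R) (v : X -> 'cV[R]_p).
Hypotheses (conD : connected_on D S) (vS : gram_on D S v).
Hypothesis intS : {in D &, forall x y, S x y \is a Num.int}.
Hypothesis normS : {in D, forall x, S x x <= 2}.

(** Everything that meets the frame lies in its span: the part outside the frame has an integral
    norm at most [2 - 1], and not 1. A vector linked to one in the span meets the frame, so
    connectedness puts all vectors in the span, and the coordinates are the representation. *)
Lemma integral_frame_Zrep n (e : nat -> 'cV[R]_p) : orthoframe n e ->
  (forall x i, x \in D -> (i < n)%N -> dot (v x) (e i) \is a Num.int) ->
  {in D, forall x, dot (residue n e (v x)) (residue n e (v x)) <> 1} ->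
  (exists x i, [/\ x \in D, (i < n)%N & dot (v x) (e i) <> 0]) ->
  Zrep D S.
Proof.
move=> oe ve res1 [x0 [i0 [x0D i0n x0e]]].
have res0 x i : x \in D -> (i < n)%N -> dot (v x) (e i) <> 0 ->
    residue n e (v x) = 0.
  move=> xD ltin /eqP xe; apply: dot_eq0.
  have := dot_residue (v x) (v x) oe; rewrite vS // => Sx.
  have resZ : dot (residue n e (v x)) (residue n e (v x)) \is a Num.int.
    have -> : dot (residue n e (v x)) (residue n e (v x)) = S x x -
        \sum_(i < n) dot (v x) (e i) * dot (v x) (e i) by rewrite Sx addrC addKr.
    rewrite rpredB ?intS // rpred_sum // => j _; rewrite rpredM // ve //.
  have sum1 : 1 <= \sum_(i < n) dot (v x) (e i) * dot (v x) (e i).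
    rewrite (bigD1 (Ordinal ltin)) //= -[1]addr0 lerD //.
      by rewrite -expr2 sqr_intr_ge1 // ve.
    by apply: sumr_ge0 => j _; rewrite -expr2 sqr_ge0.
  have := res1 x xD; have := normS xD; have := dot_ge0 (residue n e (v x)).
  move: (dot (residue _ _ _) _) resZ Sx => r rZ Sx r0 Sx2 r1.
  have r2 : r ^+ 2 < 4 by nra.
  by have [r'|//|//] := int_sqr_lt4 rZ r2; lra.
have allres : {in D, forall x, residue n e (v x) = 0}.
  apply: (connected_on_ind conD x0D (res0 _ _ x0D i0n x0e)) => x y xD yD Sxy resx.
  have [i xye] : exists i : 'I_n, dot (v y) (e i) != 0.
    apply/existsP; apply: contraNT Sxy; rewrite negb_exists => /forallP ye0.
    rewrite -vS // (dot_residue _ _ oe) resx dot0l addr0 big1 // => i _.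
    by have /negPn/eqP-> := ye0 i; rewrite mulr0.
  by apply: (res0 _ i) => //; apply/eqP.
exists n, (fun x => \col_i dot (v x) (e i)); split=> [x xD i|x y xD yD].
  by rewrite mxE ve.
rewrite -vS // (dot_residue _ _ oe) allres // dot0l addr0.
by apply: eq_bigr => i _; rewrite !mxE.
Qed.

Definition lattice_of : 'cV[R]_p -> Prop := zspan (fun w => exists2 x, x \in D & w = v x).

Lemma lattice_gen x : x \in D -> lattice_of (v x).
Proof. by move=> xD; apply: zspan_gen; exists x. Qed.

Lemma lattice_int u w : lattice_of u -> lattice_of w -> dot u w \is a Num.int.
Proof.
move=> Lu Lw; apply: zspan_dot_int Lu => _ [x xD ->]; rewrite dotC.
by apply: zspan_dot_int Lw => _ [y yD ->]; rewrite vS ?intS.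
Qed.

(** Extend the given unit vector to a maximal orthonormal set of lattice vectors: a residue of
    norm 1 would be one more. *)
Lemma unit_vector_Zrep x0 : x0 \in D -> S x0 x0 = 1 -> Zrep D S.
Proof.
move=> x0D Sx0.
pose P n := exists e : nat -> 'cV[R]_p,
  [/\ orthoframe n e, forall i, (i < n)%N -> lattice_of (e i) & e 0%N = v x0].
have P1 : P 1%N.
  exists (fun=> v x0); split=> [i j||//]; last by move=> *; exact: lattice_gen.
  by rewrite !ltnS !leqn0 => /eqP-> /eqP->; rewrite vS.
have [n|n [n1 [e [oe Le e0]] Pn1]] := ex_maximal (b := p) P1.
  by case=> e [oe _ _]; exact: orthoframe_le oe.
have ve x i : x \in D -> (i < n)%N -> dot (v x) (e i) \is a Num.int.
  by move=> xD ltin; apply: lattice_int; [exact: lattice_gen|exact: Le].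
apply: (integral_frame_Zrep oe ve); last first.
  exists x0, 0%N; split=> //; rewrite e0 vS // Sx0; apply/eqP; exact: oner_neq0.
move=> x xD res1; apply: Pn1; exists (snoc n e (residue n e (v x))); split.
- by apply: orthoframe_snoc => // i ltin; rewrite residue_orth.
- move=> i; rewrite /snoc; case: (ltnP i n) => [ltin _|_ _]; first exact: Le.
  apply: subgroupB; [exact: zspan_subgroup|exact: lattice_gen|].
  apply: subgroup_sum => [|j _]; first exact: zspan_subgroup.
  by apply: subgroupZ; [exact: zspan_subgroup|exact: ve|exact: Le].
- by rewrite /snoc n1.
Qed.

End FrameSpans.

(** * Coordinates of the lattice E_8 *)

Section E8Lattice.
Variable R : realType.

Lemma D8P (v : 'cV[R]_8) :
  D8 v <-> (forall i, v i 0 \is a Num.int) /\ (\sum_i v i 0) / 2 \is a Num.int.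
Proof.
split=> [[z /dvdzP[k zk] <-]|[vZ v2]].
  split=> [i|]; first by rewrite mxE intr_int.
  rewrite (eq_bigr (fun i => (z i 0)%:~R)) => [|i _]; last by rewrite mxE.
  by rewrite -(rmorph_sum (intmul 1)) /= zk intrM mulfK ?pnatr_eq0 ?intr_int.
exists (\matrix_(i, j) Num.floor (v i j)) => /=.
  rewrite /=; case/intrP: v2 => k vk; apply/dvdzP; exists k.
  apply: (intr_inj (R := R)); rewrite intrM -vk mulfVK ?pnatr_eq0 // rmorph_sum /=.
  by apply: eq_bigr => i _; rewrite mxE /= floorK ?vZ.
by apply/matrixP => i j; rewrite ord1 !mxE floorK ?vZ.
Qed.

Lemma E8P (v : 'cV[R]_8) :
  E8 R v <-> ((forall i, v i 0 \is a Num.int) \/ (forall i, v i 0 - 2^-1 \is a Num.int))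
             /\ (\sum_i v i 0) / 2 \is a Num.int.
Proof.
have sum_shift (x : 'cV[R]_8) :
    \sum_i (const_mx 2^-1 + x) i 0 = 4 + \sum_i x i 0.
  rewrite (eq_bigr (fun i => 2^-1 + x i 0)) => [|i _]; last by rewrite !mxE.
  rewrite big_split sumr_const card_ord /=; congr (_ + _).
  by rewrite -[LHS]mulr_natl; field.
have shift_int (a : R) : ((4 + a) / 2 \is a Num.int) = (a / 2 \is a Num.int).
  have -> : (4 + a) / 2 = 2%:R + a / 2 by field.
  by rewrite rpredDl ?natr_int.
split=> [[/D8P[vZ v2]|[x /D8P[xZ x2] <-]]|[[vZ|vH] v2]].
- by split=> //; left.
- split; last by rewrite sum_shift shift_int.
  by right=> i; rewrite !mxE addrAC subrr add0r.
- by left; apply/D8P.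
right; exists (v - const_mx 2^-1); last by rewrite addrC subrK.
have vE : v = const_mx 2^-1 + (v - const_mx 2^-1) by rewrite addrC subrK.
apply/D8P; split; first by move=> i; rewrite !mxE.
by rewrite -shift_int -sum_shift -vE.
Qed.

Lemma E8_subgroup : subgroup (E8 R).
Proof.
split.
  by apply/E8P; split; [left=> i|rewrite big1 ?mul0r // => i _]; rewrite mxE.
move=> x y /E8P[xZ x2] /E8P[yZ y2]; apply/E8P; split; last first.
  rewrite (eq_bigr (fun i => x i 0 - y i 0)) => [|i _]; last by rewrite !mxE.
  by rewrite sumrB mulrBl rpredB.
case: xZ yZ => xZ [] yZ; [left|right|right|left] => i; rewrite !mxE.
- exact: rpredB.
- rewrite (_ : _ - _ = x i 0 - (y i 0 - 2^-1) - 1); last by field.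
  by apply: rpredB; [exact: rpredB|exact: rpred1].
- rewrite (_ : _ - _ = (x i 0 - 2^-1) - y i 0); last by ring.
  by rewrite rpredB.
- rewrite (_ : _ - _ = (x i 0 - 2^-1) - (y i 0 - 2^-1)); last by ring.
  by rewrite rpredB.
Qed.

(** The first five coordinates of [R^8]; the frame of type [D_5] goes there. *)
Definition emb5 (c : nat -> R) : 'cV[R]_8 := \col_i (if (i < 5)%N then c i else 0).

(** In the last three coordinates, the four sign vectors [(+-1/2, +-1/2, +-1/2)] with an even
    number of minus signs, the vertices of a regular tetrahedron. *)
Definition tetra (j : nat) : 'cV[R]_8 :=
  \col_i (nth 0 (nth [::] [:: [:: 1; 1; 1]; [:: 1; -1; -1]; [:: -1; 1; -1];
                              [:: -1; -1; 1]] j) (i - 5) / 2 * (5 <= i)%N%:R).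

Lemma dot_emb5 c d : dot (emb5 c) (emb5 d) = \sum_(i < 5) c i * d i.
Proof. by rewrite /dot !big_ord_recr !big_ord0 /= !mxE /=; ring. Qed.

Lemma dot_emb5_tetra c j : dot (emb5 c) (tetra j) = 0.
Proof. by rewrite /dot !big_ord_recr !big_ord0 /= !mxE /=; ring. Qed.

Lemma dot_tetra i j : (i < 4)%N -> (j < 4)%N ->
  dot (tetra i) (tetra j) = (i == j)%:R - 4^-1.
Proof.
move=> i4 j4; rewrite /dot !big_ord_recr !big_ord0 /= !mxE /=.
by case: i i4 => [|[|[|[|]]]] // _; case: j j4 => [|[|[|[|]]]] // _ /=; field.
Qed.

Lemma E8_emb5 c : (forall i, (i < 5)%N -> c i \is a Num.int) ->
  (\sum_(i < 5) c i) / 2 \is a Num.int -> E8 R (emb5 c).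
Proof.
move=> cZ c2; apply/E8P; split.
  by left=> i; rewrite mxE; case: ifP => // /cZ.
rewrite (_ : \sum_i _ = \sum_(i < 5) c i) //.
by rewrite !big_ord_recr !big_ord0 /= !mxE /=; ring.
Qed.

Lemma E8_emb5_tetra c j : (j < 4)%N -> (forall i, (i < 5)%N -> c i - 2^-1 \is a Num.int) ->
  (\sum_(i < 5) c i - 5 / 2) / 2 \is a Num.int -> E8 R (emb5 c + tetra j).
Proof.
move=> j4 cZ c2; apply/E8P; split.
  right=> i; rewrite !mxE; case: (ltnP i 5) => i5.
    by rewrite mulr0 addr0 cZ.
  have -> : (i : nat) = (i - 5).+4.+1 by lia.
  rewrite ?leqNgt /= mulr1 add0r ?subSS ?subn0.
  have : (i - 5 < 3)%N by have := ltn_ord i; lia.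
  move: (i - 5)%N => k k3.
  have minus : - 1 / 2 - 2^-1 \is a @Num.int R.
    by rewrite (_ : _ - _ = - 1) ?rpredN ?rpred1 //; field.
  have plus : 1 / 2 - 2^-1 \is a @Num.int R.
    by rewrite (_ : _ - _ = 0) ?rpred0 //; field.
  by case: j j4 => [|[|[|[|]]]] // _; case: k k3 => [|[|[|]]] //.
have -> : \sum_i (emb5 c + tetra j) i 0 = \sum_(i < 5) c i + (if j == 0%N then 3 else -1) / 2.
  rewrite !big_ord_recr !big_ord0 /= !mxE /=.
  by case: j j4 => [|[|[|[|]]]] // _ /=; field.
rewrite (_ : _ / 2 = (\sum_(i < 5) c i - 5 / 2) / 2 + (if j == 0%N then 2 else 1)).
  by apply: rpredD => //; case: ifP => _; rewrite ?natr_int ?rpred1.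
by case: ifP => _; field.
Qed.

End E8Lattice.

(** * Frames of type D_n and half-integral coordinates *)

Section DFrames.
Variables (R : realType) (p : nat) (X : finType).
Variables (D : {set X}) (S : X -> X -> R) (v : X -> 'cV[R]_p).
Hypotheses (vS : gram_on D S v).
Hypothesis intS : {in D &, forall x y, S x y \is a Num.int}.

Implicit Types (u w : 'cV[R]_p).
Local Notation L := (lattice_of D v).

(** An orthonormal system, in general outside the lattice, whose lattice [D_n] is contained in
    [lattice_of D v]. *)
Definition Dframe n (e : nat -> 'cV[R]_p) :=
  orthoframe n e /\ forall i j, (i < n)%N -> (j < n)%N -> L (e i + e j).

Lemma half_sqr (z : R) : z - 2^-1 \is a Num.int -> z ^+ 2 <= 2 -> z ^+ 2 = 4^-1.
Proof.
move=> zZ z2; have a4 : (z - 2^-1) ^+ 2 < 4 by nra.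
have [a|a|a] := int_sqr_lt4 zZ a4.
- have -> : z = - 2^-1 by lra.
  by field.
- have -> : z = 2^-1 by lra.
  by field.
- have z32 : z = 3 / 2 by lra.
  by move: z2; rewrite z32 expr2; lra.
Qed.

(** The inner products with the [e i + e j] are integers, so the coordinates are all integral
    or all half-integral. *)
Lemma coord_half n e w i0 : Dframe n e -> L w -> (i0 < n)%N ->
  dot w (e i0) \isn't a Num.int ->
  forall i, (i < n)%N -> dot w (e i) - 2^-1 \is a Num.int.
Proof.
move=> [oe Le] Lw i0n nint i ltin.
have half0 : dot w (e i0) - 2^-1 \is a Num.int.
  apply: half_int_odd => //.
  have := lattice_int vS intS Lw (Le _ _ i0n i0n).
  by rewrite dotDr -mulr2n mulr_natl.
have := lattice_int vS intS Lw (Le _ _ ltin i0n); rewrite dotDr => intD.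
rewrite (_ : _ - _ = (dot w (e i) + dot w (e i0)) - (dot w (e i0) - 2^-1) - 1).
  by apply: rpredB; [exact: rpredB|exact: rpred1].
by field.
Qed.

Lemma coord_sqr_le n (e : nat -> 'cV[R]_p) w : orthoframe n e ->
  \sum_(i < n) dot w (e i) ^+ 2 <= dot w w.
Proof.
move=> oe; rewrite (dot_residue w w oe).
under [X in X <= _]eq_bigr do rewrite expr2.
by rewrite lerDl dot_ge0.
Qed.

(** A coordinate [3/2] in absolute value is already too long for a root, so all are [+-1/2]. *)
Lemma half_coord_sqr n e w i0 : Dframe n e -> L w -> dot w w = 2 -> (i0 < n)%N ->
  dot w (e i0) \isn't a Num.int -> forall i, (i < n)%N -> dot w (e i) ^+ 2 = 4^-1.
Proof.
move=> De Lw w2 i0n nint i ltin; apply: half_sqr; first exact: (coord_half De Lw i0n nint).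
have := coord_sqr_le w De.1; rewrite w2; apply: le_trans.
rewrite (bigD1 (Ordinal ltin)) //= lerDl.
by apply: sumr_ge0 => j _; rewrite sqr_ge0.
Qed.

Lemma half_residue n e w i0 : Dframe n e -> L w -> dot w w = 2 -> (i0 < n)%N ->
  dot w (e i0) \isn't a Num.int ->
  dot (residue n e w) (residue n e w) = 2 - n%:R / 4.
Proof.
move=> De Lw w2 i0n nint; have := dot_residue w w De.1; rewrite w2.
rewrite (eq_bigr (fun=> 4^-1)) => [|i _]; last by rewrite -expr2 (half_coord_sqr De Lw w2 i0n).
by rewrite sumr_const card_ord -mulr_natl => ->; ring.
Qed.

Lemma frame_combination (Q : 'cV[R]_p -> Prop) n (e : nat -> 'cV[R]_p) w : subgroup Q -> orthoframe n e ->
  (forall i j, (i < n)%N -> (j < n)%N -> Q (e i + e j)) ->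
  (forall i, (i < n)%N -> dot w (e i) \is a Num.int) ->
  (\sum_(i < n) dot w (e i)) / 2 \is a Num.int -> Q (w - residue n e w).
Proof.
move=> sgQ oe Qe wZ w2; rewrite opprB addrC subrK.
by apply: (@even_frame_sum _ _ n e Q (fun i => dot w (e i))) => //.
Qed.

End DFrames.

(** * Root lattices with a half-integral root over D_5 *)

Section ExceptionalCase.
Variables (R : realType) (p : nat) (X : finType).
Variables (D : {set X}) (S : X -> X -> R) (v : X -> 'cV[R]_p).
Hypotheses (conD : connected_on D S) (vS : gram_on D S v).
Hypothesis intS : {in D &, forall x y, S x y \is a Num.int}.
Hypothesis norm2 : {in D, forall x, S x x = 2}.
Variable e : nat -> 'cV[R]_p.
Hypothesis De : Dframe D v 5 e.

Implicit Types (u w : 'cV[R]_p).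
Local Notation L := (lattice_of D v).
Local Notation res := (residue 5 e).
Let sgL : subgroup L := zspan_subgroup _.
Let oe : orthoframe 5 e := De.1.

(** Roots whose coordinates on the frame are half-integral. The last condition chooses one of
    [w] and [-w], by the parity of the number of minus signs. *)
Definition half_root w :=
  [/\ L w, dot w w = 2, forall i, (i < 5)%N -> dot w (e i) - 2^-1 \is a Num.int &
      (\sum_(i < 5) dot w (e i) - 5 / 2) / 2 \is a Num.int].

Lemma residue_dotr u w : dot (res u) (res w) = dot (res u) w.
Proof.
rewrite {2}/residue dotBr dot_sumr big1 ?subr0 // => i _.
by rewrite dotZr residue_orth // mulr0.
Qed.

Lemma half_nint (z : R) : z - 2^-1 \is a Num.int -> z \isn't a Num.int.
Proof.
move=> zH; apply/negP => zZ; have := rpredB zZ zH.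
rewrite (_ : _ - _ = 2^-1) => [hZ|]; last by ring.
have : (2^-1 : R) = 0 by apply: int_lt1_eq0 => //; rewrite gtr0_norm ?invr_gt0 ?invf_lt1 ?ltr0n ?ltr1n.
by move/eqP; rewrite invr_eq0 pnatr_eq0.
Qed.

Lemma half_root_residue w : half_root w -> dot (res w) (res w) = 3 / 4.
Proof.
case=> Lw w2 wH _; rewrite (half_residue vS intS De Lw w2 (i0 := 0)) //; last exact/half_nint/wH.
by field.
Qed.

(** The five coordinates contribute an element of [5/4 + Z] to the integral inner product, and
    the residues have norm [3/4]; this leaves two values. *)
Lemma half_root_dot u w : half_root u -> half_root w ->
  dot (res u) (res w) = 3 / 4 \/ dot (res u) (res w) = - 4^-1.
Proof.
move=> hu hw; have [Lu u2 uH us] := hu; have [Lw w2 wH ws] := hw.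
have := dot_residue u w oe.
have -> : \sum_(i < 5) dot u (e i) * dot w (e i) =
    \sum_(i < 5) (dot u (e i) - 2^-1) * (dot w (e i) - 2^-1)
    + (\sum_(i < 5) dot u (e i) - 5 / 2) / 2 + (\sum_(i < 5) dot w (e i) - 5 / 2) / 2 + 5 / 4.
  by rewrite !big_ord_recr !big_ord0 /=; field.
move: us ws; set b := (\sum_(i < 5) dot u _ - _) / 2; set c := (\sum_(i < 5) dot w _ - _) / 2 => us ws.
set a := \sum_(i < 5) _; set d := dot _ (res w) => uw.
have dZ : d - 3 / 4 \is a Num.int.
  rewrite (_ : _ - _ = dot u w - a - b - c - 2); last by rewrite uw; field.
  have aZ : a \is a Num.int by rewrite rpred_sum // => i _; rewrite rpredM ?uH ?wH.
  apply: rpredB; last exact: natr_int.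
  apply: rpredB => //; apply: rpredB => //; apply: rpredB => //.
  exact: (lattice_int vS intS Lu Lw).
have dle : `|d| <= 3 / 4.
  by apply: dot_norm_le; rewrite ?half_root_residue //; lra.
move: dle; rewrite ler_norml => /andP[d0 d1].
have d4 : (d - 3 / 4) ^+ 2 < 4 by nra.
by have [d'|d'|d'] := int_sqr_lt4 dZ d4; [right|left|]; lra.
Qed.

Lemma half_root_residue_eq u w : half_root u -> half_root w ->
  dot (res u) (res w) = 3 / 4 -> res u = res w.
Proof.
move=> hu hw duw; apply/eqP; rewrite -subr_eq0; apply/eqP/dot_eq0.
move: (half_root_residue hu) (half_root_residue hw) duw.
move: (res u) (res w) => a b aa bb ab.
by rewrite dotBl !dotBr (dotC b) aa bb ab; field.
Qed.

Lemma half_root_or_opp w i0 : L w -> dot w w = 2 -> (i0 < 5)%N ->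
  dot w (e i0) \isn't a Num.int -> half_root w \/ half_root (- w).
Proof.
move=> Lw w2 i05 nint; have wH := coord_half vS intS De Lw i05 nint.
set s := \sum_(i < 5) dot w (e i).
have sZ : s - 5 / 2 \is a Num.int.
  rewrite (_ : _ - _ = \sum_(i < 5) (dot w (e i) - 2^-1)); first by apply: rpred_sum => i _; apply: wH.
  by rewrite /s !big_ord_recr !big_ord0 /=; field.
have [sE|sO] := boolP ((s - 5 / 2) / 2 \is a Num.int); first by left; split.
right; split; first exact: subgroupN.
- by rewrite dotNl dotNr opprK.
- move=> i i5; rewrite dotNl (_ : _ - _ = - (dot w (e i) - 2^-1) - 1); last by field.
  by apply: rpredB; [rewrite rpredN wH|exact: rpred1].
rewrite (eq_bigr (fun i : 'I_5 => - dot w (e i))) => [|i _]; last by rewrite dotNl.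
rewrite sumrN -/s (_ : (- s - 5 / 2) / 2 = - ((s - 5 / 2) / 2 - 2^-1) - 3); last by field.
apply: rpredB; last exact: natr_int.
rewrite rpredN half_int_odd //.
by rewrite mulrC mulfVK // pnatr_eq0.
Qed.

(** Half-integral roots whose residues form part of a regular tetrahedron. *)
Definition tetra_family k (r : nat -> 'cV[R]_p) :=
  (forall i, (i < k)%N -> half_root (r i)) /\
  (forall i j, (i < k)%N -> (j < k)%N -> dot (res (r i)) (res (r j)) = (i == j)%:R - 4^-1).

(** The sum of [k] such residues has norm [k (1 - k / 4)]. *)
Lemma tetra_family_le k r : tetra_family k r -> (k <= 4)%N.
Proof.
move=> [_ rr]; have := dot_ge0 (\sum_(i < k) res (r i)).
have -> : dot (\sum_(i < k) res (r i)) (\sum_(i < k) res (r i)) = k%:R * (1 - k%:R / 4).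
  rewrite dot_suml (eq_bigr (fun=> 1 - k%:R / 4)) => [|i _].
    by rewrite sumr_const card_ord -[LHS]mulr_natl.
  rewrite dot_sumr (eq_bigr (fun j : 'I_k => (i == j)%:R - 4^-1)) => [|j _]; last by rewrite rr.
  rewrite sumrB sumr_const card_ord -[4^-1 *+ _]mulr_natl; congr (_ - _).
  by rewrite (bigD1 i) //= eqxx big1 ?addr0 // => j /negbTE; rewrite eq_sym => ->.
case: k {rr} => // k; rewrite pmulr_rge0 ?ltr0n // subr_ge0 ler_pdivrMr ?ltr0n // mul1r.
by rewrite ler_nat.
Qed.

Lemma maximal_tetra_family w0 : half_root w0 ->
  exists k r, [/\ (0 < k)%N, tetra_family k r &
    forall w, half_root w -> exists2 j, (j < k)%N & res w = res (r j)].
Proof.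
move=> h0; pose P k := exists r, tetra_family k r.
have P1 : P 1%N.
  exists (fun=> w0); split=> // i j; rewrite !ltnS !leqn0 => /eqP-> /eqP->.
  by rewrite half_root_residue //=; field.
have [n [r]|k [k1 [r Pr] Pk1]] := ex_maximal (b := 4) P1; first exact: tetra_family_le.
exists k, r; split=> // w hw; apply: contrapT => no_j; apply: Pk1.
have rw j : (j < k)%N -> dot (res w) (res (r j)) = - 4^-1.
  move=> jk; have [rwj|//] := half_root_dot hw (Pr.1 j jk).
  by case: no_j; exists j => //; apply: half_root_residue_eq => //; exact: Pr.1.
exists (snoc k r w); split=> [i|i j]; rewrite /snoc !ltnS.
  by case: (ltnP i k) => [ik _|//]; exact: Pr.1.
case: (ltnP i k) => ik lik; case: (ltnP j k) => jk ljk.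
- exact: Pr.2.
- by rewrite dotC rw // (_ : (i == j) = false) ?sub0r //; lia.
- by rewrite rw // (_ : (i == j) = false) ?sub0r //; lia.
- by rewrite half_root_residue // (_ : i == j) /=; [field|lia].
Qed.

(** Send the frame to the first five coordinates of [R^8] and the residues of a maximal tetrahedral
    family to the vertices of the tetrahedron in the last three: this is an isometry from the
    span [M] of the frame and the family into [E_8]. All vectors of [D] are in [M]: the
    half-integral ones by maximality of the family, those meeting the frame and those linked to
    [M] because, up to sign and frame vectors, they are differences of half-integral roots. *)
Lemma exceptional_E8rep x0 i0 : x0 \in D -> (i0 < 5)%N ->
  dot (v x0) (e i0) \isn't a Num.int -> E8rep D S.
Proof.
move=> x0D i05 nint0.
have vroot x : x \in D -> L (v x) /\ dot (v x) (v x) = 2.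
  by move=> xD; split; [exact: lattice_gen|rewrite vS ?norm2].
have [w0 hw0] : exists w, half_root w.
  have [Lx x2] := vroot _ x0D.
  by case: (half_root_or_opp Lx x2 i05 nint0) => h; [exists (v x0)|exists (- v x0)].
have [k [r [k0 Pr maxr]]] := maximal_tetra_family hw0.
have k4 := tetra_family_le Pr.
pose coords w i := dot w (e i).
pose G (g : 'cV[R]_p * 'cV[R]_8) :=
  (exists i j, [/\ (i < 5)%N, (j < 5)%N & g = (e i + e j, emb5 (coords (e i + e j)))]) \/
  (exists2 j, (j < k)%N & g = (r j, emb5 (coords (r j)) + tetra R j)).
have sgG := zspan_subgroup G.
pose M w := exists w' : 'cV[R]_8, zspan G (w, w').
have sgM : subgroup M.
  split; first by exists 0; apply: zspan0.
  by move=> a b [a' Ga] [b' Gb]; exists (a' - b'); apply: (zspanB Ga Gb).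
have Me i j : (i < 5)%N -> (j < 5)%N -> M (e i + e j).
  by move=> i5 j5; exists (emb5 (coords (e i + e j))); apply: zspan_gen; left; exists i, j.
have Mr j : (j < k)%N -> M (r j).
  by move=> jk; exists (emb5 (coords (r j)) + tetra R j); apply: zspan_gen; right; exists j.
have res_e i j : (i < 5)%N -> (j < 5)%N -> res (e i + e j) = 0.
  move=> i5 j5; apply: dot_eq0; rewrite {2}/residue dotBr dot_sumr big1 => [|l _].
    by rewrite subr0 dotDr !residue_orth // addr0.
  by rewrite dotZr residue_orth // mulr0.
have Mhalf w : half_root w -> M w.
  move=> hw; have [Lw w2 wH ws] := hw; have [j jk wj] := maxr _ hw.
  have [Lr r2 rH rs] := Pr.1 j jk.
  have := subgroup0 sgM; have -> : w = r j + ((w - r j) - res (w - r j)).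
    have -> : res (w - r j) = res w - res (r j).
      rewrite /residue; under eq_bigr do rewrite dotBl scalerBl.
      by rewrite sumrB !opprD !opprK !addrA; congr (_ + _); rewrite addrAC.
    by rewrite wj subrr subr0 addrC subrK.
  move=> _; apply: subgroupD => //; first exact: Mr.
  apply: frame_combination => // [i i5|].
    rewrite dotBl (_ : _ - _ = (dot w (e i) - 2^-1) - (dot (r j) (e i) - 2^-1)); last by ring.
    by apply: rpredB; [exact: wH|exact: rH].
  under eq_bigr do rewrite dotBl.
  rewrite sumrB (_ : _ / 2 = (\sum_(i < 5) dot w (e i) - 5 / 2) / 2
    - (\sum_(i < 5) dot (r j) (e i) - 5 / 2) / 2); last by ring.
  exact: rpredB.
have Mnint w i : L w -> dot w w = 2 -> (i < 5)%N -> dot w (e i) \isn't a Num.int -> M w.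
  move=> Lw w2 i5 nint; have [/Mhalf//|/Mhalf] := half_root_or_opp Lw w2 i5 nint.
  by rewrite -{2}[w]opprK; apply: subgroupN.
have [L0 r02 r0H r0s] := Pr.1 0%N k0.
(* integral coordinates with square sum 2 or 1: a vector of D_5, or a unit vector plus g *)
have Mmeet x : x \in D -> (exists2 i, (i < 5)%N & dot (v x) (e i) <> 0) -> M (v x).
  move=> xD [i1 i15 /eqP xe0]; have [Lx x2] := vroot _ xD.
  have [/existsP[i nint]|/existsPn xZ] :=
    boolP [exists i : 'I_5, dot (v x) (e i) \isn't a Num.int]; first exact: (Mnint _ i).
  have {}xZ i : (i < 5)%N -> dot (v x) (e i) \is a Num.int.
    by move=> i5; have := xZ (Ordinal i5); rewrite negbK.
  pose s := \sum_(i < 5) dot (v x) (e i) ^+ 2; pose t := \sum_(i < 5) dot (v x) (e i).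
  have sZ : s \is a Num.int by rewrite rpred_sum // => i _; rewrite rpredX // xZ.
  have st : (s - t) / 2 \is a Num.int.
    rewrite /s /t -sumrB mulr_suml rpred_sum // => i _.
    by rewrite int_sqr_half ?xZ.
  have s2 : s <= 2 by rewrite -x2 coord_sqr_le.
  have s1 : 1 <= s.
    rewrite /s (bigD1 (Ordinal i15)) //= -[1]addr0 lerD ?sqr_intr_ge1 ?xZ //.
    by apply: sumr_ge0 => j _; rewrite sqr_ge0.
  have xx : s + dot (res (v x)) (res (v x)) = 2.
    by rewrite -x2 [RHS](dot_residue _ _ oe); congr (_ + _); apply: eq_bigr => i _; rewrite expr2.
  have s14 : (s - 1) ^+ 2 < 4 by nra.
  have [||s'] := int_sqr_lt4 (rpredB sZ (rpred1 _)) s14; first lra; last first.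
    have res0 : res (v x) = 0 by apply: dot_eq0; lra.
    rewrite -[v x]subr0 -res0; apply: frame_combination => //.
    rewrite -/t (_ : t / 2 = 1 - (s - t) / 2) ?rpredB ?rpred1 //.
    by rewrite (_ : s = 2); [field|lra].
  move=> /subr0_eq s1'; have [g gE] : {g | g = res (v x)} by exists (res (v x)).
  pose h := dot g (res (r 0%N)).
  have gg : dot g g = 1 by rewrite gE; lra.
  have hH : h - 2^-1 \is a Num.int.
    have := dot_residue (v x) (r 0%N) oe; rewrite -gE -/h => xr.
    rewrite (_ : _ - _ = dot (v x) (r 0%N) + (s - t) / 2 - 1
       - \sum_(i < 5) dot (v x) (e i) * (dot (r 0%N) (e i) - 2^-1)).
      apply: rpredB; last by rewrite rpred_sum // => i _; rewrite rpredM ?xZ ?r0H.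
      apply: rpredB; last exact: rpred1.
      by apply: rpredD => //; apply: (lattice_int vS intS).
    under eq_bigr do rewrite mulrBr.
    by rewrite sumrB -mulr_suml -/t xr s1'; field.
  have h2 : h ^+ 2 = 4^-1.
    apply: half_sqr => //; apply: le_trans (cauchy_schwarz _ _) _.
    by rewrite gg half_root_residue; [lra|exact: Pr.1].
  pose c0 := dot (r 0%N) (e 0%N); have c02 : c0 ^+ 2 = 4^-1.
    by apply: (half_coord_sqr vS intS De L0 r02 (i0 := 0)) => //; apply/half_nint/r0H.
  (* The sign sg makes y := g + sg e_0 satisfy dot y (r 0) = 2 h = +-1, so that y and r 0 differ
     by a half-integral root. *)
  pose sg := 4 * h * c0.
  have sg2 : sg ^+ 2 = 1 by rewrite /sg !exprMn h2 c02; field.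
  have sgc0 : sg * c0 = h by rewrite /sg -mulrA -expr2 c02; field.
  have [sgE sgZ sgh] : [/\ sg = 1 \/ sg = - 1, sg \is a Num.int & (1 - sg) / 2 \is a Num.int].
    have /eqP : sg ^+ 2 = 1 by [].
    rewrite sqrf_eq1 => /orP[]/eqP->; split; [by left| |by rewrite subrr mul0r|by right| |].
    - exact: rpred1.
    - by rewrite rpredN rpred1.
    - by rewrite (_ : (1 - -1) / 2 = 1) ?rpred1 //; field.
  pose d i := dot (v x) (e i) - (if i == 0%N then sg else 0).
  pose z := \sum_(i < 5) d i *: e i.
  have zE : z = \sum_(i < 5) dot (v x) (e i) *: e i - sg *: e 0%N.
    rewrite /z; under eq_bigr do rewrite scalerBl.
    rewrite sumrB; congr (_ - _).
    by rewrite big_ord_recl /= big1 ?addr0 // => i _; rewrite scale0r.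
  have dZ i : (i < 5)%N -> d i \is a Num.int.
    by move=> i5; apply: rpredB; [exact: xZ|by case: ifP => // _; rewrite rpred0].
  have d2 : (\sum_(i < 5) d i) / 2 \is a Num.int.
    rewrite /d sumrB -/t (_ : \sum_(i < 5) (if _ then _ else _) = sg); last first.
      by rewrite big_ord_recl /= big1 ?addr0.
    rewrite (_ : (t - sg) / 2 = (1 - sg) / 2 - (s - t) / 2); last by rewrite s1'; field.
    exact: rpredB.
  have Lz : L z by apply: even_frame_sum => //; exact: De.2.
  have Mz : M z by apply: even_frame_sum.
  have [y ydef] : {y | y = v x - z} by exists (v x - z).
  have Ly : L y by rewrite ydef; apply: subgroupB.
  have yE : y = g + sg *: e 0%N by rewrite ydef zE opprB addrCA addrC gE.
  have ge0 : dot g (e 0%N) = 0 by rewrite gE residue_orth.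
  have e00 : dot (e 0%N) (e 0%N) = 1 by rewrite oe.
  have yy : dot y y = 2.
    by rewrite yE !(dotDl, dotDr, dotZl, dotZr) (dotC (e 0%N)) ge0 gg e00; nra.
  have yr : dot y (r 0%N) = 2 * h.
    rewrite yE dotDl dotZl (dotC (e 0%N)) -/c0 sgc0 /h gE residue_dotr; ring.
  have hZ2 : 2 * h \is a Num.int.
    rewrite (_ : 2 * h = (h - 2^-1) *+ 2 + 1); last by rewrite -mulr_natl; field.
    by rewrite rpredD ?rpred1 // rpredMn.
  pose w := r 0%N - (2 * h) *: y.
  have Mw : M w.
    apply: (Mnint _ 0%N) => //.
    - by apply: subgroupB => //; apply: subgroupZ.
    - rewrite /w !(dotBl, dotBr, dotZl, dotZr) (dotC _ y) yr yy r02.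
      rewrite (_ : _ - _ = 2 - 8 * (h ^+ 2) + 8 * (h ^+ 2)); last by ring.
      by ring.
    - have -> : dot w (e 0%N) = - c0.
        rewrite /w dotBl dotZl yE dotDl dotZl ge0 e00 -/c0 /sg.
        rewrite (_ : _ - _ = c0 - 8 * (h ^+ 2) * c0); last by ring.
        by rewrite h2; field.
      by rewrite rpredN; apply/half_nint/r0H.
  have My : M y.
    have -> : y = (2 * h) *: (r 0%N - w).
      rewrite /w opprB addrC subrK scalerA (_ : 2 * h * (2 * h) = 4 * h ^+ 2); last by ring.
      by rewrite h2 divff ?pnatr_eq0 // scale1r.
    by apply: subgroupZ => //; apply: subgroupB => //; apply: Mr.
  by rewrite -[v x](subrK z) -ydef; apply: subgroupD.
have Mall : {in D, forall x, M (v x)}.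
  apply: (connected_on_ind conD x0D).
    by apply: Mmeet => //; exists i0 => // x0e; rewrite x0e rpred0 in nint0.
  move=> x y xD yD Sxy [x' Gx]; have [Ly y2] := vroot _ yD.
  have [/existsP[i /eqP ye]|/existsPn ye] :=
    boolP [exists i : 'I_5, dot (v y) (e i) != 0]; first by apply: Mmeet => //; exists i.
  have {}ye i : (i < 5)%N -> dot (v y) (e i) = 0.
    by move=> i5; have := ye (Ordinal i5); rewrite negbK => /eqP.
  have res_y : res (v y) = v y.
    by rewrite /residue big1 ?subr0 // => i _; rewrite ye // scale0r.
  (* y is orthogonal to the frame, but linked to M, hence not orthogonal to some r j *)
  have [j jk yr] : exists2 j, (j < k)%N & dot (v y) (r j) != 0.
    apply: contrapT => no_j; case/negP: Sxy; rewrite -vS //; apply/eqP.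
    have G0 : forall q, zspan G q -> dot q.1 (v y) = 0.
      apply: zspan_min; first split; first by rewrite dot0l.
        by move=> a b a0 b0; rewrite dotBl a0 b0 subrr.
      move=> _ [[i [j [i5 j5 ->]]]|[j jk ->]] /=.
        by rewrite dotDl !(dotC _ (v y)) !ye // addr0.
      by rewrite dotC; apply/eqP; apply: contraPT no_j => yr /(_ _)[]; exists j.
    exact: (G0 _ Gx).
  have [Lr r2 rH rs] := Pr.1 j jk; set d := dot (v y) (r j) in yr.
  have dZ : d \is a Num.int by apply: (lattice_int vS intS).
  have d32 : d ^+ 2 <= 3 / 2.
    rewrite /d -res_y -residue_dotr; apply: le_trans (cauchy_schwarz _ _) _.
    rewrite (half_root_residue (Pr.1 j jk)).
    by rewrite res_y y2; lra.
  have d1 : d ^+ 2 = 1.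
    have d4 : d ^+ 2 < 4 by lra.
    have [->|d0|->] := int_sqr_lt4 dZ d4; rewrite ?sqrrN ?expr1n //.
    by rewrite d0 eqxx in yr.
  have Mw : M (r j - d *: v y).
    apply: (Mnint _ 0%N) => //.
    - by apply: subgroupB => //; apply: subgroupZ.
    - rewrite !(dotBl, dotBr, dotZl, dotZr) (dotC _ (v y)) -/d r2 y2.
      by rewrite (_ : _ - _ = 2); [by []|nra].
    - by rewrite dotBl dotZl ye // mulr0 subr0; apply/half_nint/rH.
  have -> : v y = d *: (r j - (r j - d *: v y)).
    by rewrite opprB addrC subrK scalerA -expr2 d1 scale1r.
  by apply: subgroupZ => //; apply: subgroupB => //; apply: Mr.
have /choice[b bG] : forall x, exists w' : 'cV[R]_8, x \in D -> zspan G (v x, w').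
  move=> x; have [xD|] := boolP (x \in D); last by exists 0.
  by have [w' ?] := Mall x xD; exists w'.
exists b; split=> [x xD|x y xD yD].
  have GE : forall q, zspan G q -> E8 R q.2.
    apply: zspan_min; first split; first exact: (subgroup0 (@E8_subgroup R)).
      by move=> ? ? ? ?; apply: (subgroupB (@E8_subgroup R)).
    move=> _ [[i [j [i5 j5 ->]]]|[j jk ->]] /=.
      apply: E8_emb5 => [l l5|]; rewrite /coords.
        by rewrite dotDl !oe // rpredD ?natr_int.
      rewrite (eq_bigr (fun l : 'I_5 => (i == l)%:R + (j == l)%:R)) => [|l _]; last by rewrite dotDl !oe.
      rewrite big_split /= (bigD1 (Ordinal i5)) //= eqxx big1 => [|l]; last first.
        by rewrite -val_eqE eq_sym /= => /negbTE->.
      rewrite (bigD1 (Ordinal j5)) //= eqxx big1 => [|l]; last first.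
        by rewrite -val_eqE eq_sym /= => /negbTE->.
      by rewrite !addr0 (_ : (true%:R + true%:R) / 2 = 1 :> R) ?rpred1 //=; field.
    have [Lr r2 rH rs] := Pr.1 j jk.
    by apply: E8_emb5_tetra => //; exact: leq_trans k4.
  exact: (GE _ (bG x xD)).
rewrite -vS //; symmetry; apply: (zspan_pair_dot _ (bG x xD) (bG y yD)).
move=> _ _ [[i [j [i5 j5 ->]]]|[i ik ->]] [[i' [j' [i5' j5' ->]]]|[i' ik' ->]] /=.
- by rewrite dot_emb5 (dot_residue _ _ oe) res_e // dot0l addr0.
- by rewrite dotDr dot_emb5_tetra addr0 dot_emb5 (dot_residue _ _ oe) res_e // dot0l addr0.
- by rewrite dotDl (dotC (tetra _ _)) dot_emb5_tetra addr0 dot_emb5 (dot_residue _ _ oe) (res_e i' j') // dot0r addr0.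
rewrite !(dotDl, dotDr) (dotC (tetra _ _)) !dot_emb5_tetra addr0 add0r dot_emb5.
rewrite (dot_residue _ _ oe) (Pr.2 i i') // dot_tetra //; exact: leq_trans k4.
Qed.

End ExceptionalCase.

(** * Root lattices in general *)

Section Classification.
Variables (R : realType) (p : nat) (X : finType).
Variables (D : {set X}) (S : X -> X -> R) (v : X -> 'cV[R]_p).
Hypotheses (conD : connected_on D S) (vS : gram_on D S v).
Hypothesis intS : {in D &, forall x y, S x y \is a Num.int}.
Hypothesis norm2 : {in D, forall x, S x x = 2}.
Implicit Types (u w : 'cV[R]_p).

Local Notation L := (lattice_of D v).
Let sgL : subgroup L := zspan_subgroup _.

(** The new unit vector is the residue of a root with one coordinate [+-1] on the frame. *)
Lemma Dframe_snoc n e x : Dframe D v n e -> x \in D ->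
  (forall i, (i < n)%N -> dot (v x) (e i) \is a Num.int) ->
  dot (residue n e (v x)) (residue n e (v x)) = 1 ->
  Dframe D v n.+1 (snoc n e (residue n e (v x))).
Proof.
move=> [oe Le] xD xZ res1.
split; first by apply: orthoframe_snoc => // i ltin; rewrite residue_orth.
pose s := \sum_(i < n) dot (v x) (e i) ^+ 2; pose t := \sum_(i < n) dot (v x) (e i).
have s1 : s = 1.
  have := dot_residue (v x) (v x) oe; rewrite vS // norm2 // res1.
  under eq_bigr do rewrite -expr2.
  by rewrite -/s; lra.
have tZ : t \is a Num.int by rewrite rpred_sum // => i _; rewrite xZ.
have st : (1 - t) / 2 \is a Num.int.
  have -> : 1 - t = \sum_(i < n) (dot (v x) (e i) ^+ 2 - dot (v x) (e i)).
    by rewrite sumrB -/s s1.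
  rewrite mulr_suml rpred_sum // => i _.
  by rewrite int_sqr_half ?xZ.
have Lres j : (j < n)%N -> L (residue n e (v x) + e j).
  move=> jn; pose c i := dot (v x) (e i) - (i == j)%:R.
  have -> : residue n e (v x) + e j = v x - \sum_(i < n) c i *: e i.
    rewrite /c; under [in RHS]eq_bigr do rewrite scalerBl.
    rewrite sumrB opprB addrCA addrC; congr (_ + _).
    rewrite (bigD1 (Ordinal jn)) //= eqxx scale1r big1 ?addr0 // => i.
    by rewrite -val_eqE /= => /negbTE->; rewrite scale0r.
  apply: subgroupB => //; first exact: lattice_gen.
  apply: even_frame_sum => // [i ltin|]; first by rewrite rpredB ?xZ ?natr_int.
  rewrite /c sumrB -/t (_ : \sum_(i < n) (_ == _)%:R = 1).
    by rewrite (_ : _ / 2 = - ((1 - t) / 2)) ?rpredN //; field.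
  rewrite (bigD1 (Ordinal jn)) //= eqxx big1 ?addr0 // => i.
  by rewrite -val_eqE /= => /negbTE->.
have L2res : L (residue n e (v x) + residue n e (v x)).
  have -> : residue n e (v x) + residue n e (v x) =
      (v x + v x) - \sum_(i < n) (2 * dot (v x) (e i)) *: e i.
    rewrite /residue addrACA -opprD -big_split /=; congr (_ - _).
    by apply: eq_bigr => i _; rewrite -scalerDl mulr_natl mulr2n.
  have Lx := lattice_gen v xD.
  apply: subgroupB => //; first exact: subgroupD.
  apply: (@even_frame_sum _ _ n e L (fun i => 2 * dot (v x) (e i))) => // [i ltin|].
    by rewrite rpredM ?xZ ?natr_int.
  by rewrite -mulr_sumr -/t mulrC mulKf ?pnatr_eq0.
move=> i j; rewrite /snoc !ltnS => lein lejn.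
case: (ltnP i n) => ltin; case: (ltnP j n) => ltjn //; last exact: Lres.
- exact: Le.
- by rewrite addrC; apply: Lres.
Qed.

(** A half-integral root over [D_4] becomes a vector [f 0 + g] in the frame of [D_4] made of the
    rows of a Hadamard matrix, and then [g] extends that frame. *)
Lemma triality e w i0 : Dframe D v 4 e -> L w -> dot w w = 2 -> (i0 < 4)%N ->
  dot w (e i0) \isn't a Num.int -> exists e', Dframe D v 5 e'.
Proof.
move=> De Lw w2 i04 nint; have [oe Le] := De.
have wH := coord_half vS intS De Lw i04 nint.
have w4 := half_coord_sqr vS intS De Lw w2 i04 nint.
have res1 := half_residue vS intS De Lw w2 i04 nint.
pose c i := dot w (e i).
(* the sign change making all coordinates of w equal to 1/2 *)
have [d dE] : {d : nat -> 'cV[R]_p | forall i, d i = (2 * c i) *: e i}.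
  by exists (fun i => (2 * c i) *: e i).
have [g gE] : {g | g = residue 4 e w} by exists (residue 4 e w).
have ddot i j : (i < 4)%N -> (j < 4)%N -> dot (d i) (d j) = (i == j)%:R.
  move=> i4 j4; rewrite !dE dotZl dotZr oe //; case: eqP => [<-|]; rewrite ?mulr0 //.
  by have := w4 i i4; rewrite -/(c i) expr2 /=; lra.
have gd i : (i < 4)%N -> dot g (d i) = 0.
  by move=> i4; rewrite dE dotZr gE residue_orth // mulr0.
have gg : dot g g = 1 by rewrite gE res1; field.
pose F (a : nat -> R) := a 0%N *: d 0%N + a 1%N *: d 1%N + a 2%N *: d 2%N + a 3%N *: d 3%N.
have FD a b : F a + F b = F (fun i => a i + b i).
  by apply/matrixP => x y; rewrite !mxE; ring.
have FB a b : F a - F b = F (fun i => a i - b i).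
  by apply/matrixP => x y; rewrite !mxE; ring.
have wF : w = F (fun=> 2^-1) + g.
  rewrite gE /residue !big_ord_recr big_ord0 /= add0r -!/(c _) /F.
  have dc i : (i < 4)%N -> 2^-1 *: d i = c i *: e i.
    by move=> i4; rewrite dE scalerA mulrA mulVf ?mul1r ?pnatr_eq0.
  by rewrite !dc // [RHS]addrC subrK.
have LF (a : nat -> R) : (forall i, a i \is a Num.int) ->
    (a 0%N + a 1%N + a 2%N + a 3%N) / 2 \is a Num.int -> L (F a).
  move=> aZ a2.
  have c2Z i : (i < 4)%N -> (2 * c i - 1) / 2 \is a Num.int.
    by move=> i4; rewrite (_ : _ / 2 = c i - 2^-1) ?wH //; field.
  have c1Z i : (i < 4)%N -> 2 * c i \is a Num.int.
    move=> i4; rewrite (_ : 2 * c i = ((2 * c i - 1) / 2) *+ 2 + 1); last by rewrite -mulr_natl; field.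
    by rewrite rpredD ?rpred1 ?rpredMn ?c2Z.
  have := @even_frame_sum _ _ 4 e L (fun i => a i * (2 * c i)) sgL Le.
  rewrite /F !dE !big_ord_recr !big_ord0 /= !add0r !scalerA; apply.
    by move=> i i4; rewrite rpredM ?aZ ?c1Z.
  rewrite (_ : _ / 2 = a 0%N * ((2 * c 0%N - 1) / 2) + a 1%N * ((2 * c 1%N - 1) / 2)
    + a 2%N * ((2 * c 2%N - 1) / 2) + a 3%N * ((2 * c 3%N - 1) / 2)
    + (a 0%N + a 1%N + a 2%N + a 3%N) / 2); last by field.
  by do 4?[apply: rpredD => //]; apply: rpredM; rewrite ?aZ ?c2Z.
(* the rows of a Hadamard matrix *)
pose h k : seq R := nth [:: 1; 1; 1; 1]
  [:: [:: 1; 1; 1; 1]; [:: 1; 1; -1; -1]; [:: 1; -1; 1; -1]; [:: 1; -1; -1; 1]] k.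
pose hs k i := nth 1 (h k) i.
have hs1 k i : hs k i = 1 \/ hs k i = -1.
  rewrite /hs /h; case: k => [|[|[|[|k]]]] /=; rewrite ?nth_nil;
  case: i => [|[|[|[|i]]]] /=; rewrite ?nth_nil; (by left) || (by right).
have hsum k : (hs k 0%N + hs k 1%N + hs k 2%N + hs k 3%N) / 4 \is a Num.int.
  rewrite /hs /h; case: k => [|[|[|[|k]]]] /=.
  - by rewrite (_ : _ / 4 = 1) ?rpred1 //; field.
  - by rewrite (_ : _ / 4 = 0) ?rpred0 //; field.
  - by rewrite (_ : _ / 4 = 0) ?rpred0 //; field.
  - by rewrite (_ : _ / 4 = 0) ?rpred0 //; field.
  by rewrite nth_nil /= (_ : _ / 4 = 1) ?rpred1 //; field.
have pm_half (x y : R) : (x = 1 \/ x = -1) -> (y = 1 \/ y = -1) -> (x + y) / 2 \is a Num.int.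
  move=> [->|->] [->|->].
  - by rewrite (_ : _ / 2 = 1) ?rpred1 //; field.
  - by rewrite (_ : _ / 2 = 0) ?rpred0 //; field.
  - by rewrite (_ : _ / 2 = 0) ?rpred0 //; field.
  - by rewrite (_ : _ / 2 = -1) ?rpredN ?rpred1 //; field.
pose f k := if (k < 4)%N then F (fun i => hs k i / 2) else g.
have gf k : (k < 4)%N -> dot g (f k) = 0.
  by move=> k4; rewrite /f k4 /F !(dotDr, dotZr) !gd // !mulr0 !addr0.
have Lgf k : (k < 4)%N -> L (g + f k).
  move=> k4; rewrite /f k4 -[g](addKr (F (fun=> 2^-1))) -wF addrAC addrC [- _ + _]addrC FB.
  apply: subgroupD => //; apply: LF => [i|].
    rewrite (_ : _ - _ = (hs k i + -1) / 2); last by field.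
    by apply: pm_half => //; right.
  rewrite (_ : _ / 2 = (hs k 0%N + hs k 1%N + hs k 2%N + hs k 3%N) / 4 - 1); last by field.
  by rewrite rpredB ?rpred1.
exists f; split=> i j i5 j5.
  have [i4|i4] := ltnP i 4; have [j4|j4] := ltnP j 4.
  - rewrite /f i4 j4 /F !(dotDl, dotDr, dotZl, dotZr) !ddot //.
    move: i4 j4; rewrite /hs /h {i5 j5}.
    by case: i => [|[|[|[|]]]] // _; case: j => [|[|[|[|]]]] // _ /=; field.
  - have -> : j = 4%N by lia.
    by rewrite dotC gf // (_ : (i == 4%N) = false) //; lia.
  - have -> : i = 4%N by lia.
    by rewrite gf // (_ : (4%N == j) = false) //; lia.
  have -> : i = 4%N by lia. have -> : j = 4%N by lia.
  exact: gg.
have [i4|i4] := ltnP i 4; have [j4|j4] := ltnP j 4.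
- rewrite /f i4 j4 FD; apply: LF => [k|].
    by rewrite -mulrDl; apply: pm_half.
  rewrite (_ : _ / 2 = (hs i 0%N + hs i 1%N + hs i 2%N + hs i 3%N) / 4 +
    (hs j 0%N + hs j 1%N + hs j 2%N + hs j 3%N) / 4); last by field.
  exact: rpredD.
- have -> : j = 4%N by lia.
  by rewrite addrC; apply: Lgf.
- have -> : i = 4%N by lia.
  exact: Lgf.
have -> : i = 4%N by lia. have -> : j = 4%N by lia.
rewrite /f /= (_ : g + g = (w + w) - F (fun=> 1)).
  apply: subgroupB => //; first exact: subgroupD.
  by apply: LF => [k|]; rewrite ?rpred1 // (_ : _ / 2 = 1 + 1) ?rpredD ?rpred1 //; field.
by rewrite wF; apply/matrixP => x y; rewrite !mxE; field.
Qed.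

(** Take a maximal frame of type [D_n]. If all coordinates are integral, the frame spans
    everything; otherwise [n <> 4] by triality, and the first five frame vectors fall under the
    exceptional case. *)
Lemma D4_rep : (exists e, Dframe D v 4 e) -> Zrep D S \/ E8rep D S.
Proof.
move=> D4; have [n|n [n4 [e De] maxn]] :=
  ex_maximal (P := fun n => exists e, Dframe D v n e) (b := p) D4.
  by case=> e [oe _]; exact: orthoframe_le oe.
have [oe Le] := De.
have [xZ|] := pselect (forall x i, x \in D -> (i < n)%N -> dot (v x) (e i) \is a Num.int).
  left; apply: (integral_frame_Zrep conD vS intS _ oe xZ) => [x xD|x xD res1|].
  - by rewrite norm2.
  - apply: maxn; exists (snoc n e (residue n e (v x))); apply: Dframe_snoc => // i.
    exact: xZ.
  apply: contrapT => no_x.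
  have e0 : dot (e 0%N + e 0%N) (e 0%N) = 0.
    apply: zspan_dot0 (Le 0%N 0%N _ _); try lia.
    move=> _ [x xD ->]; apply: contrapT => xe; apply: no_x.
    by exists x, 0%N; split=> //; lia.
  move: e0; rewrite dotDl oe //; last by lia.
    by move/eqP; rewrite -mulr2n mulrn_eq0 /= pnatr_eq0.
  by lia.
move=> /existsNP[x /existsNP[i /not_implyP[xD /not_implyP[ltin /negP nint]]]].
have Lx := lattice_gen v xD; have x2 : dot (v x) (v x) = 2 by rewrite vS ?norm2.
have [n4'|n4'] := eqVneq n 4%N.
  by case: maxn; rewrite n4' in De ltin *; apply: (triality De Lx x2 ltin nint).
have n5 : (5 <= n)%N by lia.
right; have De5 : Dframe D v 5 e.
  by split=> a b a5 b5; [apply: oe|apply: Le]; lia.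
apply: (exceptional_E8rep conD vS intS norm2 De5 xD (i0 := 0)) => //.
by apply: half_nint; apply: (coord_half vS intS De Lx ltin nint); lia.
Qed.

(** A model is [e_0 - e_1, ..., e_0 - e_n], which generates the root lattice [A_n]. *)
Definition root_clique n (a : nat -> 'cV[R]_p) :=
  (forall i, (i < n)%N -> L (a i)) /\
  (forall i j, (i < n)%N -> (j < n)%N -> dot (a i) (a j) = (i == j)%:R + 1).

Lemma root_clique_le n a : root_clique n a -> (n <= p)%N.
Proof.
move=> [_ aa]; apply: (independent_le (e := a)) => c c0.
have : dot (\sum_i c i *: a i) (\sum_i c i *: a i) = \sum_i c i ^+ 2 + (\sum_i c i) ^+ 2.
  rewrite dot_suml [X in _ = _ + X]expr2 mulr_suml -big_split /=; apply: eq_bigr => i _.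
  rewrite dotZl dot_sumr -[c i ^+ 2]/(c i * c i) -mulrDr; congr (_ * _).
  rewrite (eq_bigr (fun j : 'I_n => c j * (i == j)%:R + c j)) => [|j _]; last by rewrite dotZr aa // mulrDr mulr1.
  rewrite big_split /=; congr (_ + _); rewrite (bigD1 i) //= eqxx mulr1 big1 ?addr0 // => j.
  by rewrite eq_sym -val_eqE => /negbTE /= ->; rewrite mulr0.
rewrite c0 dot0l => /esym sum0 i.
have /psumr_eq0P ci : forall i : 'I_n, true -> 0 <= c i ^+ 2 by move=> *; exact: sqr_ge0.
have /ci/(_ i isT)/eqP : \sum_i c i ^+ 2 = 0.
  have : 0 <= \sum_i c i ^+ 2 by apply: sumr_ge0 => *; exact: sqr_ge0.
  by have := sqr_ge0 (\sum_i c i); lra.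
by rewrite sqrf_eq0 => /eqP.
Qed.

Lemma roots_eq u w : dot u u = 2 -> dot w w = 2 -> 2 <= dot u w -> u = w.
Proof.
move=> u2 w2 uw; apply/eqP; rewrite -subr_eq0; apply/eqP/dot_eq0.
have := dot_ge0 (u - w); rewrite !(dotBl, dotBr) (dotC w) u2 w2; lra.
Qed.

(** In [D_4], take [u1 = e_0 + e_1], [u2 = e_0 + e_2], [u3 = e_0 + e_3] and [w = e_1 + e_2], and
    solve for the [e_i]. *)
Lemma D4_of_triangle u1 u2 u3 w : L u1 -> L u2 -> L u3 -> L w ->
  dot u1 u1 = 2 -> dot u2 u2 = 2 -> dot u3 u3 = 2 -> dot w w = 2 ->
  dot u1 u2 = 1 -> dot u1 u3 = 1 -> dot u2 u3 = 1 ->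
  dot w u1 = 1 -> dot w u2 = 1 -> dot w u3 = 0 -> exists e, Dframe D v 4 e.
Proof.
move=> L1 L2 L3 Lw d11 d22 d33 dww d12 d13 d23 dw1 dw2 dw3.
have d21 : dot u2 u1 = 1 by rewrite dotC. have d31 : dot u3 u1 = 1 by rewrite dotC.
have d32 : dot u3 u2 = 1 by rewrite dotC. have d1w : dot u1 w = 1 by rewrite dotC.
have d2w : dot u2 w = 1 by rewrite dotC. have d3w : dot u3 w = 0 by rewrite dotC.
pose F (a : nat -> R) := a 0%N *: u1 + a 1%N *: u2 + a 2%N *: u3 + a 3%N *: w.
(* The four vectors to be found have the same coefficients rho / 2 modulo the integers. *)
pose rho i : R := nth 0 [:: 1; 1; 0; 1] i.
pose m k i : R := nth 0 (nth [::] [:: [:: 0; 0; 0; -1]; [:: 0; -1]; [:: -1]; [:: -1; -1; 1]] k) i.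
have mZ k i : m k i \is a Num.int.
  rewrite /m; case: k => [|[|[|[|k]]]] /=; rewrite ?nth_nil ?rpred0 //;
  by case: i => [|[|[|[|i]]]] /=; rewrite ?nth_nil ?rpredN ?rpred1 ?rpred0.
exists (fun k => F (fun i => rho i / 2 + m k i)); split=> i j i4 j4.
  rewrite /F !(dotDl, dotDr, dotZl, dotZr) d11 d12 d13 d21 d22 d23 d31 d32 d33 dww.
  rewrite d1w d2w d3w dw1 dw2 dw3 /rho /m.
  by case: i i4 => [|[|[|[|]]]] // _; case: j j4 => [|[|[|[|]]]] // _ /=; field.
rewrite (_ : _ + _ = F (fun k => rho k + m i k + m j k)); last first.
  by apply/matrixP => x y; rewrite !mxE; field.
have cZ k : rho k + m i k + m j k \is a Num.int.
  do 2?[apply: rpredD => //]; rewrite /rho.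
  by case: k => [|[|[|[|k]]]] /=; rewrite ?nth_nil ?rpred0 ?rpred1.
by rewrite /F; do 3?[apply: subgroupD => //]; apply: subgroupZ.
Qed.

(** In a maximal root clique [a], consider a root [w] with [dot w (a i) = 1]. Unless [w] is some
    [a j] or [a i - a j], its inner products with the clique are 0 and 1. All equal to 1, or only
    one, and the clique extends by [w] or by [a i - w]; otherwise [w] and three members of the
    clique generate [D_4]. *)
Lemma clique_rep x0 : x0 \in D -> ~ (exists e, Dframe D v 4 e) -> Zrep D S.
Proof.
move=> x0D noD4; pose P n := exists2 a, root_clique n a & a 0%N = v x0.
have P1 : P 1%N.
  exists (fun=> v x0) => //; split=> [i _|i j]; first exact: lattice_gen.
  by rewrite !ltnS !leqn0 => /eqP-> /eqP->; rewrite vS // norm2.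
have [n [a aP _]|n [n1 [a [La aa] a0] maxn]] := ex_maximal (b := p) P1.
  exact: root_clique_le aP.
have no_ext w : L w -> dot w w = 2 -> ~ (forall j, (j < n)%N -> dot w (a j) = 1).
  move=> Lw w2 wa; apply: maxn; exists (snoc n a w); last by rewrite /snoc n1.
  split=> [i|i j]; rewrite /snoc !ltnS.
    by case: (ltnP i n) => // ltin _; apply: La.
  case: (ltnP i n) => ltin; case: (ltnP j n) => ltjn lein lejn.
  - exact: aa.
  - by rewrite dotC wa // (_ : (i == j) = false) ?add0r //; lia.
  - by rewrite wa // (_ : (i == j) = false) ?add0r //; lia.
  - by rewrite w2 (_ : i == j) //; lia.
pose A w := exists2 i, (i < n)%N & w = a i.
have sgA := zspan_subgroup A.
have Aa i : (i < n)%N -> zspan A (a i) by move=> ltin; apply: zspan_gen; exists i.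
have a2 i : (i < n)%N -> dot (a i) (a i) = 2 by move=> ltin; rewrite aa // eqxx.
have a1 i j : (i < n)%N -> (j < n)%N -> i <> j -> dot (a i) (a j) = 1.
  by move=> ltin ltjn /eqP/negbTE ij; rewrite aa // ij add0r.
have step1 w i : L w -> dot w w = 2 -> (i < n)%N -> dot w (a i) = 1 -> zspan A w.
  move=> Lw w2 ltin wi; apply: contrapT => Aw.
  have wZ j : (j < n)%N -> dot w (a j) \is a Num.int.
    by move=> ltjn; apply: (lattice_int vS intS) => //; apply: La.
  have wle j : (j < n)%N -> dot w (a j) < 2.
    move=> ltjn; rewrite ltNge; apply/negP => w2j; case: Aw.
    by rewrite (roots_eq w2 (a2 j ltjn) w2j); apply: Aa.
  have wge j : (j < n)%N -> -1 < dot w (a j).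
    move=> ltjn; rewrite ltNge; apply/negP => wj; case: Aw.
    have ij : i <> j by move=> ij; move: wj; rewrite -ij wi; lra.
    rewrite (@roots_eq w (a i - a j)) //; first by apply: subgroupB => //; apply: Aa.
      rewrite !(dotBl, dotBr) !a2 // !a1 //; first by lra.
      by move=> ji; apply: ij.
    by rewrite dotBr wi; lra.
  have w01 j : (j < n)%N -> dot w (a j) = 0 \/ dot w (a j) = 1.
    move=> ltjn; have := wle j ltjn; have := wge j ltjn => lo hi.
    have w4 : dot w (a j) ^+ 2 < 4 by nra.
    by have [h|h|h] := int_sqr_lt4 (wZ j ltjn) w4; [move: lo; rewrite h; lra|left|right].
  have [k ltkn wk] : exists2 k, (k < n)%N & dot w (a k) = 0.
    apply: contrapT => no_k; apply: (no_ext w) => // j ltjn.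
    by have [wj|//] := w01 j ltjn; case: no_k; exists j.
  have ik : i <> k by move=> ik; move: wi; rewrite ik wk; lra.
  have [[j [ltjn ij wj]]|no_j] := pselect (exists j, [/\ (j < n)%N, i <> j & dot w (a j) = 1]).
    have jk : j <> k by move=> jk; move: wj; rewrite jk wk; lra.
    apply: noD4; apply: (@D4_of_triangle (a i) (a j) (a k) w); rewrite ?a2 ?a1 //; exact: La.
  apply: (no_ext (a i - w)).
  - by apply: subgroupB => //; apply: La.
  - by rewrite !(dotBl, dotBr) (dotC _ w) wi a2 // w2; lra.
  move=> j ltjn; have [<-|/eqP ij] := eqVneq i j; first by rewrite dotBl a2 // wi; lra.
  rewrite dotBl a1 //; have [->|wj] := w01 j ltjn; first by rewrite subr0.
  by case: no_j; exists j.
have step w i : L w -> dot w w = 2 -> (i < n)%N -> dot w (a i) <> 0 -> zspan A w.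
  move=> Lw w2 ltin wi0.
  have wZ : dot w (a i) \is a Num.int.
    by apply: (lattice_int vS intS) => //; apply: La.
  have opp : zspan A (- w) -> zspan A w.
    by move=> Aw; rewrite -[w]opprK; apply: subgroupN.
  have w2N : dot (- w) (- w) = 2 by rewrite dotNl dotNr opprK.
  have [w2i|w2i] := lerP 2 (dot w (a i)).
    by rewrite (roots_eq w2 (a2 i ltin) w2i); apply: Aa.
  have [w2i'|w2i'] := lerP 2 (dot (- w) (a i)).
    by apply: opp; rewrite (roots_eq w2N (a2 i ltin) w2i'); apply: Aa.
  rewrite dotNl in w2i'; have w4 : dot w (a i) ^+ 2 < 4 by nra.
  have [wi|//|wi] := int_sqr_lt4 wZ w4; last exact: (step1 _ i).
  by apply/opp/(step1 _ i) => //; [exact: subgroupN|rewrite dotNl wi opprK].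
have Aall : {in D, forall x, zspan A (v x)}.
  apply: (connected_on_ind conD x0D); first by rewrite -a0; apply: Aa.
  move=> x y xD yD Sxy Ax; apply: contrapT => Ay; case/negP: Sxy; rewrite -vS //.
  apply/eqP; apply: zspan_dot0 Ax => _ [i ltin ->]; apply: contrapT => ya.
  apply/Ay/(step _ i) => //; first exact: lattice_gen.
    by rewrite vS ?norm2.
  by rewrite dotC.
pose eps i : 'cV[R]_n.+1 := delta_mx i 0.
pose img i := eps ord0 - eps (inord i.+1).
pose G (g : 'cV[R]_p * 'cV[R]_n.+1) := exists2 i, (i < n)%N & g = (a i, img i).
have sgG := zspan_subgroup G.
have /choice[b bG] : forall x, exists w' : 'cV[R]_n.+1, x \in D -> zspan G (v x, w').
  move=> x; have [xD|] := boolP (x \in D); last by exists 0.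
  pose Q w := exists w' : 'cV[R]_n.+1, zspan G (w, w').
  have [w' Gw'] : Q (v x); last by exists w'.
  apply: zspan_min (Aall x xD); last by move=> _ [i ltin ->]; exists (img i); apply: zspan_gen; exists i.
  split; first by exists 0; apply: zspan0.
  by move=> y z [y' Gy] [z' Gz]; exists (y' - z'); apply: (zspanB Gy Gz).
exists n.+1, b; split=> [x xD|x y xD yD].
  have GE : forall q, zspan G q -> forall i, q.2 i 0 \is a Num.int.
    apply: zspan_min.
      by split=> [i|y z yZ zZ i]; rewrite !mxE ?rpred0 // rpredB ?yZ ?zZ.
    by move=> _ [i ltin ->] l /=; rewrite !mxE rpredB ?natr_int.
  exact: (GE _ (bG x xD)).
have deps (i j : 'I_n.+1) : dot (eps i) (eps j) = (i == j)%:R.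
  rewrite /dot (bigD1 i) //= !mxE !eqxx mul1r andbT big1 ?addr0 // => k /negbTE ki.
  by rewrite !mxE ki mul0r.
rewrite -vS //; symmetry; apply: (zspan_pair_dot _ (bG x xD) (bG y yD)).
move=> _ _ [i ltin ->] [j ltjn ->] /=; rewrite aa // !(dotBl, dotBr) !deps.
rewrite -!val_eqE /= !inordK ?ltnS // eqSS /=; ring.
Qed.

End Classification.

Section Classify.
Variables (R : realType) (X : finType).

(** This is the part of the classification of root lattices that is needed: each irreducible one
    embeds in [Z^n] or in [E_8]. *)
Lemma psd_Zrep_or_E8rep (D : {set X}) (S : X -> X -> R) x0 :
  (forall x y, S x y = S y x) -> {in D &, forall x y, S x y \is a Num.int} ->
  {in D, forall x, S x x = 1 \/ S x x = 2} -> connected_on D S -> x0 \in D ->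
  psd_on D S -> Zrep D S \/ E8rep D S.
Proof.
move=> symS intS normS conD x0D psdS; have [p [v vS]] := psd_gram symS psdS.
have normS2 : {in D, forall x, S x x <= 2} by move=> x /normS[]->; lra.
have [[x xD Sx]|no1] := pselect (exists2 x, x \in D & S x x = 1).
  by left; apply: (unit_vector_Zrep conD vS intS normS2 xD Sx).
have norm2 : {in D, forall x, S x x = 2}.
  by move=> x xD; have [Sx|//] := normS x xD; case: no1; exists x.
have [D4|noD4] := pselect (exists e, Dframe D v 4 e).
  exact: (D4_rep conD vS intS norm2 D4).
by left; apply: (clique_rep conD vS intS norm2 x0D noD4).
Qed.

End Classify.

(** * Gluing local coordinates of a functional *)

Section Rich.
Variables (R : realType) (X : finType) (S : X -> X -> R).
Hypothesis symS : forall x y, S x y = S y x.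
Hypothesis intS : forall x y, S x y \is a Num.int.
Hypothesis normS : forall x, S x x <= 2.
Variables (n : nat) (phi : X -> 'cV[R]_n) (Y : {set X}).
Hypothesis phiZ : {in Y, forall y i, phi y i 0 \is a Num.int}.
Hypothesis phiS : gram_on Y S phi.
Implicit Types (T : {set X}) (g h w : 'cV[R]_n).

Let unit_vec (i : 'I_n) : 'cV[R]_n := delta_mx i 0.

Lemma dot_delta g i : dot g (unit_vec i) = g i 0.
Proof.
rewrite /dot (bigD1 i) //= mxE !eqxx mulr1 big1 ?addr0 // => k /negbTE ki.
by rewrite mxE ki mulr0.
Qed.

Definition supp w : {set 'I_n} := [set i | w i 0 != 0].

Lemma supp_le w : (forall i, w i 0 \is a Num.int) -> #|supp w|%:R <= dot w w.
Proof.
move=> wZ; rewrite -sum1_card natr_sum /dot [X in _ <= X](bigID (mem (supp w))) /=.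
rewrite -[X in X <= _]addr0; apply: lerD; last by apply: sumr_ge0 => i _; rewrite -expr2 sqr_ge0.
by apply: ler_sum => i; rewrite inE => wi; rewrite -expr2 sqr_intr_ge1.
Qed.

Lemma sum_norm_le w : (forall i, w i 0 \is a Num.int) -> \sum_i `|w i 0| <= dot w w.
Proof.
move=> wZ; apply: ler_sum => i _; rewrite -expr2 -intr_normK //.
by apply: intr_ler_sqr; apply: intr_nat; apply: natr_norm_int.
Qed.

(** Then the coordinates [i] and [j] of a vector with integral inner products with the [phi y],
    for [y] in [T], are equal up to sign modulo the integers. *)
Definition tied T i j := exists2 s : R, s = 1 \/ s = -1 & lattice_of T phi (unit_vec i + s *: unit_vec j).

Definition covered T i := exists2 y, y \in T & phi y i 0 != 0.

(** The number comes from vectors of norm at most 2, which have at most 200 coordinates of absolute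
    value at least [1/10]. *)
Definition rich T := forall i, covered T i ->
  exists2 J : {set 'I_n}, (200 < #|J|)%N & forall j, j \in J -> tied T i j.

Lemma tied_mono T T' i j : T \subset T' -> tied T i j -> tied T' i j.
Proof.
move=> /fintype.subsetP sTT' [s s1 Ls]; exists s => //; apply: zspan_min Ls.
  exact: zspan_subgroup.
by move=> _ [y yT ->]; apply: lattice_gen; apply: sTT'.
Qed.

Lemma rich_cover T :
  (forall i, covered T i -> exists T', [/\ T' \subset T, rich T' & covered T' i]) -> rich T.
Proof.
move=> cov i /cov[T' [sT'T rT' /rT'[J J200 JT']]]; exists J => // j /JT'.
exact: tied_mono.
Qed.

Lemma int_lt_add1 (a b : R) : a \is a Num.int -> b \is a Num.int -> a < b + 1 -> a <= b.
Proof.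
case/intrP=> k -> /intrP[l ->]; rewrite -[1]/(1%:~R) -intrD ltr_int ler_int; lia.
Qed.

(** The inner products of [x] with [T] are those of a real vector [xi] of norm at most 2. A large
    class contains an index where [xi] is below [1/10] in absolute value, and then all the
    coordinates of [xi] in this class are within [1/10] of integers. Rounding changes the inner
    product with an integral vector of norm at most 2 by at most [2/10], hence not at all, and it
    multiplies the norm by at most [100/81], hence keeps it below [S x x + 1]. *)
Lemma rich_functional T x : T \subset Y -> x \notin T -> psd_on (x |: T) S -> rich T ->
  exists g, [/\ forall i, g i 0 \is a Num.int,
    {in T, forall y, dot g (phi y) = S x y} & dot g g <= S x x].
Proof.
move=> /fintype.subsetP sTY xT psdT rT.
have phiST : gram_on T S phi by move=> y z yT zT; apply: phiS; apply: sTY.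
have [xi xiS xixi] := psd_extend xT symS phiST psdT.
have c0 : (0 : R) <= 10 / 9 by lra.
have near_int i : exists m, [/\ m \is a Num.int, `|m| <= 10 / 9 * `|xi i 0| &
    covered T i -> `|xi i 0 - m| < 1 / 10].
  have [ci|nci] := pselect (covered T i); last first.
    by exists 0; split=> //; rewrite ?rpred0 // normr0 mulr_ge0.
  have [J J200 JT] := rT i ci.
  have [j jJ xij] : exists2 j, j \in J & `|xi j 0| < 1 / 10.
    apply: contrapT => no_j; suff : 2 < dot xi xi by have := normS x; lra.
    apply: (@lt_le_trans _ _ (\sum_(j in J) 100^-1)).
      rewrite sumr_const -[_ *+ _]mulr_natl.
      have : (201 : R) <= #|J|%:R by rewrite ler_nat.
      lra.
    rewrite /dot [X in _ <= X](bigID (mem J)) /= -[X in X <= _]addr0; apply: lerD; last first.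
      by apply: sumr_ge0 => j _; rewrite -expr2 sqr_ge0.
    apply: ler_sum => j jJ; have : 1 / 10 <= `|xi j 0|.
      by rewrite leNgt; apply/negP => xij; apply: no_j; exists j.
    have : `|xi j 0| ^+ 2 = xi j 0 * xi j 0 by rewrite real_normK ?num_real ?expr2.
    by rewrite expr2 => <-; have := normr_ge0 (xi j 0); nra.
  have [s s1 Ls] := JT j jJ.
  have mZ : xi i 0 + s * xi j 0 \is a Num.int.
    rewrite -!dot_delta -dotZr -dotDr dotC; apply: zspan_dot_int Ls => _ [y yT ->].
    by rewrite dotC xiS.
  have ns : `|s * xi j 0| < 1 / 10.
    by rewrite normrM (_ : `|s| = 1) ?[1 * `|_|]mul1r //; case: s1 => ->; rewrite ?normrN normr1.
  exists (xi i 0 + s * xi j 0); split=> //; last by rewrite opprD addNKr normrN.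
  have [->|m0] := eqVneq (xi i 0 + s * xi j 0) 0; first by rewrite normr0 mulr_ge0.
  have := norm_intr_ge1 mZ m0; have := ler_normD (xi i 0) (s * xi j 0); lra.
have /choice[m mP] := near_int.
pose g : 'cV[R]_n := \col_i m i.
have gZ i : g i 0 \is a Num.int by rewrite mxE; case: (mP i).
exists g; split=> // [y yT|].
  apply/eqP; rewrite -subr_eq0; apply/eqP/int_lt1_eq0.
    rewrite rpredB // rpred_sum // => i _; rewrite rpredM // phiZ //; exact: sTY.
  rewrite -xiS // -dotBl; apply: (@le_lt_trans _ _ (1 / 10 * \sum_i `|phi y i 0|)).
    rewrite mulr_sumr; apply: le_trans (ler_norm_sum _ _ _) _.
    apply: ler_sum => i _; rewrite normrM !mxE.
    have [->|yi] := eqVneq (phi y i 0) 0; first by rewrite normr0 !mulr0.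
    apply: ler_wpM2r => //; rewrite distrC; apply: ltW.
    by case: (mP i) => _ _; apply; exists y.
  have yY := sTY _ yT; have := sum_norm_le (phiZ yY); rewrite phiS //.
  by have := normS y; lra.
apply: int_lt_add1 => //; first by rewrite rpred_sum // => i _; rewrite rpredM.
apply: (@le_lt_trans _ _ (100 / 81 * S x x)); last by have := normS x; lra.
apply: (@le_trans _ _ (100 / 81 * dot xi xi)); last by lra.
rewrite /dot mulr_sumr; apply: ler_sum => i _; rewrite mxE.
have [_ mi _] := mP i.
have -> : m i * m i = `|m i| ^+ 2 by rewrite real_normK ?num_real ?expr2.
have -> : xi i 0 * xi i 0 = `|xi i 0| ^+ 2 by rewrite real_normK ?num_real ?expr2.
have := normr_ge0 (m i); nra.
Qed.

(** The difference is orthogonal to the span of [T], so its absolute value is constant on a class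
    of tied coordinates, and it has at most 4 nonzero coordinates. *)
Lemma rich_unique T g g' : rich T -> (forall i, g i 0 \is a Num.int) ->
  (forall i, g' i 0 \is a Num.int) -> dot g g <= 2 -> dot g' g' <= 2 ->
  {in T, forall y, dot g (phi y) = dot g' (phi y)} ->
  forall i, covered T i -> g i 0 = g' i 0.
Proof.
move=> rT gZ g'Z g2 g'2 gg' i /rT[J J200 JT].
have [j /setDP[jJ]] : exists j, j \in J :\: (supp g :|: supp g').
  apply/set0Pn; rewrite -card_gt0; have : (#|supp g :|: supp g'| <= 4)%N.
    apply: leq_trans (leq_card_setU _ _) _.
    have := supp_le gZ; have := supp_le g'Z => s' s.
    have : (#|supp g| <= 2)%N by rewrite -(ler_nat R) (le_trans s).
    have : (#|supp g'| <= 2)%N by rewrite -(ler_nat R) (le_trans s').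
    lia.
  by have := cardsID (supp g :|: supp g') J; have := subset_leq_card (finset.subsetIr J (supp g :|: supp g')); lia.
rewrite !inE negb_or !negbK => /andP[/eqP gj /eqP g'j].
have [s _ Ls] := JT j jJ.
have /eqP : dot (unit_vec i + s *: unit_vec j) (g - g') = 0.
  apply: zspan_dot0 Ls => _ [y yT ->].
  by rewrite dotC dotBl gg' ?subrr.
by rewrite dotC dotDr dotZr !dot_delta !mxE gj g'j subrr mulr0 addr0 subr_eq0 => /eqP.
Qed.

(** By uniqueness, the local solutions on the [B y] agree where they overlap, already on unions of
    two of them. If the glued vector were too long, three of its coordinates, hence a union of
    three [B y], would show it. This is why sets of size [3 * b] suffice. *)
Lemma glue_functionals x (B : X -> {set X}) b : x \notin Y ->
  (forall y, y \in Y -> [/\ y \in B y, B y \subset Y, rich (B y) & (#|B y| <= b)%N]) ->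
  (forall T, T \subset Y -> (#|T| <= 3 * b)%N -> psd_on (x |: T) S) ->
  exists g, [/\ forall i, g i 0 \is a Num.int,
    {in Y, forall y, dot g (phi y) = S x y} & dot g g <= S x x].
Proof.
move=> xY BP psdT.
have fun_on T : T \subset Y -> (#|T| <= 3 * b)%N -> rich T ->
    exists g, [/\ forall i, g i 0 \is a Num.int,
      {in T, forall y, dot g (phi y) = S x y} & dot g g <= S x x].
  move=> sTY T3b rT; apply: rich_functional => //; last exact: psdT.
  by apply: contra xY; apply: (fintype.subsetP sTY).
have /choice[gB gBP] : forall y, exists g, y \in Y -> [/\ forall i, g i 0 \is a Num.int,
      {in B y, forall z, dot g (phi z) = S x z} & dot g g <= S x x].
  move=> y; have [yY|_] := boolP (y \in Y); last by exists 0.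
  have [_ sBY rB Bb] := BP y yY.
  by have [|g gP] := fun_on _ sBY _ rB; [lia|exists g].
have /choice[yi yiP] : forall i : 'I_n, exists y, covered Y i -> y \in Y /\ phi y i 0 != 0.
  move=> i; have [[y yY yi]|nci] := pselect (covered Y i); first by exists y.
  by exists x.
pose g : 'cV[R]_n := \col_i (if `[< covered Y i >] then gB (yi i) i 0 else 0).
have le2 (h : 'cV[R]_n) : dot h h <= S x x -> dot h h <= 2 by move/le_trans; apply.
have consistent y i T (h : 'cV[R]_n) : y \in Y -> B y \subset T -> T \subset Y ->
    (forall i, h i 0 \is a Num.int) -> {in T, forall z, dot h (phi z) = S x z} ->
    dot h h <= S x x -> covered (B y) i -> gB y i 0 = h i 0.
  move=> yY sBT sTY hZ hS hn ci; have [_ sBY rB _] := BP y yY.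
  have [gZ gS gn] := gBP y yY.
  apply: (rich_unique rB) => // [||z zB]; [exact: le2|exact: le2|].
  by rewrite gS // hS // (fintype.subsetP sBT).
have cov_yi i : covered Y i -> covered (B (yi i)) i.
  by move=> /yiP[yY yi0]; exists (yi i) => //; case: (BP _ yY).
have richU T : (forall i, covered T i -> exists2 y, y \in Y & B y \subset T /\ covered (B y) i) -> rich T.
  move=> TB; apply: rich_cover => i /TB[y yY [sBT ci]]; exists (B y); split=> //.
  by case: (BP y yY).
have gE y i : y \in Y -> covered (B y) i -> g i 0 = gB y i 0.
  move=> yY ci; have [_ sBY rB Bb] := BP y yY.
  have cYi : covered Y i by case: ci => z zB zi; exists z => //; apply: (fintype.subsetP sBY).
  rewrite mxE asboolT //; have [yiY yi0] := yiP i cYi; have [_ sB'Y rB' B'b] := BP _ yiY.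
  have sUY : B y :|: B (yi i) \subset Y by rewrite finset.subUset sBY.
  have [||h [hZ hS hn]] := fun_on _ sUY.
  - by apply: leq_trans (leq_card_setU _ _) _; lia.
  - apply: richU => l [z]; rewrite inE => /orP[zB|zB] zl.
      by exists y => //; split; [exact: finset.subsetUl|exists z].
    by exists (yi i) => //; split; [exact: finset.subsetUr|exists z].
  rewrite (consistent (yi i) i _ h yiY (finset.subsetUr (B y) _)) //; last exact: cov_yi.
  by rewrite (consistent y i _ h yY (finset.subsetUl _ (B (yi i)))).
have gZ i : g i 0 \is a Num.int.
  rewrite mxE; case: asboolP => [ci|_]; last exact: rpred0.
  by have [yY _] := yiP i ci; case: (gBP _ yY).
exists g; split=> // [y yY|].
  have [yB sBY rB Bb] := BP y yY; have [_ gS _] := gBP y yY; rewrite -gS //.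
  apply: eq_bigr => i _; have [->|yi0] := eqVneq (phi y i 0) 0; first by rewrite !mulr0.
  by rewrite (gE y) //; exists y.
rewrite leNgt; apply/negP => gn.
(* The coordinates are integral and S x x <= 2, so three nonzero ones always witness that g is
   too long. *)
have [I0 I3 gI0] : exists2 I0 : {set 'I_n}, (#|I0| <= 3)%N & S x x < \sum_(i in I0) g i 0 ^+ 2.
  have [s3|s3] := leqP 3 #|supp g|; last first.
    exists (supp g); first exact: ltnW.
    apply: (lt_le_trans gn); rewrite /dot (bigID (mem (supp g))) /= [X in _ + X]big1 ?addr0.
      by apply: ler_sum => i _; rewrite expr2.
    by move=> i; rewrite inE negbK => /eqP->; rewrite mulr0.
  have [s0 [s0u s03 s0g]] := card_geqP s3.
  exists [set i in s0]; first by rewrite cardsE (card_uniqP s0u) s03.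
  apply: (@lt_le_trans _ _ (\sum_(i in [set i in s0]) 1)).
    by rewrite sumr_const cardsE (card_uniqP s0u) s03 (le_lt_trans (normS x)) ?ltr_nat.
  by apply: ler_sum => i; rewrite inE => /s0g; rewrite inE => gi; rewrite sqr_intr_ge1.
pose I1 := [set i in I0 | g i 0 != 0].
have cov1 i : i \in I1 -> covered Y i.
  by rewrite !inE mxE => /andP[_]; case: asboolP => // _; rewrite eqxx.
pose T := \bigcup_(i in I1) B (yi i).
have sTY : T \subset Y.
  by apply/bigcupsP => i /cov1/yiP[yY _]; case: (BP _ yY).
have sBT i : i \in I1 -> B (yi i) \subset T by move=> iI; apply: (bigcup_max i).
have I13 : (#|I1| <= 3)%N.
  by apply: leq_trans (subset_leq_card _) I3; apply/fintype.subsetP => i; rewrite inE => /andP[].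
have T3b : (#|T| <= 3 * b)%N.
  apply: (@leq_trans (\sum_(i in I1) #|B (yi i)|)).
    rewrite /T; elim/big_rec2: _ => [|i m U _ Um]; first by rewrite cards0.
    by apply: leq_trans (leq_card_setU _ _) _; rewrite leq_add2l.
  apply: (@leq_trans (\sum_(i in I1) b)).
    by apply: leq_sum => i /cov1/yiP[yY _]; case: (BP _ yY).
  by rewrite sum_nat_const leq_mul2r I13 orbT.
have rT : rich T.
  apply: richU => l [z /bigcupP[i iI zB] zl]; exists (yi i); first by case: (yiP i (cov1 i iI)).
  by split; [exact: sBT|exists z].
have [h [hZ hS hn]] := fun_on T sTY T3b rT.
suff : \sum_(i in I0) g i 0 ^+ 2 <= S x x by rewrite leNgt gI0.
apply: (le_trans _ hn); rewrite (bigID (fun i => g i 0 != 0)) /= [X in _ + X]big1 ?addr0; last first.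
  by move=> i /andP[_]; rewrite negbK => /eqP->; rewrite expr0n.
rewrite (eq_bigl (mem I1)) => [|i]; last by rewrite /= inE.
rewrite /dot [X in _ <= X](bigID (mem I1)) /= -[X in X <= _]addr0; apply: lerD; last first.
  by apply: sumr_ge0 => i _; rewrite -expr2 sqr_ge0.
apply: ler_sum => i iI; have [yY yi0] := yiP i (cov1 i iI).
have ci := cov_yi i (cov1 i iI).
by rewrite -expr2 (gE _ i yY ci) (consistent _ i T h yY (sBT i iI) sTY hZ hS hn ci).
Qed.

(** The norm that [g] lacks is supplied in two fresh coordinates. *)
Lemma Zrep_extend x (B : X -> {set X}) b : x \notin Y ->
  (forall y, y \in Y -> [/\ y \in B y, B y \subset Y, rich (B y) & (#|B y| <= b)%N]) ->
  (forall T, T \subset Y -> (#|T| <= 3 * b)%N -> psd_on (x |: T) S) ->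
  Zrep (x |: Y) S.
Proof.
move=> xY BP psdT; have [g [gZ gS gn]] := glue_functionals xY BP psdT.
have [f [fZ ff]] : exists f : 'cV[R]_2, (forall i, f i 0 \is a Num.int) /\ dot f f = S x x - dot g g.
  have nZ : S x x - dot g g \is a Num.int.
    by rewrite rpredB // rpred_sum // => i _; rewrite rpredM.
  have n0 : 0 <= S x x - dot g g by rewrite subr_ge0.
  have n2 : S x x - dot g g <= 2 by have := normS x; have := dot_ge0 g; lra.
  have n4 : (S x x - dot g g - 1) ^+ 2 < 4 by nra.
  have [r|r|r] := int_sqr_lt4 (rpredB nZ (rpred1 _)) n4.
  - exists 0; split=> [i|]; first by rewrite mxE rpred0.
    by rewrite dot0l; lra.
  - exists (\col_i (val i == 0%N)%:R); split=> [i|]; first by rewrite mxE natr_int.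
    by rewrite [LHS]/dot !big_ord_recr big_ord0 /= !mxE /=; lra.
  - exists (const_mx 1); split=> [i|]; first by rewrite mxE rpred1.
    by rewrite [LHS]/dot !big_ord_recr big_ord0 /= !mxE /=; lra.
exists (n + 2)%N, (fun y => if y == x then col_mx g f else col_mx (phi y) 0).
have yx y : y \in Y -> (y == x) = false.
  by move=> yY; apply: contraNF xY => /eqP<-.
split=> [y|y z] /setU1P yP.
  move=> i; case: (split_ordP i) => j ->; case: yP => [->|yY]; rewrite ?eqxx ?yx //.
  - by rewrite col_mxEu.
  - by rewrite col_mxEu phiZ.
  - by rewrite col_mxEd.
  - by rewrite col_mxEd mxE rpred0.
move=> /setU1P zP; case: yP zP => [->|yY] [->|zY]; rewrite ?eqxx ?yx // dot_col_mx.
- by rewrite ff addrC subrK.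
- by rewrite gS // dot0r addr0.
- by rewrite dotC gS // dot0l addr0 symS.
- by rewrite phiS // dot0l addr0.
Qed.

End Rich.

(** * Growing connected sets *)

Section Growth.
Variables (R : realType) (X : finType) (S : X -> X -> R).
Hypothesis symS : forall x y, S x y = S y x.
Implicit Types (D Y : {set X}).

Lemma linked_sym D : connect_sym (linked D S).
Proof.
apply: sym_connect_sym => x y; rewrite /linked symS.
by apply/and3P/and3P => -[].
Qed.

Lemma connected_on1 x : connected_on [set x] S.
Proof. by move=> y z /set1P-> /set1P->; apply: connect0. Qed.

Lemma connected_onU1 Y x y : connected_on Y S -> y \in Y -> S y x != 0 ->
  connected_on (x |: Y) S.
Proof.
move=> cY yY Syx; have toy z : z \in x |: Y -> connect (linked (x |: Y) S) y z.
  case/setU1P => [->|zY].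
    by apply: connect1; rewrite /linked setU11 setU1r.
  have := cY y z yY zY; apply: connect_sub => a b /and3P[aY bY Sab].
  by apply: connect1; rewrite /linked !setU1r.
move=> a b aY bY; apply: (connect_trans _ (toy b bY)).
by rewrite linked_sym toy.
Qed.

Lemma connected_grow D Y y0 : connected_on D S -> Y \subset D -> y0 \in Y ->
  connected_on Y S -> (#|Y| < #|D|)%N ->
  exists x, [/\ x \in D, x \notin Y & connected_on (x |: Y) S].
Proof.
move=> cD /fintype.subsetP sYD y0Y cY ltYD; apply: contrapT => no_x.
have sDY : {in D, forall x, x \in Y}.
  apply: (connected_on_ind cD (sYD _ y0Y) y0Y) => x y xD yD Sxy xY.
  apply: contrapT => /negP yY; apply: no_x; exists y; split=> //.
  exact: connected_onU1 Sxy.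
by move: ltYD; rewrite ltnNge subset_leq_card //; apply/fintype.subsetP.
Qed.

Lemma connected_subset_of_size D x0 m : connected_on D S -> x0 \in D ->
  (0 < m <= #|D|)%N -> exists B : {set X}, [/\ x0 \in B, B \subset D, connected_on B S & #|B| = m].
Proof.
move=> cD x0D; elim: m => // -[|m] IHm /andP[_ mD].
  exists [set x0]; rewrite set11 sub1set cards1; split=> //; exact: connected_on1.
have [|B [x0B sBD cB Bm]] := IHm; first by apply: ltnW.
have [|x [xD xB cxB]] := connected_grow cD sBD x0B cB; first by rewrite Bm.
exists (x |: B); split=> //; first by rewrite setU1r.
  by rewrite finset.subUset sub1set xD.
by rewrite cardsU1 xB Bm.
Qed.

End Growth.

(** * Connected forms that are locally positive *)

Section Local.
Variables (R : realType) (X : finType) (S : X -> X -> R).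
Hypothesis symS : forall x y, S x y = S y x.
Hypothesis intS : forall x y, S x y \is a Num.int.
Hypothesis normS : forall x, S x x <= 2.
Implicit Types (D Y T : {set X}).

(** Equality up to sign, for vectors with Gram matrix [S]. *)
Definition twins x y := (S x x == S y y) && ((S x y == S x x) || (S x y == - S x x)).

Definition twin_free D := {in D &, forall x y, twins x y -> x = y}.

Lemma twin_free_gram_inj D p (v : X -> 'cV[R]_p) : twin_free D -> gram_on D S v ->
  {in D &, injective v}.
Proof.
move=> tf vS x y xD yD vxy; apply: tf => //.
by rewrite /twins -!vS // vxy !eqxx.
Qed.

(** Twin-free families in a fixed [Z^k] or in [E_8] are bounded, because the vectors have few
    possible entries. *)
Lemma card_few_entries m D (v : X -> 'cV[R]_m) (W : {set 'I_m}) (s : seq R) k :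
  size s = k.+1 -> {in D &, injective v} ->
  {in D, forall x i, v x i 0 \in s} -> {in D, forall x i, i \notin W -> v x i 0 = nth 0 s 0} ->
  (#|D| <= k.+1 ^ #|W|)%N.
Proof.
move=> sk vinj vs vW; pose code x : {ffun 'I_m -> 'I_k.+1} := [ffun i => inord (index (v x i 0) s)].
have codeE x i : x \in D -> nth 0 s (code x i) = v x i 0.
  by move=> xD; rewrite ffunE inordK ?nth_index ?vs // -sk index_mem vs.
have code_inj : {in D &, injective code}.
  move=> x y xD yD xy; apply: vinj => //; apply/matrixP => i j.
  by rewrite ord1 -!codeE // xy.
rewrite -(card_in_imset code_inj).
have -> : (k.+1 ^ #|W|)%N = #|pffun_on (ord0 : 'I_k.+1) (mem W) predT|.
  by rewrite card_pffun_on card_ord.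
apply: subset_leq_card; apply/fintype.subsetP => _ /imsetP[x xD ->].
apply/pffun_onP; split=> //; apply/fintype.subsetP => i; rewrite inE; apply: contraNT => iW.
rewrite ffunE vW //.
by apply/eqP/val_inj => /=; rewrite inordK -?sk ?index_head; case: s sk {vs vW code codeE code_inj} => //= a s' _; rewrite eqxx.
Qed.

Section Coordinates.
Variables (n : nat) (phi : X -> 'cV[R]_n) (D : {set X}).
Hypothesis phiZ : {in D, forall y i, phi y i 0 \is a Num.int}.
Hypothesis phiS : gram_on D S phi.
Hypothesis posS : {in D, forall x, S x x <> 0}.

Lemma phi_entry y i : y \in D -> phi y i 0 \in [:: 0; -1; 1 : R].
Proof.
move=> yD; have y2 : phi y i 0 ^+ 2 <= 2.
  apply: le_trans (normS y); rewrite -phiS // /dot (bigD1 i) //= -expr2 lerDl.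
  by apply: sumr_ge0 => j _; rewrite -expr2 sqr_ge0.
have y4 : phi y i 0 ^+ 2 < 4 by lra.
by rewrite !inE; have [->|->|->] := int_sqr_lt4 (phiZ yD i) y4; rewrite eqxx ?orbT.
Qed.

Lemma tied_trans T i j k : tied phi T i j -> tied phi T j k -> tied phi T i k.
Proof.
move=> [s s1 Ls] [t t1 Lt]; exists (- (s * t)).
  by case: s1 => ->; case: t1 => ->; rewrite ?mulN1r ?mul1r ?opprK; auto.
rewrite (_ : _ + _ = (delta_mx i 0 + s *: delta_mx j 0) - s *: (delta_mx j 0 + t *: delta_mx k 0)).
  apply: subgroupB => //; first exact: zspan_subgroup.
  apply: subgroupZ => //; first exact: zspan_subgroup.
  by case: s1 => ->; rewrite ?rpredN rpred1.
by rewrite scalerDr opprD addrA addrK scalerA scaleNr.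
Qed.

Lemma tied_sym T i j : tied phi T i j -> tied phi T j i.
Proof.
move=> [s s1 Ls]; exists s => //.
rewrite (_ : _ + _ = s *: (delta_mx i 0 + s *: delta_mx j 0)).
  apply: subgroupZ => //; first exact: zspan_subgroup.
  by case: s1 => ->; rewrite ?rpredN rpred1.
by rewrite scalerDr scalerA; case: s1 => ->; rewrite ?mulN1r ?opprK ?mul1r !scale1r addrC.
Qed.

(** A vector of norm at most 2 with two nonzero entries is [+- e_i +- e_j]. *)
Lemma tied_in_vector T y i j : T \subset D -> y \in T -> phi y i 0 != 0 -> phi y j 0 != 0 -> tied phi T i j.
Proof.
move=> /fintype.subsetP sTD yT yi yj; have yD := sTD y yT.
have sgT := zspan_subgroup (fun w => exists2 x, x \in T & w = phi x).
have [<-|ij] := eqVneq i j.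
  by exists (-1); [right|rewrite scaleN1r subrr; apply: zspan0].
have pm k : phi y k 0 != 0 -> phi y k 0 = 1 \/ phi y k 0 = -1.
  move=> yk; have := phi_entry k yD; rewrite !inE (negbTE yk) /=.
  by case/orP=> /eqP->; auto.
have sq1 k : phi y k 0 != 0 -> phi y k 0 ^+ 2 = 1.
  by move=> /pm[]->; rewrite ?sqrrN expr1n.
have others k : k != i -> k != j -> phi y k 0 = 0.
  move=> ki kj; apply/eqP; apply: contraT => yk.
  have := normS y; rewrite -phiS // /dot (bigD1 i) //= (bigD1 j) 1?eq_sym //= (bigD1 k) ?ki //=.
  rewrite -!expr2 !sq1 //; set r := \sum_(_ | _) _.
  have : 0 <= r by apply: sumr_ge0 => l _; rewrite -expr2 sqr_ge0.
  lra.
exists (phi y i 0 * phi y j 0).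
  by case: (pm i yi) => ->; case: (pm j yj) => ->; rewrite ?mulN1r ?mul1r ?opprK; auto.
rewrite (_ : _ + _ = phi y i 0 *: phi y).
  by apply: subgroupZ => //; [exact: phiZ|apply: lattice_gen].
apply/matrixP => k z; rewrite ord1 !mxE eqxx !andbT.
have [->|ki] := eqVneq k i; first by rewrite (negbTE ij) mulr0 addr0 -expr2 sq1.
have [->|kj] := eqVneq k j; first by rewrite add0r mulr1.
by rewrite (others k) // !mulr0 addr0.
Qed.

(** Linked vectors share a coordinate, so connectedness ties all coordinates together; there are
    many of them since only [3 ^ k] vectors are supported on [k] coordinates. The exponent is a
    variable so that the power is never evaluated. *)
Lemma connected_rich B x0 m : (200 <= m)%N -> connected_on B S -> x0 \in B -> B \subset D -> twin_free B ->
  (3 ^ m < #|B|)%N -> rich phi B.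
Proof.
move=> m200 cB x0B sBD tfB B3; have sBD' := fintype.subsetP sBD.
have [i0 x0i0] : exists i0, phi x0 i0 0 != 0.
  apply/existsP; apply: contraT; rewrite negb_exists => /forallP phi0.
  case: (posS (sBD' _ x0B)); rewrite -phiS ?sBD' // /dot big1 // => i _.
  by have /negPn/eqP-> := phi0 i; rewrite mulr0.
have all_tied : {in B, forall y i, phi y i 0 != 0 -> tied phi B i0 i}.
  apply: (connected_on_ind cB x0B) => [i|x y xB yB Sxy xt i yi].
    exact: tied_in_vector.
  have [j] : exists j, phi x j 0 * phi y j 0 != 0.
    apply/existsP; apply: contraNT Sxy; rewrite negb_exists => /forallP xy0.
    by rewrite -phiS ?sBD' // /dot big1 // => j _; have /negPn/eqP := xy0 j.
  rewrite mulf_eq0 negb_or => /andP[xj yj].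
  exact: tied_trans (xt j xj) (tied_in_vector sBD yB yj yi).
pose W := [set i | [exists y in B, phi y i 0 != 0]].
have W200 : (200 < #|W|)%N.
  rewrite ltnNge; apply/negP => W200; move: B3; rewrite ltnNge => /negP; apply.
  apply: (@leq_trans (3 ^ #|W|)); last by rewrite leq_exp2l // (leq_trans W200).
  have tfphi : {in B &, injective phi}.
    by apply: twin_free_gram_inj tfB _ => x y /sBD' xD /sBD' yD; apply: phiS.
  apply: (card_few_entries (s := [:: 0; -1; 1]) _ tfphi) => // [x /sBD' xD i|x xB i].
    exact: phi_entry.
  by rewrite inE negb_exists => /forallP/(_ x); rewrite xB /= negbK => /eqP.
move=> i [y yB yi]; exists W => // j; rewrite inE => /existsP[z /andP[zB zj]].
by apply: tied_trans (all_tied z zB j zj); apply: tied_sym; apply: all_tied yi.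
Qed.

End Coordinates.

Lemma E8rep_card D m : (8 <= m)%N -> twin_free D -> E8rep D S -> (#|D| <= 5 ^ m)%N.
Proof.
move=> m8 tf [b [bE bS]]; have binj := twin_free_gram_inj tf bS.
pose b2 x := 2 *: b x.
have b2inj : {in D &, injective b2}.
  by move=> x y xD yD /(scalerI (a := 2)) xy; apply: binj => //; apply: xy; rewrite pnatr_eq0.
apply: (@leq_trans (5 ^ #|[set: 'I_8]|)); last by rewrite leq_exp2l // cardsT card_ord.
apply: (card_few_entries (s := [:: 0; -1; 1; -2; 2]) _ b2inj) => // [x xD i|x xD i]; last by rewrite inE.
rewrite mxE; have [k bk] : exists k : int, 2 * b x i 0 = k%:~R.
  have /E8P[bZ _] := bE x xD; case: bZ => /(_ i)/intrP[l bl].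
    by exists (2 * l); rewrite bl intrM.
  by exists (2 * l + 1); rewrite intrD intrM -bl mulrBr divff ?pnatr_eq0 // subrK.
have : (2 * b x i 0) ^+ 2 <= 8.
  have : b x i 0 ^+ 2 <= 2.
    apply: le_trans (normS x); rewrite -bS // /dot (bigD1 i) //= -expr2 lerDl.
    by apply: sumr_ge0 => j _; rewrite -expr2 sqr_ge0.
  by nra.
rewrite bk -rmorphXn /= -[8]/(8%:~R) ler_int expr2 => k8.
have : [\/ k = 0, k = -1, k = 1 | k = -2 \/ k = 2].
  have : k = 0 \/ k = -1 \/ k = 1 \/ k = -2 \/ k = 2 by nia.
  by case=> [|[|[|]]] ?; [constructor 1|constructor 2|constructor 3|constructor 4].
by rewrite !inE; case=> [->|->|->|[->|->]]; rewrite ?rmorphN eqxx ?orbT.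
Qed.

(** Add the vertices one at a time, keeping the set connected. Up to size [K] the classification
    applies. Beyond that size the set no longer fits in [E_8], so it is in some [Z^n], and the
    next vertex is added by gluing its local coordinates. *)
Lemma local_Zrep_or_E8rep D x0 m K : (200 <= m)%N -> {in D, forall x, S x x <> 0} -> {in D, forall x, 0 <= S x x} ->
  twin_free D -> connected_on D S -> x0 \in D ->
  (3 * (3 ^ m).+1 < K)%N -> (5 ^ m < K)%N ->
  (forall T, (#|T| <= K)%N -> psd_on T S) -> Zrep D S \/ E8rep D S.
Proof.
move=> m200 posD nnegD tf cD x0D; set b := (3 ^ m).+1 => K_ge3 K5 psdT.
have subsetZ T : {in T &, forall x y, S x y \is a Num.int} by move=> *; exact: intS.
have norm12 : {in D, forall x, S x x = 1 \/ S x x = 2}.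
  move=> x xD; have := posD x xD; have := nnegD x xD; have := normS x => s2 s0 sn0.
  have s4 : S x x ^+ 2 < 4 \/ S x x = 2.
    have [->|n2] := eqVneq (S x x) 2; first by right.
    left; have : S x x < 2 by rewrite lt_neqAle n2.
    by nra.
  case: s4 => [s4|]; last by right.
  by left; have [s|//|//] := int_sqr_lt4 (intS x x) s4; lra.
suff grow k : (0 < k <= #|D|)%N -> exists Y : {set X}, [/\ x0 \in Y, Y \subset D, connected_on Y S, #|Y| = k &
    Zrep Y S \/ E8rep Y S].
  have [|Y [_ sYD _ YD rep]] := grow #|D|.
    by rewrite leqnn andbT (cardD1 x0) x0D.
  by have /eqP <- : Y == D by rewrite eqEcard sYD YD leqnn.
elim: k => // -[|k] IHk /andP[_ kD].
  exists [set x0]; rewrite set11 sub1set cards1; split=> //; first exact: connected_on1.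
  apply: (psd_Zrep_or_E8rep (x0 := x0)) => //; last by apply: psdT; rewrite cards1; lia.
  - by move=> x /set1P->; apply: norm12.
  - exact: connected_on1.
  - exact: set11.
have [|Y [x0Y sYD cY Yk repY]] := IHk; first by apply: ltnW.
have [|x [xD xY cxY]] := connected_grow symS cD sYD x0Y cY; first by rewrite Yk.
have sxYD : x |: Y \subset D by rewrite finset.subUset sub1set xD.
exists (x |: Y); split=> //; [by rewrite setU1r|by rewrite cardsU1 xY Yk|].
have [smallY|bigY] := leqP #|x |: Y| K.
  apply: (psd_Zrep_or_E8rep (x0 := x0)) => //; last exact: psdT.
  - by move=> y yY; apply: norm12; apply: (fintype.subsetP sxYD).
  - by rewrite setU1r.
have tfS T : T \subset D -> twin_free T.
  by move=> /fintype.subsetP sTD y z /sTD yD /sTD zD; apply: tf.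
have YK : (K <= #|Y|)%N by move: bigY; rewrite cardsU1 xY.
case: repY => [[n [phi [phiZ phiS]]]|E8Y]; last first.
  have := @E8rep_card Y m _ (tfS Y sYD) E8Y; lia.
left.
have posY : {in Y, forall x, S x x <> 0} by move=> y /(fintype.subsetP sYD); apply: posD.
have /choice[B BP] : forall y, exists B : {set X}, y \in Y -> [/\ y \in B, B \subset Y, rich phi B & (#|B| <= b)%N].
  move=> y; have [yY|_] := boolP (y \in Y); last by exists finset.set0.
  have [|B [yB sBY cB Bb]] := @connected_subset_of_size _ _ _ symS Y y b cY yY; first by rewrite /b; lia.
  exists B => _; split=> //; last by rewrite Bb.
  apply: (connected_rich phiZ phiS posY m200 cB yB sBY); last by rewrite Bb.
  exact/tfS/(fintype.subset_trans sBY).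
apply: (Zrep_extend symS intS normS phiZ phiS xY BP) => T sTY T3b.
apply: psdT; apply: leq_trans (leq_card_setU _ _) _; rewrite cards1; lia.
Qed.

End Local.

(** * Forms that embed in sums of copies of Z and E_8 *)

Section Embeddings.
Variables (R : realType) (X : finType).
Implicit Types (S : X -> X -> R).

(** An orthogonal sum of rank one integral forms and of Gram matrices in [E_8]: the Gram matrices
    in the lattices [Z^n + E_8^k]. In this form sums are immediate. *)
Definition embeds S := exists n (a : nat -> X -> R) k (b : nat -> X -> 'cV[R]_8),
  [/\ forall i x, (i < n)%N -> a i x \is a Num.int,
      forall j x, (j < k)%N -> E8 R (b j x) &
      forall x y, S x y = \sum_(i < n) a i x * a i y + \sum_(j < k) dot (b j x) (b j y)].

Lemma embeds_ext S S' : (forall x y, S x y = S' x y) -> embeds S -> embeds S'.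
Proof.
by move=> SS' [n [a [k [b [aZ bE Sab]]]]]; exists n, a, k, b; split=> // x y; rewrite -SS'.
Qed.

Lemma embeds0 : embeds (fun _ _ => 0).
Proof.
exists 0%N, (fun _ _ => 0), 0%N, (fun _ _ => 0).
by split=> // x y; rewrite !big_ord0 addr0.
Qed.

Lemma embeds_add S1 S2 : embeds S1 -> embeds S2 -> embeds (fun x y => S1 x y + S2 x y).
Proof.
move=> [n [a [k [b [aZ bE Sab]]]]] [n' [a' [k' [b' [aZ' bE' Sab']]]]].
exists (n + n')%N, (fun i => if (i < n)%N then a i else a' (i - n)%N).
exists (k + k')%N, (fun i => if (i < k)%N then b i else b' (i - k)%N).
split=> [i x|j x|x y].
- by case: (ltnP i n) => [ltin _|lein lti]; [exact: aZ|apply: aZ'; lia].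
- by case: (ltnP j k) => [ltjk _|lejk ltj]; [exact: bE|apply: bE'; lia].
rewrite Sab Sab' !big_split_ord /= addrACA; congr (_ + _ + (_ + _)); apply: eq_bigr => i _ /=.
- by rewrite ltn_ord.
- by rewrite ltnNge leq_addr /= addKn.
- by rewrite ltn_ord.
- by rewrite ltnNge leq_addr /= addKn.
Qed.

Lemma embeds_sum I (r : seq I) (P : pred I) (F : I -> X -> X -> R) :
  (forall i, P i -> embeds (F i)) -> embeds (fun x y => \sum_(i <- r | P i) F i x y).
Proof.
move=> FE; elim: r => [|i r IHr].
  by apply: embeds_ext embeds0 => x y; rewrite big_nil.
have [Pi|nPi] := boolP (P i).
  by apply: embeds_ext (embeds_add (FE i Pi) IHr) => x y; rewrite big_cons Pi.
by apply: embeds_ext IHr => x y; rewrite big_cons (negbTE nPi).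
Qed.

Lemma embeds_rank1 (f : X -> R) : (forall x, f x \is a Num.int) -> embeds (fun x y => f x * f y).
Proof.
move=> fZ; exists 1%N, (fun=> f), 0%N, (fun _ _ => 0); split=> // x y.
by rewrite big_ord0 big_ord1 addr0.
Qed.

Fixpoint stack k (b : nat -> 'cV[R]_8) : 'cV[R]_(k * 8) :=
  match k return 'cV[R]_(k * 8) with
  | 0 => 0
  | k'.+1 => col_mx (b k') (stack k' b)
  end.

Lemma dot_stack k b b' : dot (stack k b) (stack k b') = \sum_(j < k) dot (b j) (b' j).
Proof.
elim: k => [|k IHk]; first by rewrite big_ord0 dot0l.
rewrite [RHS]big_ord_recr /= -IHk addrC; exact: (dot_col_mx (b k) (b' k) (stack k b) (stack k b')).
Qed.

Lemma stack_lattice k b : (forall j, (j < k)%N -> E8 R (b j)) ->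
  lattice_pow (E8 R) k (stack k b).
Proof.
elim: k => [|k IHk] bE //; split.
  by rewrite col_mxKu; apply: bE.
by rewrite col_mxKd; apply: IHk => j jk; apply: bE; apply: ltnW.
Qed.

Lemma embeds_vectors S : embeds S -> exists n k (w : X -> 'cV[R]_(n + k * 8)),
  (forall x, lattice_sum (Zlattice R n) (lattice_pow (E8 R) k) (w x)) /\
  forall x y, dot (w x) (w y) = S x y.
Proof.
move=> [n [a [k [b [aZ bE Sab]]]]]; exists n, k.
exists (fun x => col_mx (\col_i a i x) (stack k (fun j => b j x))); split=> [x|x y].
  split; last by rewrite col_mxKd; apply: stack_lattice => j; apply: bE.
  rewrite col_mxKu; exists (\matrix_(i, j) Num.floor (a i x)) => //.
  by apply/matrixP => i j; rewrite !mxE floorK // aZ.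
rewrite dot_col_mx dot_stack Sab; congr (_ + _).
by apply: eq_bigr => i _; rewrite !mxE.
Qed.

Lemma embeds_psd S (D : {set X}) : embeds S -> psd_on D S.
Proof.
by case/embeds_vectors=> n [k [w [_ wS]]]; apply: (gram_psd (v := w)) => x y _ _.
Qed.

End Embeddings.

(** * Locally positive forms embed *)

Section Components.
Variables (R : realType) (X : finType) (S : X -> X -> R).
Hypothesis symS : forall x y, S x y = S y x.
Hypothesis intS : forall x y, S x y \is a Num.int.
Hypothesis normS : forall x, S x x <= 2.
Variables (m K : nat).
Hypotheses (m200 : (200 <= m)%N) (K3m : (3 * (3 ^ m).+1 < K)%N) (K5m : (5 ^ m < K)%N).
Hypothesis psdT : forall T : {set X}, (#|T| <= K)%N -> psd_on T S.

Let K_ge3 : (3 <= K)%N.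
Proof. by apply: leq_trans (ltnW K3m); rewrite leq_pmulr. Qed.

Lemma local_gram x y z : exists p (v : X -> 'cV[R]_p), gram_on [set x; y; z] S v.
Proof.
apply: psd_gram symS _; apply: psdT; apply: leq_trans K_ge3.
by apply: leq_trans (leq_card_setU _ _) _; rewrite cards1 cards2 addn1 ltnS; case: (_ != _).
Qed.

Lemma diag_ge0 x : 0 <= S x x.
Proof.
have [p [v vS]] := local_gram x x x.
by rewrite -vS ?dot_ge0 // !inE eqxx.
Qed.

Lemma diag_eq0 x y : S x x = 0 -> S x y = 0.
Proof.
have [p [v vS]] := local_gram x y y => Sx.
have vx : v x = 0 by apply: dot_eq0; rewrite vS // !inE eqxx.
by rewrite -vS ?vx ?dot0l // !inE eqxx ?orbT.
Qed.

Definition twin_sign x y : R := if S x y == S x x then 1 else -1.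

Lemma twin_signP x y : twin_sign x y = 1 \/ twin_sign x y = -1.
Proof. by rewrite /twin_sign; case: eqP; auto. Qed.

(** Locally the form has Gram vectors, and those of twins are equal up to sign. *)
Lemma twinsP x y z : twins S x y -> S x z = twin_sign x y * S y z.
Proof.
move=> /andP[/eqP Sxx Sxy]; have [p [v vS]] := local_gram x y z.
have [xU yU zU] : [/\ x \in [set x; y; z], y \in [set x; y; z] & z \in [set x; y; z]].
  by rewrite !inE !eqxx ?orbT.
rewrite -!vS // -dotZl; congr dot; apply/eqP; rewrite -subr_eq0; apply/eqP/dot_eq0.
have sxy : twin_sign x y * S x y = S x x.
  rewrite /twin_sign; case: eqP Sxy => [->|_ /= /eqP->]; first by rewrite mul1r.
  by rewrite mulN1r opprK.
have s2 : twin_sign x y * twin_sign x y = 1.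
  by case: (twin_signP x y) => ->; rewrite ?mulrNN mul1r.
rewrite !(dotBl, dotBr, dotZl, dotZr) !vS // (symS y x).
move: sxy s2; rewrite Sxx; move: (twin_sign x y) (S x y) (S y y) => s a b sa s2.
by rewrite (_ : _ - _ = b - 2 * (s * a) + s * s * b); [rewrite sa s2; ring|ring].
Qed.

Lemma connect_ind (e : rel X) (Q : X -> Prop) c y : connect e c y -> Q c ->
  (forall a b, e a b -> Q a -> Q b) -> Q y.
Proof.
move=> /connectP[s]; elim: s c => [|a s IHs] c /=; first by move=> _ ->.
by case/andP=> ca sa yl Qc step; apply: (IHs a sa yl) => //; exact: step Qc.
Qed.

(** A maximal twin-free set [D] in the component represents every vertex up to sign, and is again
    connected; a representation of [D] extends to the component by copying with signs. *)
Lemma component_embeds c : S c c <> 0 ->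
  embeds (fun x y => if connect (linked setT S) c x && connect (linked setT S) c y
                     then S x y else 0).
Proof.
move=> Sc; pose C := [set x | connect (linked setT S) c x].
pose P (D : {set X}) := (D \subset C) && [forall x in D, forall y in D, twins S x y ==> (x == y)].
have P0 : P finset.set0.
  by rewrite /P finset.sub0set; apply/forall_inP => x; rewrite inE.
have [D /maxsetP[/andP[sDC /forall_inP tfD] maxD] _] := maxset_exists P0.
have sDC' := fintype.subsetP sDC.
have tf : twin_free S D.
  by move=> x y xD yD xy; have /forall_inP/(_ y yD)/implyP/(_ xy)/eqP := tfD x xD.
have posC x : x \in C -> S x x <> 0.
  rewrite inE => cx; apply: (connect_ind (Q := fun z => S z z <> 0) cx) => // a b /and3P[_ _ Sab] _ Sb.
  by move/eqP: Sab; apply; rewrite symS; apply: diag_eq0.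
have twins_refl x : twins S x x by rewrite /twins !eqxx.
have twins_sym x y : twins S x y -> twins S y x.
  move=> /andP[/eqP Sxx Sxy]; rewrite /twins Sxx eqxx (symS y x) /=.
  by rewrite -Sxx.
have /choice[r rP] : forall x, exists y, x \in C -> y \in D /\ twins S x y.
  move=> x; have [xC|_] := boolP (x \in C); last by exists x.
  apply: contrapT => no_y.
  have nDx y : y \in D -> ~~ twins S x y.
    by move=> yD; apply/negP => xy; apply: no_y; exists y.
  have xD : x \in D.
    rewrite -(maxD (x |: D)); rewrite ?setU11 ?finset.subsetUr //.
    rewrite /P finset.subUset sub1set xC sDC /=; apply/forall_inP => y yD.
    apply/forall_inP => z zD; apply/implyP => yz.
    case/setU1P: yD zD yz => [->|yD] /setU1P[->|zD] yz //.
    - by have := nDx z zD; rewrite yz.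
    - by have := nDx y yD; rewrite (twins_sym _ _ yz).
    - by rewrite (tf y z).
  by have := nDx x xD; rewrite twins_refl.
have rid x : x \in D -> r x = x.
  by move=> xD; have [rD xr] := rP x (sDC' x xD); apply/esym/tf.
pose s x := twin_sign x (r x).
have Srr x y : x \in C -> y \in C -> S x y = s x * s y * S (r x) (r y).
  move=> xC yC; have [_ xr] := rP x xC; have [_ yr] := rP y yC.
  by rewrite (twinsP y xr) symS (twinsP (r x) yr) symS mulrA.
have cC : c \in C by rewrite inE connect0.
have [rcD _] := rP c cC.
have conr x : x \in C -> connect (linked D S) (r c) (r x).
  rewrite inE => cx; suff [] : x \in C /\ connect (linked D S) (r c) (r x) by [].
  apply: (connect_ind (Q := fun z => z \in C /\ connect (linked D S) (r c) (r z)) cx) => [|a b /and3P[_ _ Sab] [aC ca]]; first by rewrite cC connect0.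
  have bC : b \in C.
    rewrite inE; move: aC; rewrite inE => /connect_trans; apply; apply: connect1.
    by rewrite /linked !inE.
  split=> //; apply: connect_trans ca _; apply: connect1; rewrite /linked.
  have [-> _] := rP a aC; have [-> _] := rP b bC; rewrite /=.
  by apply: contraNneq Sab => Sr; rewrite Srr // Sr mulr0.
have conD : connected_on D S.
  move=> x y xD yD; rewrite -(rid x xD) -(rid y yD).
  apply: (connect_trans _ (conr y (sDC' y yD))).
  by rewrite linked_sym // conr // sDC'.
have sZ x : s x \is a Num.int by case: (twin_signP x (r x)); rewrite /s => ->; rewrite ?rpredN rpred1.
have eqC x y : (connect (linked setT S) c x && connect (linked setT S) c y) = (x \in C) && (y \in C).
  by rewrite !inE.
have [[n [a [aZ aS]]]|[b [bE bS]]] : Zrep D S \/ E8rep D S.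
  apply: (local_Zrep_or_E8rep (x0 := r c) symS intS normS m200) psdT => //.
  - by move=> x xD; apply: posC; apply: sDC'.
  - by move=> x _; apply: diag_ge0.
- pose f i x : R := if x \in C then s x * (if insub i is Some j then a (r x) (j : 'I_n) 0 else 0) else 0.
  exists n, f, 0%N, (fun _ _ => 0); split=> // [i x lin|x y].
    rewrite /f; case: ifP => [xC|_]; last exact: rpred0.
    rewrite rpredM //; case: insubP => [j _ _|_]; last exact: rpred0.
    by apply: aZ; case: (rP x xC).
  rewrite big_ord0 addr0 eqC /f; case: (boolP (x \in C)) => xC; last by rewrite big1 // => *; rewrite mul0r.
  case: (boolP (y \in C)) => yC; last by rewrite big1 // => *; rewrite mulr0.
  have [rxD _] := rP x xC; have [ryD _] := rP y yC.
  rewrite Srr // -aS // /dot mulr_sumr; apply: eq_bigr => i _; rewrite valK; ring.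
pose f (_ : nat) x : 'cV[R]_8 := if x \in C then s x *: b (r x) else 0.
exists 0%N, (fun _ _ => 0), 1%N, f; split=> // [j x _|x y].
  rewrite /f; case: ifP => [xC|_]; last exact: subgroup0 (@E8_subgroup R).
  by apply: subgroupZ; [exact: E8_subgroup| |apply: bE; case: (rP x xC)].
rewrite big_ord0 add0r big_ord1 eqC /f; case: (boolP (x \in C)) => xC; last by rewrite dot0l.
case: (boolP (y \in C)) => yC; last by rewrite dot0r.
have [rxD _] := rP x xC; have [ryD _] := rP y yC.
by rewrite dotZl dotZr bS // Srr // mulrA.
Qed.

Lemma local_embeds : embeds S.
Proof.
pose e := linked setT S.
have esym : connect_sym e by apply: linked_sym.
pose F c x y := if connect e c x && connect e c y then S x y else 0.
refine (@embeds_ext R X (fun x y => \sum_(c | (fingraph.root e c == c) && (S c c != 0)) F c x y) S _ _); last first.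
  by apply: embeds_sum => c /andP[_ /eqP]; apply: component_embeds.
move=> x y; have [Sxy|Sxy] := eqVneq (S x y) 0.
  by rewrite big1 // => c _; rewrite /F Sxy if_same.
have exy : connect e x y by apply: connect1; rewrite /e /linked !inE.
rewrite (bigD1 (fingraph.root e x)) /=.
  rewrite {1}/F esym connect_root /= (connect_trans _ exy); last by rewrite esym connect_root.
  rewrite big1 ?addr0 // => c /andP[/andP[/eqP rc _] cx]; rewrite /F.
  case: ifP => // /andP[ecx _]; case/eqP: cx; rewrite -rc.
  exact/(fingraph.rootP esym).
rewrite (root_root esym) eqxx /=.
have : connect e x (fingraph.root e x) by apply: connect_root.
move=> xr; apply/eqP; apply: (connect_ind (Q := fun z => S z z <> 0) xr).
  by move=> Sx; move/eqP: Sxy; apply; apply: diag_eq0.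
move=> a b /and3P[_ _ Sab] _ Sb; move/eqP: Sab; apply.
by rewrite symS; apply: diag_eq0.
Qed.

End Components.

Section LocalGlobal.
Variable R : realType.

(** In particular, an integral form with diagonal entries at most 2 that is not positive
    semidefinite fails to be so on some set of bounded size, however large the form is. *)
Lemma embeds_of_local_psd : exists K : nat, forall (X : finType) (S : X -> X -> R),
  (forall x y, S x y = S y x) -> (forall x y, S x y \is a Num.int) ->
  (forall x, S x x <= 2) ->
  (forall T : {set X}, (#|T| <= K)%N -> psd_on T S) -> embeds S.
Proof.
have genK m : (200 <= m)%N -> exists K : nat, forall (X : finType) (S : X -> X -> R),
  (forall x y, S x y = S y x) -> (forall x y, S x y \is a Num.int) ->
  (forall x, S x x <= 2) ->
  (forall T : {set X}, (#|T| <= K)%N -> psd_on T S) -> embeds S.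
  move=> m200; exists (3 * (3 ^ m).+1 + 5 ^ m).+1 => X S symS intS normS psdT.
  by apply: (local_embeds symS intS normS m200 _ _ psdT); rewrite ltnS ?leq_addr ?leq_addl.
exact: (genK 200).
Qed.

End LocalGlobal.

(** * Stability of positivity for bounded integral forms *)

Section Stability.
Variable R : realType.

Lemma finite_lower_bound (F : finType) (d : F -> R) : (forall i, 0 < d i) ->
  exists2 delta, 0 < delta & forall i, delta <= d i.
Proof.
move=> d0; suff [delta delta0 le] : exists2 delta, 0 < delta & forall i, i \in enum F -> delta <= d i.
  by exists delta => // i; apply: le; rewrite mem_enum.
elim: (enum F) => [|i s [delta delta0 le]]; first by exists 1.
exists (Num.min delta (d i)); first by rewrite lt_min delta0 d0.
move=> j; rewrite inE ge_min => /orP[/eqP->|/le->//]; by rewrite lexx orbT.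
Qed.

Definition form k (T : 'I_k -> 'I_k -> R) (u : 'I_k -> R) :=
  \sum_i \sum_j u i * u j * T i j.

(** There are finitely many integral forms with entries in [-4 .. 4], and those with a negative
    value keep one under a small enough perturbation. *)
Lemma form_stable k : exists2 delta : R, 0 < delta & forall T T' : 'I_k -> 'I_k -> R,
  (forall i j, T i j \is a Num.int) -> (forall i j, `|T i j| <= 4) ->
  (forall i j, `|T' i j - T i j| <= delta) ->
  (forall u, 0 <= form T' u) -> forall u, 0 <= form T u.
Proof.
pose tab (m : {ffun 'I_k * 'I_k -> 'I_9}) i j : R := (m (i, j))%:R - 4.
have /choice[d dP] : forall m, exists d : R, 0 < d /\ forall T',
    (forall i j, `|T' i j - tab m i j| <= d) ->
    (forall u, 0 <= form T' u) -> forall u, 0 <= form (tab m) u.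
  move=> m; have [psd|/existsNP[u /negP]] := pselect (forall u, 0 <= form (tab m) u).
    by exists 1; split.
  rewrite -ltNge; set q := form _ _ => q0.
  pose A := \sum_i \sum_j `|u i * u j|.
  have A0 : 0 <= A by apply: sumr_ge0 => i _; apply: sumr_ge0.
  exists (- q / (A + 1)); split=> [|T' T'd psd]; first by rewrite divr_gt0 ?oppr_gt0 // ltr_wpDl.
  suff : form T' u < 0 by rewrite ltNge psd.
  have -> : form T' u = q + \sum_i \sum_j u i * u j * (T' i j - tab m i j).
    rewrite /q /form -big_split; apply: eq_bigr => i _ /=.
    by rewrite -big_split; apply: eq_bigr => j _ /=; ring.
  have : \sum_i \sum_j u i * u j * (T' i j - tab m i j) <= A * (- q / (A + 1)).
    rewrite mulr_suml; apply: ler_sum => i _; rewrite mulr_suml; apply: ler_sum => j _.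
    apply: le_trans (ler_norm _) _; rewrite normrM; apply: ler_wpM2l => //.
  have : A * (- q / (A + 1)) < - q.
    by rewrite mulrA ltr_pdivrMr ?ltr_wpDl // mulrC ltr_pM2l ?oppr_gt0 // ltrDl.
  lra.
have [delta delta0 le_delta] := finite_lower_bound (fun m => (dP m).1).
exists delta => // T T' TZ T4 TT' psd.
pose m : {ffun 'I_k * 'I_k -> 'I_9} := [ffun ij => inord `|Num.floor (T ij.1 ij.2 + 4)|%N].
have mT i j : tab m i j = T i j.
  rewrite /tab ffunE /=; have := T4 i j; case/intrP: (TZ i j) => z ->.
  rewrite -[4]/(4%:~R) -intrD -intr_norm ler_int intrKfloor => z4.
  rewrite inordK; last by lia.
  rewrite natr_absz ger0_norm; last by lia.
  by rewrite intrD addrK.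
have formE u : form (tab m) u = form T u.
  by apply: eq_bigr => i _; apply: eq_bigr => j _; rewrite mT.
move=> u; rewrite -formE; apply: (dP m).2 psd _ => i j.
by rewrite mT; apply: le_trans (le_delta m).
Qed.

Lemma psd_stable K : exists2 delta : R, 0 < delta &
  forall (X : finType) (D : {set X}) (S S' : X -> X -> R), (#|D| <= K)%N ->
  {in D &, forall x y, S x y \is a Num.int} -> {in D &, forall x y, `|S x y| <= 4} ->
  {in D &, forall x y, `|S' x y - S x y| <= delta} ->
  psd_on D S' -> psd_on D S.
Proof.
have /choice[d dP] : forall k, exists d : R, 0 < d /\ forall T T' : 'I_k -> 'I_k -> R,
    (forall i j, T i j \is a Num.int) -> (forall i j, `|T i j| <= 4) ->
    (forall i j, `|T' i j - T i j| <= d) ->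
    (forall u, 0 <= form T' u) -> forall u, 0 <= form T u.
  by move=> k; have [d ? ?] := form_stable k; exists d.
have [delta delta0 le_delta] := finite_lower_bound (fun k : 'I_K.+1 => (dP k).1).
exists delta => // X D S S' DK SZ S4 SS' psd u.
have formE (Q : X -> X -> R) (w : X -> R) :
    \sum_(x in D) \sum_(y in D) w x * w y * Q x y =
    form (fun i j : 'I_#|D| => Q (enum_val i) (enum_val j)) (fun i => w (enum_val i)).
  rewrite /form big_enum_val; apply: eq_bigr => i _; exact: big_enum_val.
rewrite formE; apply: (dP #|D|).2 (fun i j => S' (enum_val i) (enum_val j)) _ _ _ _ _.
- by move=> i j; apply: SZ; apply: enum_valP.
- by move=> i j; apply: S4; apply: enum_valP.
- move=> i j; have DK1 : (#|D| < K.+1)%N by [].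
  apply: le_trans (le_delta (Ordinal DK1)) => /=.
  by apply: SS'; apply: enum_valP.
move=> w; pose w' x := \sum_(i | enum_val i == x) w i.
have w'E i : w' (enum_val i) = w i.
  rewrite /w' (bigD1 i) //= big1 ?addr0 // => j /andP[/eqP/enum_val_inj-> ].
  by rewrite eqxx.
have := psd w'; rewrite formE; congr (0 <= _).
by apply: eq_bigr => i _; apply: eq_bigr => j _; rewrite !w'E.
Qed.

End Stability.

(** * Ramsey's theorem for two colours *)

Section Ramsey.

(** The usual induction, splitting the other points by their adjacency to one of them. *)
Lemma ramsey a b : exists n : nat, forall (X : finType) (e : rel X) (A : {set X}),
  symmetric e -> (n <= #|A|)%N ->
  (exists C : {set X}, [/\ C \subset A, #|C| = a & {in C &, forall x y, x != y -> e x y}]) \/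
  (exists C : {set X}, [/\ C \subset A, #|C| = b & {in C &, forall x y, x != y -> ~~ e x y}]).
Proof.
move: {2}(a + b)%N (leqnn (a + b)) => s; elim: s a b => [|s IHs] a b abs.
  exists 0%N => X e A _ _; left; exists finset.set0.
  by rewrite finset.sub0set cards0; split; [|lia|move=> x y; rewrite inE].
case: a abs => [|a] abs.
  exists 0%N => X e A _ _; left; exists finset.set0.
  by rewrite finset.sub0set cards0; split=> // x y; rewrite inE.
case: b abs => [|b] abs.
  exists 0%N => X e A _ _; right; exists finset.set0.
  by rewrite finset.sub0set cards0; split=> // x y; rewrite inE.
have [|n1 r1] := IHs a b.+1; first by lia.
have [|n2 r2] := IHs a.+1 b; first by lia.
exists (n1 + n2).+1 => X e A esym An.
have /card_gt0P[x xA] : (0 < #|A|)%N by apply: leq_trans An.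
pose N := [set y in A :\ x | e x y]; pose M := [set y in A :\ x | ~~ e x y].
have NM : #|A| = (#|N| + #|M|).+1.
  rewrite (cardsD1 x) xA add1n; congr _.+1; rewrite -(cardsID [set y | e x y] (A :\ x)).
  by congr (_ + _)%N; apply: eq_card => y; rewrite !inE //= andbC.
have sNA : N \subset A by apply/fintype.subsetP => y; rewrite !inE => /andP[/andP[]].
have sMA : M \subset A by apply/fintype.subsetP => y; rewrite !inE => /andP[/andP[]].
have extend (C W : {set X}) (q : rel X) : symmetric q -> W \subset A -> C \subset W ->
    (forall y, y \in W -> (y != x) && q x y) -> {in C &, forall y z, y != z -> q y z} ->
    [/\ x |: C \subset A, #|x |: C| = #|C|.+1 & {in x |: C &, forall y z, y != z -> q y z}].
  move=> qsym sWA /fintype.subsetP sCW Wq Cq.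
  have xC : x \notin C by apply/negP => /sCW/Wq; rewrite eqxx.
  split; last 1 first.
  - move=> y z /setU1P[->|yC] /setU1P[->|zC]; rewrite ?eqxx //.
    + by move=> _; case/andP: (Wq z (sCW z zC)).
    + by move=> _; rewrite qsym; case/andP: (Wq y (sCW y yC)).
    + exact: Cq.
  - rewrite finset.subUset sub1set xA /=; apply: fintype.subset_trans sWA; exact/fintype.subsetP.
  - by rewrite cardsU1 xC.
have Nq y : y \in N -> (y != x) && e x y by rewrite !inE => /andP[/andP[-> _] ->].
have Mq y : y \in M -> (y != x) && ~~ e x y by rewrite !inE => /andP[/andP[-> _] ->].
have nesym : symmetric (fun y z => ~~ e y z) by move=> y z; rewrite esym.
have [N1|N1] := leqP n1 #|N|.
  have [[C [sCN Ca Ce]]|[C [sCN Cb Ce]]] := r1 X e N esym N1.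
    by left; exists (x |: C); rewrite -Ca; apply: extend Nq Ce.
  by right; exists C; split=> //; apply: fintype.subset_trans sNA.
have M2 : (n2 <= #|M|)%N by lia.
have [[C [sCN Ca Ce]]|[C [sCN Cb Ce]]] := r2 X e M esym M2.
  by left; exists C; split=> //; apply: fintype.subset_trans sMA.
by right; exists (x |: C); rewrite -Cb; apply: (extend C M (fun y z => ~~ e y z)) Mq Ce.
Qed.

End Ramsey.

(** * Large switched cliques and their centroids *)

Section Cliques.
Variables (R : realType) (X : finType) (a : X -> X -> R) (p : nat) (v : X -> 'cV[R]_p).
Variables (eps om : R) (M : nat).
Hypotheses (eps0 : 0 < eps) (eps1 : eps <= 1 / 100) (om0 : 0 < om) (om1 : om <= 1 / 1000).
Hypothesis omM : 9 <= om ^+ 2 * M%:R.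
Hypotheses (syma : forall x y, a x y = a y x) (irra : forall x, a x x = 0).
Hypotheses (aZ : forall x y, a x y \is a Num.int) (a1 : forall x y, `|a x y| <= 1).
Hypothesis va : forall x y, dot (v x) (v y) = a x y + (3 + eps) * (x == y)%:R.

Lemma entry_cases x y : [\/ a x y = -1, a x y = 0 | a x y = 1].
Proof.
apply: int_sqr_lt4 => //; have := a1 x y; rewrite ler_norml => /andP[]; nra.
Qed.

(** Brings the bounds on the parameters into the local context of arithmetic goals. *)
Lemma parameter_bounds : [/\ 0 < eps, eps <= 1 / 100, 0 < om, om <= 1 / 1000 & 9 <= om ^+ 2 * M%:R].
Proof. by []. Qed.

Lemma vertex_norm x : dot (v x) (v x) = 3 + eps.
Proof. by rewrite va irra eqxx mulr1 add0r. Qed.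

Lemma vertex_dot x y : x != y -> dot (v x) (v y) = a x y.
Proof. by move=> /negbTE xy; rewrite va xy mulr0 addr0. Qed.

(** A set of vertices with a switching function. *)
Definition sclique := ({set X} * {ffun X -> bool})%type.
Implicit Types (c d : sclique).

Definition switched c x : 'cV[R]_p := (-1) ^+ c.2 x *: v x.

(** A clique of size [M.+1] all of whose edges become positive after switching. *)
Definition positive_clique c : bool := (#|c.1| == M.+1) &&
  [forall x in c.1, forall y in c.1, (x != y) ==> (dot (switched c x) (switched c y) == 1)].

(** As the clique grows, its centroid tends to a unit vector; the vectors [switched c x] then
    become the sums of this unit vector and of orthogonal vectors of norm [2 + eps]. *)
Definition centroid c : 'cV[R]_p := M.+1%:R^-1 *: \sum_(x in c.1) switched c x.

Lemma positive_cliqueP c x y : positive_clique c -> x \in c.1 -> y \in c.1 ->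
  dot (switched c x) (switched c y) = 1 + (2 + eps) * (x == y)%:R.
Proof.
move=> /andP[_ /forall_inP cl] xc yc; have [<-|xy] := eqVneq x y.
  rewrite /switched dotZl dotZr vertex_norm; by case: (c.2 x); rewrite /= ?expr1 ?expr0 ?mulr1n; ring.
by have /forall_inP/(_ y yc)/implyP/(_ xy)/eqP-> := cl x xc; rewrite mulr0 addr0.
Qed.

Lemma M1_neq0 : M.+1%:R != 0 :> R. Proof. by rewrite pnatr_eq0. Qed.

Lemma sum_centroid c z :
  \sum_(x in c.1) dot z (switched c x) = M.+1%:R * dot z (centroid c).
Proof.
by rewrite /centroid dotZr dot_sumr mulrA mulfV ?mul1r ?M1_neq0.
Qed.

Lemma dot_switched_centroid c x : positive_clique c -> x \in c.1 ->
  dot (switched c x) (centroid c) = 1 + (2 + eps) / M.+1%:R.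
Proof.
move=> cl xc; rewrite /centroid dotZr dot_sumr.
rewrite (eq_bigr (fun y => 1 + (2 + eps) * (x == y)%:R)) => [|y yc]; last by rewrite positive_cliqueP.
have /andP[/eqP cM _] := cl.
have sx : \sum_(y in c.1) (x == y)%:R = 1 :> R.
  rewrite (bigD1 x) //= eqxx big1 ?addr0 // => y /andP[_].
  by rewrite eq_sym => /negbTE->.
by rewrite big_split sumr_const cM /= -mulr_sumr sx mulr1 mulrDr mulVf ?M1_neq0 // [_^-1 * _]mulrC.
Qed.

(** The norm of a centroid exceeds 1 by this quantity. *)
Lemma clique_excess_small : exists s, [/\ (2 + eps) / M.+1%:R = s, 0 < s & s <= om].
Proof.
have [e0 e1 o0 o1 oM] := parameter_bounds.
exists ((2 + eps) / M.+1%:R).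
have p0 : 0 < 2 + eps by lra.
split=> //; first by rewrite divr_gt0 ?ltr0n.
rewrite ler_pdivrMr ?ltr0n // -natr1.
have : 0 <= om * M%:R * (1 - om) by rewrite !mulr_ge0 ?ler0n //; lra.
have : 9 <= om * (om * M%:R) by rewrite mulrA -expr2.
nra.
Qed.

Lemma centroid_norm c : positive_clique c ->
  dot (centroid c) (centroid c) = 1 + (2 + eps) / M.+1%:R.
Proof.
move=> cl; rewrite {1}/centroid dotZl dot_suml.
rewrite (eq_bigr (fun=> 1 + (2 + eps) / M.+1%:R)) => [|x xc]; last by rewrite dot_switched_centroid.
have /andP[/eqP cM _] := cl.
by rewrite sumr_const cM -[X in _ * X]mulr_natl mulKf ?M1_neq0.
Qed.

(** Bessel's inequality for the deviations [switched c x - centroid c], whose Gram matrix is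
    [2 + eps] times a projection. *)
Lemma centroid_variance c z : positive_clique c ->
  \sum_(x in c.1) (dot z (switched c x) - dot z (centroid c)) ^+ 2 <= (2 + eps) * dot z z.
Proof.
have [e0 e1 o0 o1 oM] := parameter_bounds.
move=> cl; pose k x := dot z (switched c x) - dot z (centroid c).
set Q := \sum_(x in _) _; have /andP[/eqP cM _] := cl.
have k0 : \sum_(x in c.1) k x = 0.
  by rewrite sumrB sum_centroid // sumr_const cM -[X in _ - X]mulr_natl subrr.
have Q0 : 0 <= Q by apply: sumr_ge0 => x _; apply: sqr_ge0.
pose w := \sum_(x in c.1) k x *: switched c x.
have zw : dot z w = Q.
  rewrite dot_sumr /Q; under eq_bigr do rewrite dotZr.
  under [RHS]eq_bigr do rewrite expr2 -/(k _) {2}/k mulrBr.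
  by rewrite sumrB -[X in _ - X]mulr_suml k0 mul0r subr0.
have ww : dot w w = (2 + eps) * Q.
  rewrite -quad_gram (eq_bigr (fun x => k x * \sum_(y in c.1) k y + (2 + eps) * k x ^+ 2)).
    by rewrite k0; under eq_bigr do rewrite mulr0 add0r; rewrite -mulr_sumr.
  move=> x xc; rewrite (eq_bigr (fun y => k x * k y + (2 + eps) * k x * (k y * (x == y)%:R))).
    rewrite big_split /= -!mulr_sumr; congr (_ + _); rewrite (bigD1 x) //= eqxx mulr1 big1 => [|y].
      by rewrite addr0; ring.
    by rewrite eq_sym => /andP[_ /negbTE->]; rewrite mulr0.
  by move=> y yc; rewrite positive_cliqueP //; ring.
have := cauchy_schwarz z w; rewrite zw ww.
have [->|Qn0] := eqVneq Q 0; first by move=> _; rewrite mulr_ge0 ?dot_ge0 //; lra.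
have Qp : 0 < Q by rewrite lt_neqAle eq_sym Qn0.
by rewrite expr2 mulrA ler_pM2r // [X in _ <= X]mulrC.
Qed.

Definition near (eta t : R) := exists2 m, m \is a Num.int & `|t - m| <= eta.

(** If all the deviations exceeded [om], their squares would add up to more than Bessel's
    inequality allows. So the inner product with the centroid is close to one with a member of
    the clique. The exception [x0] makes room for [z = v x0], with [x0] in the clique. *)
Lemma near_centroid c z x0 eta : positive_clique c -> dot z z <= 4 ->
  (forall x, x \in c.1 -> x != x0 -> near eta (dot z (switched c x))) ->
  near (eta + om) (dot z (centroid c)).
Proof.
have [e0 e1 o0 o1 oM] := parameter_bounds.
move=> cl z4 zc; have /andP[/eqP cM _] := cl.
have [x [xc xx0 zx]] : exists x, [/\ x \in c.1, x != x0 &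
    `|dot z (switched c x) - dot z (centroid c)| <= om].
  apply: contrapT => no_x; have := centroid_variance z cl; apply/negP; rewrite -ltNge.
  apply: (@lt_le_trans _ _ 9).
    by have := dot_ge0 z; nra.
  apply: (le_trans omM); apply: (@le_trans _ _ (\sum_(x in c.1 :\ x0) om ^+ 2)).
    rewrite sumr_const -[X in _ <= X]mulr_natl mulrC ler_wpM2r ?sqr_ge0 // ler_nat.
    by have := cardsD1 x0 c.1; rewrite cM; case: (_ \in _) => /=; lia.
  rewrite [X in _ <= X](bigID (mem (c.1 :\ x0))) /= -[X in X <= _]addr0; apply: lerD; last first.
    by apply: sumr_ge0 => x _; apply: sqr_ge0.
  rewrite [X in _ <= X](eq_bigl (mem (c.1 :\ x0))) => [|x]; last by rewrite !inE; case: (x == x0); rewrite ?andbF ?andbb.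
  apply: ler_sum => x; rewrite !inE => /andP[xx0 xc].
  rewrite -[X in _ <= X]real_normK ?num_real // ler_sqr ?nnegrE //; last exact: ltW.
  by rewrite leNgt; apply/negP => lt; apply: no_x; exists x; split=> //; apply: ltW.
have [m mZ zm] := zc x xc xx0; exists m => //.
rewrite -(subrKA (dot z (switched c x))); apply: le_trans (ler_normD _ _) _.
by rewrite addrC lerD // distrC.
Qed.

Lemma near_vertex x c : positive_clique c ->
  exists m, [/\ m = -1 \/ m = 0 \/ m = 1 & `|dot (v x) (centroid c) - m| <= om].
Proof.
have [e0 e1 o0 o1 oM] := parameter_bounds.
move=> cl; have [||m mZ xm] := near_centroid (z := v x) (x0 := x) (eta := 0) cl.
- by rewrite vertex_norm; lra.
- move=> y yc yx; exists (dot (v x) (switched c y)); last by rewrite subrr normr0.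
  by rewrite dotZr vertex_dot 1?eq_sym // rpredM // rpredX // rpredN rpred1.
exists m; rewrite add0r in xm; split=> //.
have : `|dot (v x) (centroid c)| <= 7 / 4.
  apply: dot_norm_le; first lra.
  rewrite vertex_norm centroid_norm //; have [s [-> s0 s1]] := clique_excess_small.
  by nra.
move: xm; rewrite !ler_norml => /andP[? ?] /andP[? ?].
have m4 : m ^+ 2 < 4 by nra.
by have [] := int_sqr_lt4 mZ m4; auto.
Qed.

Lemma near_centroids c d : positive_clique c -> positive_clique d ->
  exists m, [/\ m = -1 \/ m = 0 \/ m = 1 & `|dot (centroid c) (centroid d) - m| <= 2 * om].
Proof.
have [e0 e1 o0 o1 oM] := parameter_bounds.
move=> cl dl.
have [cM _] := andP cl.
have [x0 _] : exists x, x \in c.1 by apply/set0Pn; rewrite -card_gt0 (eqP cM).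
have [s [sE s0 s1]] := clique_excess_small.
have [||m mZ xm] := near_centroid (z := centroid c) (x0 := x0) (eta := om) dl.
- by rewrite centroid_norm // sE; lra.
- move=> y yd _; have [m [mE ym]] := near_vertex y cl.
  exists ((-1) ^+ d.2 y * m).
    rewrite rpredM ?rpredX ?rpredN ?rpred1 //.
    by case: mE => [->|[->|->]]; rewrite ?rpredN ?rpred0 ?rpred1.
  rewrite dotZr dotC -mulrBr normrM normrX normrN1 expr1n mul1r //.
have {}xm : `|dot (centroid c) (centroid d) - m| <= 2 * om.
  by move: xm; rewrite (_ : om + om = 2 * om) //; ring.
exists m; split=> //.
have : `|dot (centroid c) (centroid d)| <= 7 / 4.
  apply: dot_norm_le; first lra.
  by rewrite !centroid_norm // sE; nra.
move: xm; rewrite !ler_norml => /andP[? ?] /andP[? ?].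
have m4 : m ^+ 2 < 4 by nra.
by have [] := int_sqr_lt4 mZ m4; auto.
Qed.

(** Inner products of centroids are almost integral, so below [1/2] means almost orthogonal. *)
Definition independent_cliques (F : {set sclique}) : bool :=
  [forall c in F, positive_clique c] &&
  [forall c in F, forall d in F, (c != d) ==> (`|dot (centroid c) (centroid d)| < 2^-1)].

Variable F : {set sclique}.
Hypothesis maxF : maxset independent_cliques F.

Lemma family_clique c : c \in F -> positive_clique c.
Proof. by have /maxsetP[/andP[/forall_inP Fc _] _] := maxF; exact: Fc. Qed.

Lemma family_dot c d : c \in F -> d \in F ->
  `|dot (centroid c) (centroid d) - (c == d)%:R| <= 2 * om.
Proof.
have [e0 e1 o0 o1 oM] := parameter_bounds.
move=> cF dF; have [s [sE s0 s1]] := clique_excess_small; have [<-|cd] := eqVneq c d.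
  by rewrite centroid_norm ?family_clique // sE addrAC subrr add0r gtr0_norm //; lra.
have /maxsetP[/andP[_ /forall_inP Fi] _] := maxF.
have /forall_inP/(_ d dF)/implyP/(_ cd) := Fi c cF.
have [m [mE cm]] := near_centroids (family_clique cF) (family_clique dF) => lt2.
have m0 : m = 0.
  case: mE cm => [->|[->//|->]]; move: lt2; rewrite !ltr_norml ler_norml => /andP[? ?] /andP[? ?]; lra.
by rewrite m0 in cm.
Qed.

(** If the centroid of [c] is not almost orthogonal to that of [d], it is almost equal to it up to
    sign, so both have almost the same inner products with the vertices, up to sign. *)
Lemma clique_represented x c : positive_clique c -> x \in c.1 ->
  exists2 d, d \in F & om < `|dot (v x) (centroid d)|.
Proof.
have [e0 e1 o0 o1 oM] := parameter_bounds.
move=> cl xc; have [s [sE s0 s1]] := clique_excess_small.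
have vc : `|dot (v x) (centroid c)| = 1 + s.
  rewrite -[RHS]gtr0_norm -?sE; last by rewrite sE; lra.
  rewrite -(dot_switched_centroid cl xc) /switched dotZl normrM normrX normrN1 expr1n mul1r //.
have [cF|cF] := boolP (c \in F).
  by exists c => //; rewrite vc; lra.
have [d dF cd] : exists2 d, d \in F & 2^-1 <= `|dot (centroid c) (centroid d)|.
  apply: contrapT => no_d.
  have lt d : d \in F -> `|dot (centroid c) (centroid d)| < 2^-1.
    by move=> dF; rewrite ltNge; apply/negP => le; apply: no_d; exists d.
  have /maxsetP[/andP[/forall_inP Fc /forall_inP Fi] maxF'] := maxF.
  case/negP: cF; rewrite -(maxF' (c |: F)); rewrite ?setU11 ?finset.subsetUr //.
  apply/andP; split; first by apply/forall_inP => d /setU1P[->|/Fc].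
  apply/forall_inP => d1 /setU1P d1F; apply/forall_inP => d2 /setU1P d2F; apply/implyP.
  case: d1F d2F => [->|d1F] [->|d2F]; rewrite ?eqxx // => d12.
  - exact: lt.
  - by rewrite dotC; apply: lt.
  - by have /forall_inP/(_ d2 d2F)/implyP/(_ d12) := Fi d1 d1F.
have dl := family_clique dF; exists d => //; have [m [mE cm]] := near_centroids cl dl.
have mm : m ^+ 2 = 1.
  case: mE cm => [->|[->|->]]; rewrite ?sqrrN ?expr1n //.
  by rewrite subr0 => le; move: (le_trans cd le); lra.
have u2 : dot (centroid c - m *: centroid d) (centroid c - m *: centroid d) <= 6 * om.
  move: (centroid_norm cl) (centroid_norm dl) cm; rewrite sE.
  move: (centroid c) (centroid d) => u w uu ww.
  rewrite !(dotBl, dotBr, dotZl, dotZr) (dotC w) uu ww ler_norml => /andP[uw1 uw2].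
  move: mE mm uw1 uw2; move: (dot u w) => q; case=> [->|[->|->]] mm; rewrite ?expr0n /= in mm *; lra.
have : `|dot (v x) (centroid c - m *: centroid d)| <= 1 / 2.
  apply: dot_norm_le; first lra.
  by rewrite vertex_norm; nra.
have nm : `|m * dot (v x) (centroid d)| = `|dot (v x) (centroid d)|.
  by rewrite normrM; case: mE mm => [->|[->|->]] mm; rewrite ?normrN ?normr1 ?mul1r //; move: mm; rewrite expr0n /=; lra.
have split_dot (u w : 'cV[R]_p) : dot (v x) (u - m *: w) = dot (v x) u - m * dot (v x) w.
  by rewrite dotBr dotZr.
rewrite split_dot => le; have := lerB_dist (dot (v x) (centroid c)) (m * dot (v x) (centroid d)).
by rewrite vc nm; lra.
Qed.

Variable t : X -> sclique -> R.
Hypothesis tP : forall x c, c \in F -> (t x c = -1 \/ t x c = 0 \/ t x c = 1) /\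
  `|dot (v x) (centroid c) - t x c| <= om.

Definition support x : {set sclique} := [set c in F | t x c != 0].

Lemma support_t x c : c \in support x -> c \in F /\ t x c ^+ 2 = 1.
Proof.
rewrite inE => /andP[cF t0]; split=> //.
by have [[->|[t0'|->]] _] := tP x cF; rewrite ?sqrrN ?expr1n // t0' eqxx in t0 *.
Qed.

Lemma support_abs x c : c \in support x -> `|t x c| = 1.
Proof.
by case/support_t=> _ /eqP; rewrite sqrf_eq1 => /orP[]/eqP->; rewrite ?normrN normr1.
Qed.

(** Bessel's inequality: [v x] has norm close to 3 and inner products close to [+-1] with
    almost orthonormal centroids. *)
Lemma support_le3 x : (#|support x| <= 3)%N.
Proof.
have [e0 e1 o0 o1 oM] := parameter_bounds.
rewrite leqNgt; apply/negP => /card_geqP[s [us s4 sx]].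
pose T := [set c in s]; have T4 : #|T| = 4%N by rewrite cardsE (card_uniqP us).
have Tx c : c \in T -> c \in support x by rewrite inE => /sx.
pose z := \sum_(c in T) t x c *: centroid c.
have zz : dot z z <= 4 + 32 * om.
  rewrite -quad_gram; apply: (@le_trans _ _ (\sum_(c in T) (1 + 8 * om))); last first.
    by rewrite sumr_const T4 -[X in X <= _]mulr_natl; lra.
  apply: ler_sum => c cT; have [cF _] := support_t (Tx c cT).
  apply: (@le_trans _ _ (\sum_(d in T) ((c == d)%:R + 2 * om))).
    apply: ler_sum => d dT; have [dF _] := support_t (Tx d dT).
    apply: le_trans (ler_norm _) _; rewrite !normrM !support_abs ?Tx // !mul1r.
    have := ler_normD (dot (centroid c) (centroid d) - (c == d)%:R) (c == d)%:R.
    rewrite subrK normr_nat; have := family_dot cF dF; lra.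
  have s1 : \sum_(d in T) (c == d)%:R = 1 :> R.
    rewrite (bigD1 c) //= eqxx big1 ?addr0 // => d /andP[_].
    by rewrite eq_sym => /negbTE->.
  by rewrite big_split sumr_const T4 /= s1 -[X in _ + X <= _]mulr_natl; lra.
have vz : 4 - 4 * om <= dot (v x) z.
  rewrite dot_sumr; apply: (@le_trans _ _ (\sum_(c in T) (1 - om))).
    by rewrite sumr_const T4 -[X in _ <= X]mulr_natl; lra.
  apply: ler_sum => c cT; have [cF t1] := support_t (Tx c cT); rewrite dotZr.
  have [_] := tP x cF; rewrite ler_norml => /andP[].
  have /eqP := t1; rewrite sqrf_eq1 => /orP[]/eqP->; lra.
have := cauchy_schwarz (v x) z; rewrite vertex_norm; nra.
Qed.

Lemma sum_support x (f : sclique -> R) :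
  \sum_(c in F) t x c * f c = \sum_(c in support x) t x c * f c.
Proof.
rewrite (bigID (fun c => t x c != 0)) /= [X in _ + X]big1 ?addr0.
  by apply: eq_bigl => c; rewrite inE.
by move=> c /andP[_]; rewrite negbK => /eqP->; rewrite mul0r.
Qed.

Lemma sum_support_le x (f : sclique -> R) b : 0 <= b -> (forall c, c \in F -> `|f c| <= b) ->
  `|\sum_(c in F) t x c * f c| <= 3 * b.
Proof.
move=> b0 fb; rewrite sum_support; apply: le_trans (ler_norm_sum _ _ _) _.
apply: (@le_trans _ _ (\sum_(c in support x) b)).
  apply: ler_sum => c cx; rewrite normrM support_abs // mul1r; apply: fb.
  by case: (support_t cx).
rewrite sumr_const -[X in X <= _]mulr_natl ler_wpM2r // ler_nat; exact: support_le3.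
Qed.

(** The Gram matrix, in the limit of infinite cliques, of the vertices projected off all the
    clique directions. *)
Definition remainder_form x y : R := a x y + 3 * (x == y)%:R - \sum_(c in F) t x c * t y c.

Lemma t_int x c : c \in F -> t x c \is a Num.int.
Proof. by case/(tP x)=> [[->|[->|->]] _]; rewrite ?rpredN ?rpred0 ?rpred1. Qed.

Lemma t_le1 x c : c \in F -> `|t x c| <= 1.
Proof. by case/(tP x)=> [[->|[->|->]] _]; rewrite ?normrN ?normr0 ?normr1. Qed.

Lemma remainder_int x y : remainder_form x y \is a Num.int.
Proof.
rewrite rpredB ?rpredD ?rpredM ?natr_int ?aZ //.
by rewrite rpred_sum // => c cF; rewrite rpredM ?t_int.
Qed.

Lemma remainder_diag x : remainder_form x x = 3 - #|support x|%:R.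
Proof.
rewrite /remainder_form irra eqxx add0r mulr1 sum_support; congr (_ - _).
rewrite (eq_bigr (fun=> 1)) ?sumr_const // => c /support_t[_ <-].
by rewrite expr2.
Qed.

Lemma remainder_le4 x y : `|remainder_form x y| <= 4.
Proof.
have [<-|xy] := eqVneq x y.
  rewrite remainder_diag; have : (#|support x|%:R : R) <= 3 by rewrite ler_nat support_le3.
  have := ler0n R #|support x|; rewrite ler_norml; lra.
rewrite /remainder_form (negbTE xy) mulr0 addr0.
apply: le_trans (ler_normB _ _) _.
have := @sum_support_le x (t y) 1 ler01 (fun c cF => t_le1 y cF).
by have := a1 x y; lra.
Qed.

(** Each of the sums in the expansion has at most 3 nonzero terms on either side, with errors [om]
    or [2 * om] per term, which makes [3 + 3 + 18] times [om]. *)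
Lemma remainder_close x y :
  `|dot (v x - \sum_(c in F) t x c *: centroid c) (v y - \sum_(c in F) t y c *: centroid c)
    - remainder_form x y| <= eps + 24 * om.
Proof.
have [e0 e1 o0 o1 oM] := parameter_bounds.
pose A z w := \sum_(c in F) t w c * (dot (v z) (centroid c) - t z c).
pose B := \sum_(c in F) t x c * \sum_(d in F) t y d * (dot (centroid c) (centroid d) - (c == d)%:R).
have A3 z w : `|A z w| <= 3 * om.
  by apply: sum_support_le => [|c cF]; [exact: ltW|case: (tP z cF)].
have B18 : `|B| <= 3 * (3 * (2 * om)).
  apply: sum_support_le => [|c cF]; first by lra.
  by apply: sum_support_le => [|d dF]; [lra|exact: family_dot].
have AE z w : A z w = \sum_(c in F) t w c * dot (v z) (centroid c) - \sum_(c in F) t z c * t w c.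
  by rewrite -sumrB; apply: eq_bigr => c _; ring.
have BE : B = dot (\sum_(c in F) t x c *: centroid c) (\sum_(c in F) t y c *: centroid c)
    - \sum_(c in F) t x c * t y c.
  rewrite dot_suml -sumrB; apply: eq_bigr => c cF; rewrite dotZl -mulrBr; congr (_ * _).
  rewrite dot_sumr (eq_bigr (fun d => t y d * dot (centroid c) (centroid d) - t y d * (c == d)%:R)).
    rewrite sumrB; congr (_ - _); first by apply: eq_bigr => d _; rewrite [RHS]dotZr.
    rewrite (bigD1 c) //= eqxx mulr1 big1 ?addr0 // => d /andP[_].
    by rewrite eq_sym => /negbTE->; rewrite mulr0.
  by move=> d _; rewrite mulrBr.
have vsum z w : dot (v z) (\sum_(c in F) t w c *: centroid c) =
    \sum_(c in F) t w c * dot (v z) (centroid c).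
  by rewrite dot_sumr; apply: eq_bigr => c _; rewrite [LHS]dotZr.
rewrite (_ : dot _ _ - _ = eps * (x == y)%:R - A x y - A y x + B).
  have : `|eps * (x == y)%:R| <= eps.
    by case: (x == y); rewrite ?mulr1 ?mulr0 ?normr0 ?(ltW e0) ?gtr0_norm.
  move: (A3 x y) (A3 y x) B18; clear BE AE vsum A3.
  move: (A x y) (A y x) B (eps * _) => p1 p2 p3 p4.
  rewrite !ler_norml => /andP[? ?] /andP[? ?] /andP[? ?] /andP[? ?].
  by apply/andP; split; lra.
rewrite dotBl !dotBr [dot (\sum_(c in F) _) (v y)]dotC !vsum va !AE BE /remainder_form.
rewrite [\sum_(c in F) t y c * t x c](eq_bigr (fun c => t x c * t y c)) => [|c _]; last exact: mulrC.
ring.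
Qed.

Lemma remainder_psd K delta : eps + 24 * om <= delta ->
  (forall (D : {set X}) (S S' : X -> X -> R), (#|D| <= K)%N ->
    {in D &, forall x y, S x y \is a Num.int} -> {in D &, forall x y, `|S x y| <= 4} ->
    {in D &, forall x y, `|S' x y - S x y| <= delta} -> psd_on D S' -> psd_on D S) ->
  forall D : {set X}, (#|D| <= K)%N -> psd_on D remainder_form.
Proof.
move=> le_delta stable D DK; pose r x := v x - \sum_(c in F) t x c *: centroid c.
apply: (stable D _ (fun x y => dot (r x) (r y)) DK) => [x y _ _|x y _ _|x y _ _|].
- exact: remainder_int.
- exact: remainder_le4.
- exact: le_trans (remainder_close x y) le_delta.
- by apply: (gram_psd (v := r)) => x y.
Qed.

Lemma support_gt0 x c : positive_clique c -> x \in c.1 -> (0 < #|support x|)%N.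
Proof.
move=> cl xc; have [d dF xd] := clique_represented cl xc.
rewrite card_gt0; apply/set0Pn; exists d; rewrite inE dF /=.
apply/eqP => t0; have [_] := tP x dF; rewrite t0 subr0 => le.
by move: (lt_le_trans xd le); rewrite ltxx.
Qed.

End Cliques.

(** * Cliques at vertices of large valency *)

Section RamseyCliques.
Variables (R : realType) (X : finType) (a : X -> X -> R) (p : nat) (v : X -> 'cV[R]_p).
Variables (eps : R) (M N : nat).
Hypotheses (eps0 : 0 < eps) (eps1 : eps <= 1 / 100).
Hypotheses (syma : forall x y, a x y = a y x) (irra : forall x, a x x = 0).
Hypotheses (aZ : forall x y, a x y \is a Num.int) (a1 : forall x y, `|a x y| <= 1).
Hypothesis va : forall x y, dot (v x) (v y) = a x y + (3 + eps) * (x == y)%:R.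
Hypothesis ramseyN : forall (e : rel X) (A : {set X}), symmetric e -> (N <= #|A|)%N ->
  (exists C : {set X}, [/\ C \subset A, #|C| = M & {in C &, forall x y, x != y -> e x y}]) \/
  (exists C : {set X}, [/\ C \subset A, #|C| = 11%N & {in C &, forall x y, x != y -> ~~ e x y}]).

(** Switch so that all edges at [x] are positive. By Ramsey's theorem the neighbourhood has a large
    positive clique or 11 neighbours with pairwise nonpositive inner products; in the second case
    the sum of these 11 vectors contradicts the Cauchy-Schwarz inequality, since [11 > (3 + eps)^2]. *)
Lemma vertex_in_clique x : (N <= #|[set y | a x y != 0%R]|)%N ->
  exists2 c, positive_clique v M c & x \in c.1.
Proof.
move=> valx; pose w y := a x y *: v y.
have a2 y : y \in [set y | a x y != 0%R] -> a x y ^+ 2 = 1.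
  rewrite inE; case: (entry_cases aZ a1 x y) => ->; rewrite ?sqrrN ?expr1n // eqxx //.
have xw y : y \in [set y | a x y != 0%R] -> dot (v x) (w y) = 1.
  move=> yN; have xy : x != y by apply: contraTneq yN => <-; rewrite inE irra eqxx.
  by rewrite dotZr (vertex_dot va xy) -expr2 a2.
have [|[C [sCN CM Ce]]|[C [sCN C11 Ce]]] := ramseyN (e := fun y z => dot (w y) (w z) == 1) _ valx.
- by move=> y z; rewrite dotC.
- have sCN' := fintype.subsetP sCN.
  have xC : x \notin C by apply/negP => /sCN'; rewrite inE irra eqxx.
  pose tau : {ffun X -> bool} := [ffun y => (y != x) && (a x y == -1)].
  exists (x |: C, tau); last by rewrite setU11.
  have swx : switched v (x |: C, tau) x = v x.
    by rewrite /switched /= ffunE eqxx expr0 scale1r.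
  have swy y : y \in C -> switched v (x |: C, tau) y = w y.
    move=> yC; rewrite /switched /= ffunE (_ : y != x) /=; last by apply: contraNneq xC => <-.
    rewrite /w; have := sCN' y yC; rewrite inE.
    have n11 : (1 == -1 :> R) = false by rewrite gt_eqF //; lra.
    by case: (entry_cases aZ a1 x y) => ->; rewrite ?eqxx ?n11 //= ?expr1 ?expr0.
  rewrite /positive_clique /= cardsU1 xC CM eqxx /=.
  apply/forall_inP => y /setU1P yP; apply/forall_inP => z /setU1P zP; apply/implyP.
  case: yP zP => [->|yC] [->|zC]; rewrite ?eqxx ?swx ?swy // => yz.
  + by rewrite xw // sCN'.
  + by rewrite dotC xw // sCN'.
  + exact: Ce.
exfalso; have sCN' := fintype.subsetP sCN.
pose u := \sum_(y in C) w y.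
have xu : dot (v x) u = 11.
  rewrite dot_sumr (eq_bigr (fun=> 1)) => [|y yC]; last by rewrite xw ?sCN'.
  by rewrite sumr_const C11.
have uu : dot u u <= 11 * (3 + eps).
  rewrite dot_suml; apply: (@le_trans _ _ (\sum_(y in C) (3 + eps))); last first.
    by rewrite sumr_const C11 -[X in X <= _]mulr_natl.
  apply: ler_sum => y yC; rewrite dot_sumr (bigD1 y) //= -[X in _ <= X]addr0; apply: lerD.
    by rewrite dotZl dotZr mulrA -expr2 a2 ?sCN' // mul1r (vertex_norm irra va).
  apply: sumr_le0 => z /andP[zC zy]; have yz : y != z by rewrite eq_sym.
  have := Ce y z yC zC yz.
  rewrite dotZl dotZr (vertex_dot va yz); set m := a x y * _ => m1.
  have mZ : m \is a Num.int by rewrite !rpredM.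
  have m4 : m ^+ 2 < 4.
    rewrite (_ : m ^+ 2 = a x y ^+ 2 * a x z ^+ 2 * a y z ^+ 2); last by rewrite /m; ring.
    rewrite !a2 ?sCN' // !mul1r; case: (entry_cases aZ a1 y z) => ->; lra.
  have [->|->|m1'] := int_sqr_lt4 mZ m4; [lra|by []|by rewrite m1' eqxx in m1].
have e0 := eps0; have e1 := eps1.
have := cauchy_schwarz (v x) u; rewrite xu (vertex_norm irra va); nra.
Qed.

End RamseyCliques.

(** * The structure of signed graphs of large valency *)

Section Structure.
Variable R : realType.

(** The remainder form is integral with diagonal entries at most 2. On sets of bounded size it is
    a small perturbation of a Gram matrix, so it is positive semidefinite there by stability;
    hence it embeds. What was subtracted is a sum of rank one integral forms. *)
Lemma large_valency_embeds : exists (eps : R) (kappa : nat), [/\ 0 < eps, (0 < kappa)%N &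
  forall (X : finType) (a : X -> X -> R),
    (forall x y, a x y = a y x) -> (forall x, a x x = 0) ->
    (forall x y, a x y \is a Num.int) -> (forall x y, `|a x y| <= 1) ->
    psd_on setT (fun x y => a x y + (3 + eps) * (x == y)%:R) ->
    (forall x, (kappa <= #|[set y | a x y != 0%R]|)%N) ->
    embeds (fun x y => a x y + 3 * (x == y)%:R)].
Proof.
have [K embK] := embeds_of_local_psd R.
have [delta delta0 stable] := psd_stable R K.
pose om := Num.min (1 / 1000) (delta / 48); pose eps := Num.min (1 / 100) (delta / 2).
have om0 : 0 < om by rewrite lt_min !divr_gt0 ?ltr01 ?ltr0n.
have eps0 : 0 < eps by rewrite lt_min !divr_gt0 ?ltr01 ?ltr0n.
have om1 : om <= 1 / 1000 by rewrite ge_min lexx.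
have eps1 : eps <= 1 / 100 by rewrite ge_min lexx.
have err : eps + 24 * om <= delta.
  have : om <= delta / 48 by rewrite ge_min lexx orbT.
  have : eps <= delta / 2 by rewrite ge_min lexx orbT.
  lra.
have [M omM] : exists M : nat, 9 <= om ^+ 2 * M%:R.
  have om2 : 0 < om ^+ 2 by rewrite exprn_gt0.
  exists (Num.bound (9 / om ^+ 2)); rewrite mulrC -ler_pdivrMr //.
  by apply/ltW/archi_boundP; rewrite divr_ge0 // ?ler0n // ltW.
have [N ramseyN] := ramsey M 11.
exists eps, N.+1; split=> // X a syma irra aZ a1 psda vala.
have symS x y : a x y + (3 + eps) * (x == y)%:R = a y x + (3 + eps) * (y == x)%:R.
  by rewrite syma eq_sym.
have [p [v vS]] := psd_gram symS psda.
have va x y : dot (v x) (v y) = a x y + (3 + eps) * (x == y)%:R by rewrite vS ?inE.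
have ind0 : independent_cliques v M finset.set0.
  by apply/andP; split; apply/forall_inP => c; rewrite inE.
have [F maxF _] := maxset_exists ind0.
have Fcl := family_clique maxF.
have /choice[t tP] : forall xc : X * sclique X, exists s : R, xc.2 \in F ->
    (s = -1 \/ s = 0 \/ s = 1) /\ `|dot (v xc.1) (centroid v M xc.2) - s| <= om.
  move=> [x c]; have [cF|_] := boolP (c \in F); last by exists 0.
  by have [s [? ?]] := near_vertex eps0 eps1 om0 om1 omM irra aZ va x (Fcl c cF); exists s.
pose T x c := t (x, c).
have TP x c : c \in F -> (T x c = -1 \/ T x c = 0 \/ T x c = 1) /\
    `|dot (v x) (centroid v M c) - T x c| <= om by move=> cF; apply: (tP (x, c)).
have embS : embeds (remainder_form a F T).
  apply: embK => [x y|x y|x|D DK].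
  - rewrite /remainder_form syma eq_sym; congr (_ - _).
    by apply: eq_bigr => c _; rewrite mulrC.
  - exact: (remainder_int aZ TP x y).
  - rewrite (remainder_diag irra TP).
    have [|c cl xc] := @vertex_in_clique R X a p v eps M N eps0 eps1 irra aZ a1 va (ramseyN X) x.
      by apply: leq_trans (vala x).
    have := support_gt0 eps0 eps1 om0 om1 omM irra aZ va maxF TP cl xc.
    by rewrite -(ler_nat R); lra.
  - exact: (remainder_psd eps0 eps1 om0 om1 omM irra aZ a1 va maxF TP err (stable X) DK).
have embT : embeds (fun x y => \sum_(c in F) T x c * T y c).
  apply: (@embeds_ext R X (fun x y => \sum_(c in F) (fun x y => (if c \in F then T x c else 0) * (if c \in F then T y c else 0)) x y)).
    by move=> x y; apply: eq_bigr => c ->.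
  apply: embeds_sum => c cF; apply: embeds_rank1 => x; rewrite cF; exact: (t_int TP x cF).
apply: embeds_ext (embeds_add embS embT) => x y.
by rewrite /remainder_form subrK.
Qed.

End Structure.

(** * Isometric lattices *)

Section Isometry.
Variable R : realType.

Definition column_sum m q (N : 'M[R]_(m, q)) (z : 'I_q -> int) : 'cV[R]_m := \sum_j col j N *~ z j.

Lemma dot_column_sum m m' q (N : 'M[R]_(m, q)) (W : 'M[R]_(m', q)) :
  (forall i j, dot (col i N) (col j N) = dot (col i W) (col j W)) ->
  forall z z', dot (column_sum N z) (column_sum N z') = dot (column_sum W z) (column_sum W z').
Proof.
move=> NW z z'; rewrite /column_sum !dot_suml; apply: eq_bigr => i _.
rewrite !dot_sumr; apply: eq_bigr => j _.
by rewrite -!scaler_int !dotZl !dotZr NW.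
Qed.

Lemma column_sumB m q (N : 'M[R]_(m, q)) z z' :
  column_sum N z - column_sum N z' = column_sum N (fun j => z j - z' j).
Proof. by rewrite -sumrB; apply: eq_bigr => j _; rewrite mulrzBr. Qed.

Lemma column_sumD m q (N : 'M[R]_(m, q)) z z' :
  column_sum N z + column_sum N z' = column_sum N (fun j => z j + z' j).
Proof. by rewrite -big_split; apply: eq_bigr => j _; rewrite mulrzDr. Qed.

Lemma column_latticeP m q (N : 'M[R]_(m, q)) x :
  column_lattice N x <-> exists z : 'I_q -> int, x = column_sum N z.
Proof.
split=> [[z _ <-]|[z ->]]; first by exists z.
by exists [ffun j => z j] => //; apply: eq_bigr => j _; rewrite ffunE.
Qed.

(** Two integer combinations of columns are equal when their difference has norm 0, which depends
    on the Gram matrix only. *)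
Lemma gram_isomorphic_lattices m m' q (N : 'M[R]_(m, q)) (W : 'M[R]_(m', q)) :
  (forall i j, dot (col i N) (col j N) = dot (col i W) (col j W)) ->
  isomorphic_lattices (column_lattice N) (column_lattice W).
Proof.
move=> NW; have dotNW := dot_column_sum NW.
have /choice[zz zzP] : forall x : 'cV[R]_m, exists z : 'I_q -> int,
    column_lattice N x -> x = column_sum N z.
  move=> x; have [/column_latticeP[z ->]|nx] := pselect (column_lattice N x); first by exists z.
  by exists (fun=> 0).
pose f x := column_sum W (zz x).
have eqW z z' : column_sum N z = column_sum N z' -> column_sum W z = column_sum W z'.
  move=> Nz; apply/eqP; rewrite -subr_eq0; apply/eqP/dot_eq0.
  by rewrite column_sumB -dotNW -column_sumB Nz subrr dot0l.
have eqN z z' : column_sum W z = column_sum W z' -> column_sum N z = column_sum N z'.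
  move=> Nz; apply/eqP; rewrite -subr_eq0; apply/eqP/dot_eq0.
  by rewrite column_sumB dotNW -column_sumB Nz subrr dot0l.
have fE z : f (column_sum N z) = column_sum W z.
  by apply: eqW; rewrite -zzP //; apply/column_latticeP; exists z.
exists f; split.
- split.
  + by move=> _ /column_latticeP[z ->]; apply/column_latticeP; exists z; rewrite fE.
  + move=> x y /set_mem/column_latticeP[z ->] /set_mem/column_latticeP[z' ->].
    by rewrite !fE; apply: eqN.
  + move=> _ /column_latticeP[z ->]; exists (column_sum N z); last exact: fE.
    by apply/column_latticeP; exists z.
- move=> _ _ /column_latticeP[z ->] /column_latticeP[z' ->].
  by rewrite column_sumD !fE column_sumD.
- move=> _ _ /column_latticeP[z ->] /column_latticeP[z' ->].
  by rewrite !fE dotNW.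
Qed.

Lemma lattice_pow_subgroup m (L : set 'cV[R]_m) k : subgroup L -> subgroup (lattice_pow L k).
Proof.
move=> sgL; elim: k => [|k [IH0 IHB]]; first by split.
split.
  split; first by rewrite -[usubmx _]/(usubmx (0 : 'cV[R]_(m + k * m))) raddf0; apply: subgroup0.
  by rewrite -[dsubmx _]/(dsubmx (0 : 'cV[R]_(m + k * m))) raddf0.
move=> x y [x1 x2] [y1 y2]; split.
  by rewrite -[usubmx _]/(usubmx ((x : 'cV[R]_(m + k * m)) - y)) raddfB; apply: subgroupB.
by rewrite -[dsubmx _]/(dsubmx ((x : 'cV[R]_(m + k * m)) - y)) raddfB; apply: IHB.
Qed.

Lemma Zlattice_subgroup n : subgroup (Zlattice R n).
Proof.
split; first by exists 0 => //; rewrite map_mx0.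
by move=> _ _ [x _ <-] [y _ <-]; exists (x - y) => //; rewrite map_mxB.
Qed.

Lemma lattice_sum_subgroup m m' (L : set 'cV[R]_m) (L' : set 'cV[R]_m') :
  subgroup L -> subgroup L' -> subgroup (lattice_sum L L').
Proof.
move=> sgL sgL'; split; first by split; rewrite raddf0; apply: subgroup0.
by move=> x y [x1 x2] [y1 y2]; split; rewrite raddfB; apply: subgroupB.
Qed.

Lemma embeds_iso_to_sublattice m q (N : 'M[R]_(m, q)) :
  embeds (fun i j => dot (col i N) (col j N)) ->
  exists n k : nat, iso_to_sublattice (column_lattice N)
    (lattice_sum (Zlattice R n) (lattice_pow (E8 R) k)).
Proof.
move=> /embeds_vectors[n [k [w [wL wS]]]]; exists n, k.
have sgT : subgroup (lattice_sum (Zlattice R n) (lattice_pow (E8 R) k)).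
  apply: lattice_sum_subgroup; first exact: Zlattice_subgroup.
  exact/lattice_pow_subgroup/E8_subgroup.
pose W : 'M[R]_(n + k * 8, q) := \matrix_(i, j) w j i 0.
have colW j : col j W = w j by apply/matrixP => i z; rewrite ord1 !mxE.
exists (column_lattice W).
  split.
  - move=> _ /column_latticeP[z ->]; apply: subgroup_sum => // j _.
    by rewrite colW; apply: subgroupMz.
  - by apply/column_latticeP; exists (fun=> 0); rewrite /column_sum big1 // => j _; rewrite mulr0z.
  - move=> _ _ /column_latticeP[z ->] /column_latticeP[z' ->].
    by apply/column_latticeP; exists (fun j => z j - z' j); rewrite column_sumB.
by apply: gram_isomorphic_lattices => i j; rewrite !colW wS.
Qed.

End Isometry.

(** * The adjacency form of a signed graph *)

Section Adjacency.
Variables (R : realType) (G : signed_graph).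
Let A := adjmx R G.
Let a i j := A i j.
Let lam := lambda_min R G.

Lemma adjmx_sym i j : a i j = a j i.
Proof. by rewrite /a !mxE /signed_entry adj_sym finset.setUC. Qed.

Lemma adjmx_diag i : a i i = 0.
Proof. by rewrite /a mxE /signed_entry adj_irr. Qed.

Lemma adjmx_int i j : a i j \is a Num.int.
Proof.
by rewrite /a mxE /signed_entry; do 2?case: ifP => _; rewrite ?rpredN ?rpred1 ?rpred0.
Qed.

Lemma adjmx_le1 i j : `|a i j| <= 1.
Proof.
by rewrite /a mxE /signed_entry; do 2?case: ifP => _; rewrite ?normrN ?normr1 ?normr0 ?ler01.
Qed.

Lemma adjmx_neq0 i j : (a i j != 0) = adj (enum_val i) (enum_val j).
Proof.
by rewrite /a mxE /signed_entry; do 2?case: ifP => _; rewrite ?oppr_eq0 ?oner_eq0 ?eqxx.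
Qed.

Lemma card_adjmx i : #|[set j | a i j != 0%R]| = valency (enum_val i).
Proof.
rewrite -(card_imset _ enum_val_inj) /valency; apply: eq_card => y; rewrite inE.
apply/imsetP/idP => [[j]|xy]; first by rewrite inE adjmx_neq0 => xj ->.
by exists (enum_rank y); rewrite ?enum_rankK // inE adjmx_neq0 enum_rankK.
Qed.

Lemma adjmx_form (c : R) (u : 'I_#|G| -> R) :
  \sum_(i in setT) \sum_(j in setT) u i * u j * (a i j + c * (i == j)%:R) =
  qform A (\col_i u i) + c * dot (\col_i u i) (\col_i u i).
Proof.
rewrite /qform /dot mulr_sumr -big_split /=; apply: eq_big => [i|i _]; first by rewrite inE.
rewrite (eq_bigr (fun j => u i * (a i j * u j) + c * u i * (u j * (i == j)%:R))) => [|j _]; last by ring.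
rewrite big_split /= -!mulr_sumr !mxE; congr (_ * _ + _).
  apply: eq_big => [j|j _]; first by rewrite inE.
  by rewrite /a; congr (_ * _); rewrite mxE.
rewrite (bigD1 i) ?inE //= eqxx mulr1 big1 ?addr0; first by rewrite mulrA.
by move=> j /andP[_]; rewrite eq_sym => /negbTE->; rewrite mulr0.
Qed.

Lemma adjmx_psd (c : R) : - c <= lam -> psd_on setT (fun i j => a i j + c * (i == j)%:R).
Proof.
move=> lamc u; rewrite adjmx_form; have [_ /(_ (\col_i u i))] := lambda_minP R G.
have := dot_ge0 (\col_i u i); rewrite -/lam -/A; nra.
Qed.

Lemma psd_lambda_min (c : R) : psd_on setT (fun i j => a i j + c * (i == j)%:R) -> - c <= lam.
Proof.
move=> psd; have [/eigenvalueP[w wA w0] _] := lambda_minP R G.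
have := psd (fun i => w 0 i); rewrite adjmx_form.
have -> : \col_i w 0 i = w^T by apply/matrixP => i j; rewrite ord1 !mxE.
have symA : A^T = A by apply/matrixP => i j; rewrite mxE; exact: adjmx_sym.
have -> : qform A w^T = lam * dot w^T w^T.
  by rewrite /qform -{1}symA -trmx_mul wA linearZ dotZr.
have ww : 0 < dot w^T w^T.
  rewrite lt_neqAle dot_ge0 andbT eq_sym; apply: contra w0 => /eqP/dot_eq0 w0.
  by rewrite -[w]trmxK w0 trmx0.
by rewrite -mulrDl pmulr_lge0 //; lra.
Qed.

End Adjacency.

Theorem theorem1p3 (R : realType) :
  exists (eps : R) (kappa3 : nat),
    [/\ 0 < eps, (0 < kappa3)%N &
      forall G : signed_graph,
        connected G ->
        - 3 - eps < lambda_min R G ->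
        (forall x : G, (kappa3 <= valency x)%N) ->
        - 3 <= lambda_min R G /\
        (forall (m : nat) (N : 'M[R]_(m, #|G|)),
          N^T *m N = shifted_adjmx R G ->
          exists n k : nat,
            iso_to_sublattice (column_lattice N)
              (lattice_sum (Zlattice R n) (lattice_pow (E8 R) k)))].
Proof.
have [eps [kappa [eps0 kappa0 emb]]] := large_valency_embeds R.
exists eps, kappa; split=> // G _ lamG valG.
have emb3 : embeds (fun i j => adjmx R G i j + 3 * (i == j)%:R).
  apply: emb.
  - exact: adjmx_sym.
  - exact: adjmx_diag.
  - exact: adjmx_int.
  - exact: adjmx_le1.
  - by apply: adjmx_psd; lra.
  - by move=> i; rewrite card_adjmx.
have lam3 : - 3 <= lambda_min R G by apply: psd_lambda_min; apply: embeds_psd.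
split=> // m N NN; apply: embeds_iso_to_sublattice.
have dotN i j : dot (col i N) (col j N) =
    adjmx R G i j + (- (Num.floor (lambda_min R G))%:~R) * (i == j)%:R.
  have /matrixP/(_ i j) := NN; rewrite !mxE => NNij; rewrite mulNr mulr_natr -NNij.
  by apply: eq_bigr => k _; rewrite !mxE.
set f := Num.floor (lambda_min R G) in dotN.
have f3 : -3 <= f by rewrite /f floor_ge_int rmorphN.
(* If the floor is -3, the form to embed is A + 3. Otherwise its diagonal entries are at most 2. *)
have [f3'|f2] : f = -3 \/ -2 <= f by lia.
  by apply: embeds_ext emb3 => i j; rewrite dotN f3' rmorphN opprK.
have [K embK] := embeds_of_local_psd R.
apply: embK => [i j|i j|i|T _].
- exact: dotC.
- by rewrite dotN rpredD ?adjmx_int // rpredM ?rpredN ?intr_int ?natr_int.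
- rewrite dotN (adjmx_diag R) add0r eqxx mulr1.
  by rewrite -rmorphN -[2]/(2%:~R) ler_int; lia.
- by apply: (gram_psd (v := fun i => col i N)) => i j.
Qed.
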